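(* Let $E$ be a finite alphabet, let $g$ be a regular $g$-function on $E$ with $\prod_{k\ge 0}a_k>0$, let $(X_i)_{i\in\mathbb{Z}}$ be a $g$-chain, and let $(T_i)_{i\in\mathbb{Z}}$ be a regeneration process for $(X_i)_{i\in\mathbb{Z}}$. Let $f\colon E\to\mathbb{R}$ be a function such that $\mathbb{E}(f(X_0))=0$. Then, as $n\to\infty$, $$\frac{1}{\sqrt n}\,S_n:=\frac{1}{\sqrt n}\sum_{i=0}^{n-1}f(X_i)\;\longrightarrow\;\mathcal{N}(0,\sigma^2)\quad\text{in distribution},$$ with $$0\le \sigma^2=\frac{\mathbb{E}\Big(\big(\sum_{i=T_1}^{T_2-1}f(X_i)\big)^2\Big)}{\mathbb{E}(T_2-T_1)}<\infty .$$ Furthermore, if $\mathbb{E}\big((T_2-T_1)^2\big)<\infty$, then $$\sigma^2=\mathbb{E}\big(f^2(X_0)\big)+2\sum_{i\ge 1}\mathbb{E}\big(f(X_0)f(X_i)\big)<\infty .$$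
   Context: Notation. $E$ is a finite set with the discrete $\sigma$-algebra; $\Omega=E^{\mathbb{Z}}$ with its product $\sigma$-algebra $\mathcal{F}$. For $\omega\in\Omega$ and $-\infty\le k\le n<\infty$, $\omega_k^n=(\omega_i)_{k\le i\le n}$, and $\Omega_k^n$ is the set of all such configurations. Juxtaposition $\sigma_{-k}^{-1}\,\omega_{-\infty}^{-k-1}$ denotes the configuration on $(-\infty,-1]$ that equals $\sigma$ on $[-k,-1]$ and $\omega$ on $(-\infty,-k-1]$. $\mathcal{F}_{\le -1}$ is the $\sigma$-algebra generated by coordinates with index $\le -1$. $\mathcal{N}(0,0)$ means the point mass at $0$. A $g$-function is a probability kernel $g\colon E\times\Omega_{-\infty}^{-1}\to[0,1]$, $\sum_{\omega_0\in E}g(\omega_0\mid\omega_{-\infty}^{-1})=1$ for all $\omega_{-\infty}^{-1}$. It is regular if it is (a) continuous: for all $\epsilon>0$ there is $n\ge0$ with $|g(\omega_0\mid\omega_{-\infty}^{-1})-g(\sigma_0\mid\sigma_{-\infty}^{-1})|<\epsilon$ whenever $\omega_{-n}^0=\sigma_{-n}^0$; and (b) bounded away from zero: $g(\omega_0\mid\cdot)\ge c>0$ for each $\omega_0\in E$. A probability measure $\mathbb{P}$ on $(\Omega,\mathcal{F})$ is consistent with $g$ if it is shift-invariant and $\int h(\omega)g(x\mid\omega)\,\mathbb{P}(d\omega)=\int_{\{\omega_0=x\}}h(\omega)\,\mathbb{P}(d\omega)$ for all $x\in E$ and all $\mathcal{F}_{\le -1}$-measurable $h$ (bounded, say). A $g$-chain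 is the coordinate process $(X_i)_{i\in\mathbb{Z}}$ under a consistent $\mathbb{P}$. For $k\ge 0$, $$a_k=\inf_{\sigma_{-k}^{-1}\in\Omega_{-k}^{-1}}\ \sum_{\xi_0\in E}\ \inf_{\omega_{-\infty}^{-k-1}\in\Omega_{-\infty}^{-k-1}} g\big(\xi_0\mid\sigma_{-k}^{-1}\,\omega_{-\infty}^{-k-1}\big),$$ with $\sigma_0^{-1}=\emptyset$ when $k=0$. Let $\rho_M$, $M\ge 0$, be the probability that the Markov chain on $\{0,1,2,\dots\}$ started at $0$ with transition probabilities $p(k,k+1)=a_k$, $p(k,0)=1-a_k$, is at $0$ at time $M$ (so $\rho_0=1$). A regeneration process for $(X_i)$ is a sequence of integer-valued random times $(T_i)_{i\in\mathbb{Z}}$, defined on the same (possibly enlarged) probability space as $(X_i)$, such that: $T_i<T_{i+1}$ for all $i$ and $T_0\le 0<T_1$; $(T_i)$ is a shift-invariant (stationary) renewal process, i.e. the law of the random set $\{T_i\}\subset\mathbb{Z}$ is translation invariant, with $\mathbb{P}(T_{i+1}-T_i\ge M)=\rho_{M-1}$ for all integers $M\ge1$ and $i\ne 0$; and the random blocks $\{(X_j\colon T_i\le j<T_{i+1})\}_{i\in\mathbb{Z}}$ (of random length) are independent and, except for $i=0$, identically distributed. It is known (Comets, Fernández, Ferrari) that if $g$ is regular and $\prod_{k\ge0}a_k>0$ then there is a unique $\mathbb{P}$ consistent with $g$, a regeneration process exists, and $\mathbb{E}(T_2-T_1)=\sum_{M\ge 1}\mathbb{P}(T_2-T_1\ge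 M)<\infty$. *)

(* Defs.v *)
From HB Require Import structures.
From mathcomp Require Import all_boot all_order all_algebra.
From mathcomp Require Import all_classical all_reals all_analysis.

Set Implicit Arguments.
Unset Strict Implicit.
Unset Printing Implicit Defensive.

Import Order.TTheory GRing.Theory Num.Theory.
Import numFieldNormedType.Exports.

Local Open Scope classical_set_scope.
Local Open Scope ring_scope.

(* Measurable types of the library are pointed, so the alphabet carries a
   distinguished letter; it plays no role beyond witnessing nonemptiness. *)
#[short(type="pointedFinType")]
HB.structure Definition PointedFinite := {E of Finite E & Pointed E}.

(** ** Configuration spaces *)

(* Generators of the sigma-algebra of the coordinates with index in D, the
   alphabet being discrete. *)
Definition coord_events (I E : Type) (D : set I) : set (set (I -> E)) :=
  [set A | exists i, D i /\ exists B : set E, A = [set w | B (w i)]].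

Definition configuration (I : Type) (E : pointedType) :=
  g_sigma_algebraType (@coord_events I E setT).

Notation Omega E := (configuration int E).

(* A past (w_i)_{i <= -1} is read backwards: entry n of [u : Past E] is the
   letter at time -(n+1). *)
Notation Past E := (configuration nat E).

Definition past (E : pointedType) (w : Omega E) : Past E :=
  fun n => w (- n.+1%:Z).

Definition time_shift (E : pointedType) (w : Omega E) : Omega E :=
  fun i => w (i + 1).

(* [mu] is only evaluated on measurable sets; it is the law of a random
   configuration, possibly unbundled. *)
Definition shift_invariant (R : realType) (E : pointedType)
    (mu : set (Omega E) -> \bar R) : Prop :=
  forall A : set (Omega E), measurable A -> mu (@time_shift E @^-1` A) = mu A.

(* Measurability with respect to the coordinates of index at most -1. *)
Definition past_measurable (R : realType) (E : pointedType)
    (h : Omega E -> R) : Prop :=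
  measurable_fun setT
    (h : g_sigma_algebraType (@coord_events int E [set i | i < 0]) -> R).

(** ** g-functions and g-chains *)

(* [g x u] is g(x | u). *)
Definition g_function (R : realType) (E : pointedFinType)
    (g : E -> Past E -> R) : Prop :=
  [/\ forall x, measurable_fun setT (g x),
      forall x u, 0 <= g x u <= 1
    & forall u, \sum_(x : E) g x u = 1].

Definition regular_g (R : realType) (E : pointedFinType)
    (g : E -> Past E -> R) : Prop :=
  [/\ g_function g,
      forall e : R, 0 < e -> exists n : nat, forall (x : E) (u v : Past E),
        (forall i, (i < n)%N -> u i = v i) -> `|g x u - g x v| < e
    & exists2 c : R, 0 < c & forall x u, c <= g x u].

Definition consistent (R : realType) (E : pointedFinType)
    (g : E -> Past E -> R) (Q : probability (Omega E) R) : Prop :=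
  shift_invariant Q /\
  forall (x : E) (h : Omega E -> R), past_measurable h ->
    (exists M : R, forall w, `|h w| <= M) ->
    (\int[Q]_w (h w * g x (past w))%:E =
     \int[Q]_(w in [set w : Omega E | w 0%R = x]) (h w)%:E)%E.

(* The process lives on a probability space (T, P) that may be larger than
   the configuration space; X_i is [fun w => X w i]. *)
Definition g_chain (R : realType) (E : pointedFinType) (g : E -> Past E -> R)
    (d : measure_display) (T : measurableType d) (P : probability T R)
    (X : {RV P >-> Omega E}) : Prop :=
  consistent g (distribution P X).

(** ** The coefficients a_k and rho_M *)

(* The past equal to sigma on [-k, -1] and to w further back: both arguments
   are read backwards, and entry n of w is the letter at time -(k+1+n). *)
Definition juxtapose (E : pointedType) (k : nat) (sigma : 'I_k -> E)
    (w : Past E) : Past E :=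
  fun n => if insub n is Some j then sigma j else w (n - k)%N.

Definition g_coef (R : realType) (E : pointedFinType) (g : E -> Past E -> R)
    (k : nat) : R :=
  inf (range (fun sigma : 'I_k -> E =>
    \sum_(x : E) inf (range (fun w : Past E => g x (juxtapose sigma w))))).

(* Transition matrix of the chain j -> j+1 with probability a_j, j -> 0 with
   probability 1 - a_j. *)
Definition house_of_cards (R : realType) (a : nat -> R) (j k : nat) : R :=
  if k == j.+1 then a j else if k == 0%N then 1 - a j else 0.

(* Law at time M of the Markov chain on nat with transition matrix p started
   at 0. The sum over the previous state j is finite because the chains
   considered here increase by at most one per step, hence are in {0, .., M}
   at time M. *)
Fixpoint chain_law (R : realType) (p : nat -> nat -> R) (M k : nat) : R :=
  if M is M'.+1 then \sum_(j < M'.+1) chain_law p M' j * p j k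
  else (k == 0%N)%:R.

Definition rho (R : realType) (E : pointedFinType) (g : E -> Past E -> R)
    (M : nat) : R :=
  chain_law (house_of_cards (g_coef g)) M 0%N.

(** ** Regeneration processes *)

Section regeneration.
Context {R : realType} {E : pointedFinType} {d : measure_display}
  {T : measurableType d} (P : probability T R).

(* The word X_{T_i} ... X_{T_{i+1} - 1}, forgetting its location. *)
Definition block (X : {RV P >-> Omega E}) (tau : int -> T -> int) (i : int)
    (w : T) : seq E :=
  [seq X w (tau i w + j%:Z) | j <- iota 0 `|tau (i + 1)%R w - tau i w|%N].

Definition block_sum (f : E -> R) (X : {RV P >-> Omega E})
    (tau : int -> T -> int) (i : int) (w : T) : R :=
  \sum_(x <- block X tau i w) f x.

(* The random set {T_i : i}, as a configuration of 0s and 1s. *)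
Definition renewal_set (tau : int -> T -> int) (w : T) : Omega bool :=
  fun k => `[< exists i, tau i w = k >].

(* Mutual independence of discrete random elements. *)
Definition independent_family (S : Type) (Y : int -> T -> S) : Prop :=
  forall (s : seq int) (B : int -> set S), uniq s ->
    P (\bigcap_(i in [set` s]) (Y i @^-1` B i)) =
    (\prod_(i <- s) P (Y i @^-1` B i))%E.

Definition regeneration_process (g : E -> Past E -> R)
    (X : {RV P >-> Omega E}) (tau : int -> T -> int) : Prop :=
  [/\ forall (i k : int), measurable [set w | tau i w = k],
      {ae P, forall w, (forall i, tau i w < tau (i + 1) w) /\
                       tau 0 w <= 0 < tau 1 w},
      shift_invariant (pushforward P (renewal_set tau)),
      forall (i : int) (M : nat), i != 0 -> (1 <= M)%N ->
        P [set w | M%:Z <= tau (i + 1) w - tau i w] = (rho g M.-1)%:E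
    & independent_family (block X tau) /\
      forall (i j : int) (B : set (seq E)), i != 0 -> j != 0 ->
        P (block X tau i @^-1` B) = P (block X tau j @^-1` B)].

End regeneration.

(** ** Convergence in distribution *)

(* The normal law with mean 0 and variance v; [normal_prob] is the uniform
   law on [0, 1] when its standard deviation is 0, whence the case split. *)
Definition centered_normal (R : realType) (v : R) :
    probability (measurableTypeR R) R :=
  if v == 0 then (\d_(0 : measurableTypeR R) : probability _ R)
  else normal_prob 0 (Num.sqrt v).

Definition cvg_in_distribution (R : realType) (d : measure_display)
    (T : measurableType d) (P : probability T R) (Y : nat -> T -> R)
    (nu : probability (measurableTypeR R) R) : Prop :=
  forall h : R -> R, continuous h -> (exists M : R, forall x, `|h x| <= M) ->
    ('E_P[h \o Y n] @[n --> \oo] --> \int[nu]_x (h x)%:E)%E.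

(* Main.v *)
From HB Require Import structures.
Require Import Defs.
From mathcomp Require Import all_boot all_order all_algebra.
From mathcomp Require Import all_classical all_reals all_analysis.
From mathcomp Require Import measurable_realfun ring lra zify.

Import Order.TTheory GRing.Theory Num.Theory.
Import numFieldNormedType.Exports.

Set Implicit Arguments.
Unset Strict Implicit.
Unset Printing Implicit Defensive.

Local Open Scope classical_set_scope.
Local Open Scope ring_scope.

(* A g-chain forgets its past at the rate [rho]: under the transfer operator of
   [g] the oscillation of [f] is dominated by the return probabilities of the
   house-of-cards chain, which are summable since the product of the [a_k] is
   positive.  This decoupling bounds the second and fourth moments of the partial
   sums [S_n], and the maximum of [|S_k|] over windows of length of order [n].

   The blocks between regenerations are i.i.d. and of finite mean length, so
   their sums [Y_i] satisfy [Y_1 + ... + Y_m = O(sqrt m)] in probability.  This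
   tightness alone forces [E Y_1^2 < oo] and [E Y_1 = 0].  Lindeberg's method gives
   the central limit theorem for the block sums.  With [m = n / E L], [L] the length
   of a block, the law of large numbers for the lengths and the maximal inequality
   show that [S_n] differs from the sum of [m] blocks by [o(sqrt n)] in probability.

   Finally [S_n^2 / n] is uniformly integrable by the fourth moment bound, so its
   mean tends to [sigma2]; expanding the square, this mean is the Cesaro mean
   of the partial sums of the covariance series. *)

(** * Means and discrete random elements *)

(** Block lengths are only known to have a finite mean, and nothing relates the times [tau] to a
    filtration, so moments of block sums cannot be read off the lengths. All moment bounds are taken
    at deterministic times, from the chain, and reach the blocks by comparing sample paths outside
    events of small probability. Hence the maximal inequality: a random index is replaced by a
    supremum over a deterministic window. Hence also the detour for the variance: a bound in
    probability keeps the characteristic function of a sum of m blocks away from 0. Its squared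
    modulus is the m-th power of that of one block, and one minus the latter controls truncated
    second moments. Blocks are words over a finite alphabet, hence countably many. Independence and
    equality of laws are checked on atoms, and an independent copy is a second mean over the same
    space, so no product space is built. The limit variance may vanish, so Lindeberg's replacement
    runs against a Gaussian family that contains the point masses. It tests functions with a cubic
    Taylor remainder; cubic splines supply enough of them explicitly. *)

Section mean.
Context {d : measure_display} {T : measurableType d} {R : realType}.
Variable P : probability T R.
Implicit Types Y Z : T -> R.

Definition integ Z := P.-integrable setT (EFin \o Z).

(** [fine] sends an infinite integral to 0, so the linearity rules below ask for [integ]. *)
Definition mean Z : R := \int[P]_w Z w.

Lemma expectation_mean Z : integ Z -> ('E_P[Z] = (mean Z)%:E)%E.
Proof. by move=> iZ; rewrite unlock /mean /Rintegral fineK//; exact: integrable_fin_num. Qed.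

Lemma integral_mean Z : integ Z -> (\int[P]_w (Z w)%:E = (mean Z)%:E)%E.
Proof. by move=> iZ; rewrite -expectation_mean// unlock. Qed.

Lemma integ_measurable Z : integ Z -> measurable_fun setT Z.
Proof. by move=> /measurable_int/measurable_EFinP. Qed.

Lemma integ_bounded Z (M : R) : measurable_fun setT Z -> (forall w, `|Z w| <= M) -> integ Z.
Proof.
move=> mZ ZM; apply: measurable_bounded_integrable => //.
  by rewrite (le_lt_trans (probability_le1 P measurableT))// ltry.
exists M; split; first exact: num_real.
by move=> x Mx w _ /=; rewrite (le_trans (ZM w))// ltW.
Qed.

Lemma integ_le Y Z : measurable_fun setT Y -> (forall w, `|Y w| <= Z w) ->
  integ Z -> integ Y.
Proof.
move=> mY YZ; apply: le_integrable => //; first exact/measurable_EFinP.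
by move=> w _ /=; rewrite lee_fin (le_trans (YZ w))// ler_norm.
Qed.

Lemma integ_cst (c : R) : integ (fun=> c).
Proof. exact: finite_measure_integrable_cst. Qed.

Lemma integD Y Z : integ Y -> integ Z -> integ (fun w => Y w + Z w).
Proof. exact: integrableD. Qed.

Lemma integB Y Z : integ Y -> integ Z -> integ (fun w => Y w - Z w).
Proof. exact: integrableB. Qed.

Lemma integZ (c : R) Z : integ Z -> integ (fun w => c * Z w).
Proof. exact: integrableZl. Qed.

Lemma integ_norm Z : integ Z -> integ (fun w => `|Z w|).
Proof. exact: integrable_norm. Qed.

Lemma integ_sum I (s : seq I) (p : pred I) (Z : I -> T -> R) :
  (forall i, p i -> integ (Z i)) -> integ (fun w => \sum_(i <- s | p i) Z i w).
Proof.
move=> iZ; rewrite /integ.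
rewrite (_ : _ \o _ = fun w => (\sum_(i <- s | p i) (EFin \o Z i) w)%E).
  exact: integrable_sum.
by apply/funext => w /=; rewrite sumEFin.
Qed.

Lemma mean_cst (c : R) : mean (fun=> c) = c.
Proof. by rewrite /mean Rintegral_cst// (congr1 fine (probability_setT P)) mulr1. Qed.

Lemma meanD Y Z : integ Y -> integ Z -> mean (fun w => Y w + Z w) = mean Y + mean Z.
Proof. by move=> *; rewrite /mean RintegralD. Qed.

Lemma meanB Y Z : integ Y -> integ Z -> mean (fun w => Y w - Z w) = mean Y - mean Z.
Proof. by move=> *; rewrite /mean RintegralB. Qed.

Lemma meanZ c Z : integ Z -> mean (fun w => c * Z w) = c * mean Z.
Proof. by move=> *; rewrite /mean RintegralZl. Qed.

Lemma mean_sum I (s : seq I) (p : pred I) (Z : I -> T -> R) :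
  (forall i, p i -> integ (Z i)) ->
  mean (fun w => \sum_(i <- s | p i) Z i w) = \sum_(i <- s | p i) mean (Z i).
Proof.
move=> iZ; elim: s => [|i s ih].
  by rewrite big_nil; under [X in mean X]eq_fun do rewrite big_nil; rewrite mean_cst.
rewrite big_cons; under [X in mean X]eq_fun do rewrite big_cons.
by case: ifPn => pi; rewrite ?meanD ?ih//; [exact: iZ | exact: integ_sum].
Qed.

Lemma ler_mean Y Z : integ Y -> integ Z -> (forall w, Y w <= Z w) -> mean Y <= mean Z.
Proof. by move=> *; apply: le_Rintegral => //. Qed.

Lemma mean_ge0 Z : (forall w, 0 <= Z w) -> 0 <= mean Z.
Proof. by move=> *; apply: Rintegral_ge0. Qed.

Lemma normr_mean Z : integ Z -> `|mean Z| <= mean (fun w => `|Z w|).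
Proof. by move=> *; apply: le_normr_Rintegral. Qed.

Lemma mean_le_cst Z (c : R) : integ Z -> (forall w, Z w <= c) -> mean Z <= c.
Proof. by move=> iZ Zc; rewrite -[leRHS]mean_cst ler_mean//; exact: integ_cst. Qed.

Lemma normr_mean_le Z (c : R) : integ Z -> (forall w, `|Z w| <= c) -> `|mean Z| <= c.
Proof.
move=> iZ Zc; rewrite (le_trans (normr_mean iZ))// mean_le_cst//.
exact: integ_norm.
Qed.

Lemma eq_mean Y Z : Y =1 Z -> mean Y = mean Z.
Proof. by move=> /funext ->. Qed.

Lemma ae_eq_mean Y Z : measurable_fun setT Y -> measurable_fun setT Z ->
  {ae P, forall w, Y w = Z w} -> mean Y = mean Z.
Proof.
move=> mY mZ YZ; rewrite /mean /Rintegral; congr fine.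
apply: ae_eq_integral => //; [exact/measurable_EFinP|exact/measurable_EFinP|].
by apply: filterS YZ => w -> _.
Qed.

Definition bounded_rv Z := measurable_fun setT Z /\ exists M : R, forall w, `|Z w| <= M.

Lemma bounded_integ Z : bounded_rv Z -> integ Z.
Proof. by move=> [mZ [M ZM]]; exact: integ_bounded ZM. Qed.

Lemma bounded_cst (c : R) : bounded_rv (fun=> c).
Proof. by split; [exact: measurable_cst|exists `|c|]. Qed.

Lemma boundedD Y Z : bounded_rv Y -> bounded_rv Z -> bounded_rv (fun w => Y w + Z w).
Proof.
move=> [mY [M YM]] [mZ [N ZN]]; split; first exact: measurable_funD.
by exists (M + N) => w; rewrite (le_trans (ler_normD _ _))// lerD.
Qed.

Lemma boundedM Y Z : bounded_rv Y -> bounded_rv Z -> bounded_rv (fun w => Y w * Z w).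
Proof.
move=> [mY [M YM]] [mZ [N ZN]]; split; first exact: measurable_funM.
by exists (M * N) => w; rewrite normrM ler_pM.
Qed.

Lemma boundedX Z n : bounded_rv Z -> bounded_rv (fun w => Z w ^+ n).
Proof.
move=> bZ; elim: n => [|n ih].
  by under eq_fun do rewrite expr0; exact: bounded_cst.
by under eq_fun do rewrite exprS; exact: boundedM.
Qed.

Lemma boundedZ c Z : bounded_rv Z -> bounded_rv (fun w => c * Z w).
Proof. by move=> bZ; apply: boundedM => //; exact: bounded_cst. Qed.

Lemma boundedN Z : bounded_rv Z -> bounded_rv (fun w => - Z w).
Proof. by under eq_fun do rewrite -mulN1r; exact: boundedZ. Qed.

Lemma boundedB Y Z : bounded_rv Y -> bounded_rv Z -> bounded_rv (fun w => Y w - Z w).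
Proof. by move=> bY bZ; apply: boundedD => //; exact: boundedN. Qed.

Lemma bounded_norm Z : bounded_rv Z -> bounded_rv (fun w => `|Z w|).
Proof.
move=> [mZ [M ZM]]; split; first exact: measurableT_comp.
by exists M => w; rewrite normr_id.
Qed.

(** The target carries no sigma-algebra: all preimages are measurable, so any function of a discrete
    element is again discrete, without a side condition. *)
Definition discrete_rv (S : Type) (U : T -> S) := forall B : set S, measurable (U @^-1` B).

Lemma discrete_measurable Z : discrete_rv Z -> measurable_fun setT Z.
Proof. by move=> dZ _ B _; rewrite setTI. Qed.

Lemma discrete_comp (S S' : Type) (h : S -> S') (U : T -> S) :
  discrete_rv U -> discrete_rv (fun w => h (U w)).
Proof. by move=> dU B; exact: (dU (h @^-1` B)). Qed.

Lemma discrete_cst (S : Type) (s : S) : discrete_rv (fun=> s).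
Proof. by move=> B; rewrite preimage_cst; case: ifP. Qed.

Lemma discrete_countable (S : countType) (U : T -> S) :
  (forall s, measurable (U @^-1` [set s])) -> discrete_rv U.
Proof.
move=> mU B.
rewrite (_ : U @^-1` B = \bigcup_n
    (if unpickle n is Some s then U @^-1` ([set s] `&` B) else set0)).
  apply: bigcupT_measurable => n; case: unpickle => // s.
  have [Bs|nBs] := pselect (B s).
    by rewrite setIidl// => _ ->.
  by rewrite (_ : _ `&` _ = set0) ?preimage_set0// -subset0 => _ [/= ->].
apply/seteqP; split=> [w Bw|w [n _] /=].
  by exists (pickle (U w)) => //; rewrite pickleK.
by case: unpickle => // s [_ /= ].
Qed.

Lemma discrete_pair (S S' : countType) (U : T -> S) (V : T -> S') :
  discrete_rv U -> discrete_rv V -> discrete_rv (fun w => (U w, V w)).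
Proof.
move=> dU dV; apply: discrete_countable => -[s s'].
rewrite (_ : _ @^-1` _ = (U @^-1` [set s]) `&` (V @^-1` [set s'])).
  exact: measurableI.
by apply/seteqP; split=> [w [<- <-]|w [/= -> ->]].
Qed.

Lemma discrete_map2 (S S' : countType) (S'' : Type) (h : S -> S' -> S'')
    (U : T -> S) (V : T -> S') :
  discrete_rv U -> discrete_rv V -> discrete_rv (fun w => h (U w) (V w)).
Proof.
move=> dU dV; exact: (discrete_comp (fun p => h p.1 p.2) (discrete_pair dU dV)).
Qed.

Lemma discrete_mkseq (S : countType) (U : nat -> T -> S) n :
  (forall i, discrete_rv (U i)) -> discrete_rv (fun w => mkseq (U^~ w) n).
Proof.
move=> dU; elim: n => [|n ih]; first exact: discrete_cst.
have -> : (fun w => mkseq (U^~ w) n.+1) = (fun w => rcons (mkseq (U^~ w) n) (U n w)).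
  by apply/funext => w; rewrite /mkseq -addn1 iotaD map_cat cats1.
exact: discrete_map2.
Qed.

Lemma bounded_discrete Z (M : R) : discrete_rv Z -> (forall w, `|Z w| <= M) -> bounded_rv Z.
Proof. by move=> dZ ZM; split; [exact: discrete_measurable|exists M]. Qed.

Lemma bounded_bool (b : T -> bool) : discrete_rv b -> bounded_rv (fun w => (b w)%:R).
Proof.
move=> db; apply: (@bounded_discrete _ 1); first exact: (discrete_comp (fun c : bool => c%:R)).
by move=> w; case: (b w); rewrite ?normr1 ?normr0.
Qed.

(** As means of indicators, probabilities obey union and Markov bounds by pointwise inequalities. *)
Definition pr (b : T -> bool) : R := mean (fun w => (b w)%:R).

Lemma pr_ge0 b : 0 <= pr b.
Proof. by apply: mean_ge0 => w; exact: ler0n. Qed.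

Lemma pr_fine (b : T -> bool) : discrete_rv b -> (P (b @^-1` [set true]) = (pr b)%:E)%E.
Proof.
move=> db; rewrite -expectation_mean; last exact/bounded_integ/bounded_bool.
rewrite -(expectation_indic P (db [set true])); congr expectation; apply/funext => w.
rewrite indicE; congr ((nat_of_bool _)%:R).
by apply/idP/idP => [/set_mem//|bw]; exact/mem_set.
Qed.

End mean.

(** [mean] is made opaque further down; this equation remains the access to the integral. *)
Lemma meanE d (T : measurableType d) (R : realType) (P : probability T R) (Z : T -> R) :
  mean P Z = fine (\int[P]_w (Z w)%:E).
Proof. by []. Qed.

(** * Laws and independence of discrete elements, checked on atoms *)

Section discrete_mean.
Context {d : measure_display} {T : measurableType d} {R : realType}.
Variable P : probability T R.
Implicit Types Y Z : T -> R.

Lemma cvg_mean (Zn : nat -> T -> R) Z G :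
  (forall n, measurable_fun setT (Zn n)) -> measurable_fun setT Z -> integ P G ->
  (forall n w, `|Zn n w| <= G w) -> (forall w, Zn n w @[n --> \oo] --> Z w) ->
  mean P (Zn n) @[n --> \oo] --> mean P Z.
Proof.
move=> mZn mZ iG ZG ZnZ.
have [] := @dominated_convergence _ _ _ P setT measurableT
  (fun n w => (Zn n w)%:E) (EFin \o Z) (EFin \o G).
- by move=> n; exact/measurable_EFinP.
- exact/measurable_EFinP.
- by apply: aeW => w _; apply: cvg_EFin; [exact: nearW|exact: ZnZ].
- exact: iG.
- by apply: aeW => w n _ /=; rewrite lee_fin.
move=> iZ _ + ; rewrite /mean /Rintegral => h.
by apply: fine_cvg; rewrite fineK//; exact: integrable_fin_num.
Qed.

(** The fibers of [U] are enumerated by the codes of its values and recombined by dominated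
    convergence. Identities known on atoms thus extend to bounded functions. *)
Lemma cvg_mean_fibers (S : countType) (U : T -> S) Z : discrete_rv U ->
  bounded_rv Z ->
  \sum_(n < N) mean P (fun w => (pickle (U w) == n)%:R * Z w) @[N --> \oo]
    --> mean P Z.
Proof.
move=> dU [mZ [M ZM]].
have bb n : bounded_rv (fun w => (pickle (U w) == n)%:R : R).
  by apply: bounded_bool; exact: (discrete_comp (fun s => pickle s == n)).
rewrite (_ : (fun N : nat => _) =
    (fun N => mean P (fun w => (pickle (U w) < N)%N%:R * Z w))); last first.
  apply/funext => N; rewrite -mean_sum; last first.
    move=> i _; apply/bounded_integ/boundedM; [exact: bb|by split; [|exists M]].
  apply: eq_mean => w; rewrite -mulr_suml; congr (_ * _).
  have [UN|UN] := ltnP (pickle (U w)) N.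
    rewrite (bigD1 (Ordinal UN))//= eqxx big1 ?addr0// => i /eqP/val_eqP /= iU.
    by rewrite eq_sym (negbTE iU).
  rewrite big1// => i _; case: eqP => // UE; move: (ltn_ord i).
  by rewrite -UE ltnNge UN.
apply: (@cvg_mean _ _ (fun=> M)) => //.
- move=> n; apply: measurable_funM => //; apply: discrete_measurable.
  exact: (discrete_comp (fun s => (pickle s < n)%N%:R)).
- exact: integ_cst.
- move=> n w; rewrite normrM normr_nat (le_trans _ (ZM w))//.
  by rewrite ler_piMl// lern1 leq_b1.
- move=> w; apply: cvg_near_cst; near=> N.
  rewrite (_ : (pickle (U w) < N)%N) ?mul1r//.
  by near: N; exact: nbhs_infty_gt.
Unshelve. all: by end_near. Qed.

(** On a fiber of [U] the factor [G (U w)] is constant; a code [n] of no value gives an empty fiber,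
    where both sides vanish. *)
Lemma mean_fiber (S : countType) (U : T -> S) (b : T -> bool) (n : nat)
    (G : S -> R) (c : R) :
  (forall s, mean P (fun w => (U w == s)%:R * (b w)%:R) = c * pr P (fun w => U w == s)) ->
  discrete_rv U -> discrete_rv b ->
  mean P (fun w => (pickle (U w) == n)%:R * ((b w)%:R * G (U w))) =
  c * mean P (fun w => (pickle (U w) == n)%:R * G (U w)).
Proof.
move=> h dU db.
have [[s sn]|ns] := pselect (exists s : S, pickle s = n); last first.
  have z : forall w, (pickle (U w) == n) = false.
    by move=> w; apply/eqP => Un; apply: ns; exists (U w).
  under eq_mean do rewrite z mul0r.
  under [in RHS]eq_mean do rewrite z mul0r.
  by rewrite mean_cst mulr0.
have e w : (pickle (U w) == n) = (U w == s).
  by rewrite -sn (inj_eq (pcan_inj pickleK)).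
have e1 w : (pickle (U w) == n)%:R * ((b w)%:R * G (U w)) =
    G s * ((U w == s)%:R * (b w)%:R).
  by rewrite e; case: eqP => [->|_]; rewrite ?mul1r ?mul0r ?mulr0// mulrC.
have e2 w : (pickle (U w) == n)%:R * G (U w) = G s * (U w == s)%:R.
  by rewrite e; case: eqP => [->|_]; rewrite ?mul1r ?mul0r ?mulr0// mulr1.
have bU : bounded_rv (fun w => (U w == s)%:R : R).
  by apply: bounded_bool; exact: (discrete_comp (fun x => x == s)).
under eq_mean do rewrite e1.
under [in RHS]eq_mean do rewrite e2.
rewrite !meanZ ?h; [by rewrite /pr mulrCA|exact: bounded_integ|].
by apply/bounded_integ/boundedM => //; exact: bounded_bool.
Qed.

Lemma mean_indep_indic (S : countType) (U : T -> S) (b : T -> bool)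
    (G : S -> R) (c M : R) :
  (forall s, mean P (fun w => (U w == s)%:R * (b w)%:R) = c * pr P (fun w => U w == s)) ->
  discrete_rv U -> discrete_rv b -> (forall s, `|G s| <= M) ->
  mean P (fun w => (b w)%:R * G (U w)) = c * mean P (fun w => G (U w)).
Proof.
move=> h dU db GM.
have bG : bounded_rv (fun w => G (U w)).
  by apply: (@bounded_discrete _ _ _ _ M) => //; exact: discrete_comp.
have l1 : \sum_(n < N) mean P (fun w => (pickle (U w) == n)%:R * ((b w)%:R * G (U w)))
    @[N --> \oo] --> mean P (fun w => (b w)%:R * G (U w)).
  by apply: cvg_mean_fibers => //; apply: boundedM => //; exact: bounded_bool.
have l2 : c * \sum_(n < N) mean P (fun w => (pickle (U w) == n)%:R * G (U w))
    @[N --> \oo] --> c * mean P (fun w => G (U w)).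
  by apply: cvgM; [exact: cvg_cst|apply: cvg_mean_fibers].
rewrite -(cvg_lim (@Rhausdorff _) l1) -(cvg_lim (@Rhausdorff _) l2).
congr (lim (_ @ \oo)); apply/funext => N; rewrite mulr_sumr; apply: eq_bigr => n _; by rewrite (mean_fiber _ _ h).
Qed.

Lemma mean_same_law (S : countType) (U V : T -> S) (G : S -> R) (M : R) :
  discrete_rv U -> discrete_rv V ->
  (forall s, pr P (fun w => U w == s) = pr P (fun w => V w == s)) ->
  (forall s, `|G s| <= M) ->
  mean P (fun w => G (U w)) = mean P (fun w => G (V w)).
Proof.
move=> dU dV UV GM.
have bG (W : T -> S) : discrete_rv W -> bounded_rv (fun w => G (W w)).
  by move=> dW; apply: (@bounded_discrete _ _ _ _ M) => //; exact: discrete_comp.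
have l1 := cvg_mean_fibers dU (bG _ dU).
have l2 := cvg_mean_fibers dV (bG _ dV).
rewrite -(cvg_lim (@Rhausdorff _) l1) -(cvg_lim (@Rhausdorff _) l2).
congr (lim (_ @ \oo)); apply/funext => N; apply: eq_bigr => n _.
have [[s sn]|ns] := pselect (exists s : S, pickle s = n); last first.
  have z (W : T -> S) : forall w, (pickle (W w) == n) = false.
    by move=> w; apply/eqP => Un; apply: ns; exists (W w).
  by apply: eq_mean => w; rewrite !z !mul0r.
have e (W : T -> S) w : (pickle (W w) == n)%:R * G (W w) = G s * (W w == s)%:R.
  rewrite -sn (inj_eq (pcan_inj pickleK)).
  by case: eqP => [->|_]; rewrite ?mul1r ?mul0r ?mulr0// mulr1.
under eq_mean do rewrite e.
under [in RHS]eq_mean do rewrite e.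
have bW (W : T -> S) : discrete_rv W -> integ P (fun w => (W w == s)%:R : R).
  move=> dW; apply/bounded_integ/bounded_bool.
  exact: (discrete_comp (fun x => x == s)).
by rewrite !meanZ ?bW//; congr (_ * _); rewrite -/(pr P _) UV.
Qed.

(** Fubini for independent discrete elements: the inner mean over [w'] plays the part of an
    independent copy of [V]. *)
Lemma mean_indep (S S' : countType) (U : T -> S) (V : T -> S')
    (F : S -> S' -> R) (M : R) :
  discrete_rv U -> discrete_rv V ->
  (forall s s', pr P (fun w => (U w == s) && (V w == s')) =
                pr P (fun w => U w == s) * pr P (fun w => V w == s')) ->
  (forall s s', `|F s s'| <= M) ->
  mean P (fun w => F (U w) (V w)) =
  mean P (fun w => mean P (fun w' => F (U w) (V w'))).
Proof.
move=> dU dV UV FM.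
have bF : bounded_rv (fun w => F (U w) (V w)).
  by apply: (@bounded_discrete _ _ _ _ M) => //; exact: discrete_map2.
have bFs s : bounded_rv (fun w => F s (V w)).
  by apply: (@bounded_discrete _ _ _ _ M) => //; exact: discrete_comp.
have bG : bounded_rv (fun w => mean P (fun w' => F (U w) (V w'))).
  apply: (@bounded_discrete _ _ _ _ M).
    exact: (discrete_comp (fun s => mean P (fun w' => F s (V w')))).
  by move=> w; apply: normr_mean_le => //; exact: bounded_integ.
have l1 := cvg_mean_fibers dU bF.
have l2 := cvg_mean_fibers dU bG.
rewrite -(cvg_lim (@Rhausdorff _) l1) -(cvg_lim (@Rhausdorff _) l2).
congr (lim (_ @ \oo)); apply/funext => N; apply: eq_bigr => n _.
have [[s sn]|ns] := pselect (exists s : S, pickle s = n); last first.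
  have z : forall w, (pickle (U w) == n) = false.
    by move=> w; apply/eqP => Un; apply: ns; exists (U w).
  by apply: eq_mean => w; rewrite !z !mul0r.
have e w : (pickle (U w) == n)%:R * F (U w) (V w) = (U w == s)%:R * F s (V w).
  rewrite -sn (inj_eq (pcan_inj pickleK)).
  by case: eqP => [->|_]; rewrite ?mul0r.
have e2 w : (pickle (U w) == n)%:R * mean P (fun w' => F (U w) (V w')) =
    mean P (fun w' => F s (V w')) * (U w == s)%:R.
  rewrite -sn (inj_eq (pcan_inj pickleK)).
  by case: eqP => [->|_]; rewrite ?mul0r ?mulr0// mulrC.
under eq_mean do rewrite e.
under [in RHS]eq_mean do rewrite e2.
have dUs : discrete_rv (fun w => U w == s) by exact: (discrete_comp (fun x => x == s)).
rewrite meanZ; last exact/bounded_integ/bounded_bool.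
rewrite [RHS]mulrC.
apply: (@mean_indep_indic _ V (fun w => U w == s) (F s) _ M) => // s'.
rewrite -/(pr P (fun w => U w == s)) -UV; apply: eq_mean => w.
by rewrite mulrC -natrM mulnb.
Qed.

End discrete_mean.

Section iid.
Context {d : measure_display} {T : measurableType d} {R : realType}.
Variable P : probability T R.
Context {S : countType}.
Implicit Types U : nat -> T -> S.

(** Independence is sequential, each element against the word of its predecessors: the form needed
    by inductions that peel off the last summand. *)
Definition iid U := [/\ forall i, discrete_rv (U i),
  forall i s, pr P (fun w => U i w == s) = pr P (fun w => U 0%N w == s)
  & forall n (v : seq S) s,
      pr P (fun w => (mkseq (U^~ w) n == v) && (U n w == s)) =
      pr P (fun w => mkseq (U^~ w) n == v) * pr P (fun w => U n w == s)].

(** The last element is separated from the word by independence, then replaced by [U 0], which has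
    the same law. *)
Lemma iid_mean U (F : seq S -> S -> R) (M : R) n : iid U ->
  (forall v s, `|F v s| <= M) ->
  mean P (fun w => F (mkseq (U^~ w) n) (U n w)) =
  mean P (fun w => mean P (fun w' => F (mkseq (U^~ w') n) (U 0%N w))).
Proof.
move=> [dU lU iU] FM; have dV := discrete_mkseq n dU.
rewrite (@mean_indep _ _ _ P _ _ (U n) (fun w => mkseq (U^~ w) n)
  (fun s v => F v s) M) //; last first.
  by move=> s v; rewrite mulrC -iU; apply: eq_mean => w; rewrite andbC.
apply: (@mean_same_law _ _ _ P _ (U n) (U 0%N)
  (fun s => mean P (fun w' => F (mkseq (U^~ w') n) s)) M) => // s.
apply: normr_mean_le => //; apply: (@integ_bounded _ _ _ _ _ M) => //.
exact: (discrete_measurable (discrete_comp (fun v => F v s) dV)).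
Qed.

End iid.

(** * Normal laws *)

Section normal.
Context {R : realType}.
Implicit Types (x y z m s b c l : R).
Local Notation leb := (@lebesgue_measure R).

(** The Radon-Nikodym derivative of the normal law is almost everywhere its density, since both have
    the same integral over every measurable set. *)
Lemma ge0_integral_normal m s (f : R -> \bar R) : (forall x, 0 <= f x)%E ->
  measurable_fun setT f ->
  (\int[normal_prob m s]_x f x = \int[leb]_x (f x * (normal_pdf m s x)%:E))%E.
Proof.
move=> f0 mf.
have dom := normal_prob_dominates m s.
rewrite -(Radon_Nikodym_SigmaFinite.change_of_variables dom)//.
have mpdf : measurable_fun setT (fun x => (normal_pdf m s x)%:E).
  apply/measurable_EFinP; exact: (@measurable_normal_pdf R m s).
apply: ae_eq_integral => //.
- apply: emeasurable_funM => //.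
  exact: measurable_int (Radon_Nikodym_SigmaFinite.f_integrable dom).
- exact: emeasurable_funM.
apply: ae_eqe_mul2l; apply: integral_ae_eq => //.
- exact: Radon_Nikodym_SigmaFinite.f_integrable.
- move=> A _ mA; rewrite -Radon_Nikodym_SigmaFinite.f_integral//.
Qed.

Lemma normal_pdfE0 m s x : s != 0 ->
  normal_pdf m s x = normal_peak s * expR (- (x - m) ^+ 2 / (s ^+ 2 *+ 2)).
Proof. by move=> s0; rewrite /normal_pdf (negbTE s0). Qed.

(** Completing the square: the joint density of two successive Gaussian steps is the density of the
    endpoint times that of the intermediate point given the endpoint, whose mean and deviation
    appear in the last factor. *)
Lemma normal_pdf_mul x y z s b : 0 < s -> 0 < b ->
  normal_pdf y b z * normal_pdf x s y =
  normal_pdf x (Num.sqrt (s ^+ 2 + b ^+ 2)) z *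
  normal_pdf ((x * b ^+ 2 + z * s ^+ 2) / (s ^+ 2 + b ^+ 2))
    (s * b / Num.sqrt (s ^+ 2 + b ^+ 2)) y.
Proof.
move=> s0 b0; set c : R := Num.sqrt _.
have c2 : c ^+ 2 = s ^+ 2 + b ^+ 2.
  by rewrite sqr_sqrtr// addr_ge0// sqr_ge0.
have c0 : 0 < c by rewrite sqrtr_gt0 ltr_wpDl ?sqr_ge0// exprn_gt0.
rewrite !normal_pdfE0 ?gt_eqF ?divr_gt0 ?mulr_gt0//.
rewrite mulrACA -expRD [RHS]mulrACA -expRD; congr (_ * _).
  rewrite /normal_peak -!invfM -!sqrtrM ?mulrn_wge0 ?mulr_ge0 ?sqr_ge0 ?pi_ge0 ?(ltW c0) ?(ltW b0) ?(ltW s0)//.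
  congr (Num.sqrt _)^-1; field; lra.
have sb0 : s ^+ 2 + b ^+ 2 != 0 by rewrite -c2 expf_neq0// gt_eqF.
congr expR; rewrite !exprMn exprVn c2.
field; rewrite sb0 !gt_eqF//.
Qed.

(** Variances of successive Gaussian steps add: after Tonelli, [normal_pdf_mul] lets the
    intermediate point integrate to 1. *)
Lemma ge0_integral_normal_comp x s b (h : R -> R) : 0 < s -> 0 < b ->
  (forall z, 0 <= h z) -> measurable_fun setT h ->
  (\int[normal_prob x s]_y (\int[normal_prob y b]_z (h z)%:E) =
   \int[normal_prob x (Num.sqrt (s ^+ 2 + b ^+ 2))]_z (h z)%:E)%E.
Proof.
move=> s0 b0 h0 mh.
pose k (y z : R) := ((h z)%:E * (normal_pdf y b z)%:E)%E.
have k0 y z : (0 <= k y z)%E by rewrite mule_ge0 ?lee_fin// normal_pdf_ge0.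
have mpdf2 : measurable_fun setT (fun p : R * R => normal_pdf p.1 b p.2).
  under eq_fun do rewrite normal_pdfE0 ?gt_eqF//.
  apply: measurable_funM => //; apply: measurableT_comp => //.
  apply: measurable_funM => //; apply: measurableT_comp => //.
  by apply: measurable_funX; apply: measurable_funB.
have mk : measurable_fun setT (fun p : R * R => k p.1 p.2).
  apply/emeasurable_funM; apply/measurable_EFinP => //.
  exact: measurableT_comp.
have mpdf m c : measurable_fun setT (normal_pdf m c) by exact: measurable_normal_pdf.
under eq_integral => y _.
  rewrite ge0_integral_normal; last 2 first.
    by move=> z; rewrite lee_fin.
    exact/measurable_EFinP.
  over.
rewrite [LHS]ge0_integral_normal; last 2 first.
  move=> y /=; apply: integral_ge0 => z _; exact: k0.
  apply: (@measurable_fun_fubini_tonelli_F _ _ _ _ _ leb (fun p => k p.1 p.2)) => //.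
have mxs : measurable_fun setT (fun p : R * R => (normal_pdf x s p.1)%:E).
  by apply/measurable_EFinP; apply: measurableT_comp.
transitivity (\int[leb]_y \int[leb]_z (k y z * (normal_pdf x s y)%:E))%E.
  apply: eq_integral => y _; rewrite ge0_integralZr//.
  - exact: (measurableT_comp mk (pair1_measurable y)).
  - by rewrite lee_fin normal_pdf_ge0.
rewrite (@fubini_tonelli _ _ _ _ _ leb leb
  (fun p : R * R => k p.1 p.2 * (normal_pdf x s p.1)%:E)%E); last 2 first.
  exact: emeasurable_funM.
  by move=> p; rewrite mule_ge0// lee_fin normal_pdf_ge0.
rewrite [RHS]ge0_integral_normal; last 2 first.
  by move=> z; rewrite lee_fin.
  exact/measurable_EFinP.
apply: eq_integral => z _ /=.
under eq_integral => y _.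
  rewrite /k -muleA -[(_ * (normal_pdf x s y)%:E)%E]EFinM (normal_pdf_mul _ _ _ s0 b0).
  rewrite EFinM muleA; over.
rewrite ge0_integralZl//.
- by rewrite integral_normal_pdf mule1.
- by apply/measurable_EFinP; exact: measurable_normal_pdf.
- by move=> y _; rewrite lee_fin normal_pdf_ge0.
- by rewrite mule_ge0 ?lee_fin// normal_pdf_ge0.
Qed.

(** Exponential tilting: the weight [expR (l * (z - x))] moves the mean of the normal density by
    [l * s ^+ 2]. *)
Lemma ge0_integral_normal_expR x s l : 0 < s ->
  (\int[normal_prob x s]_z (expR (l * (z - x)))%:E =
   (expR (l ^+ 2 * s ^+ 2 / 2))%:E)%E.
Proof.
move=> s0.
have mE : measurable_fun setT (fun z : R => (expR (l * (z - x)))%:E).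
  apply/measurable_EFinP/measurableT_comp => //.
  by apply: measurable_funM => //; exact: measurable_funB.
rewrite ge0_integral_normal//.
transitivity (\int[leb]_z ((expR (l ^+ 2 * s ^+ 2 / 2))%:E *
    (normal_pdf (x + l * s ^+ 2) s z)%:E))%E.
  apply: eq_integral => z _; rewrite -!EFinM !normal_pdfE0 ?gt_eqF//.
  rewrite mulrCA [in RHS]mulrCA -!expRD; congr (_ * expR _)%:E.
  by field; rewrite gt_eqF.
rewrite ge0_integralZl ?integral_normal_pdf ?mule1//.
- by apply/measurable_EFinP; exact: measurable_normal_pdf.
- by move=> y _; rewrite lee_fin normal_pdf_ge0.
Qed.

End normal.

(** * Taylor inequalities for sine, cosine and exponential *)

Section exp_cos_inequalities.
Context {R : realType}.
Implicit Types x t : R.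

(** The engine of the inequalities below: the derivative of each difference is nonnegative by a
    simpler inequality. *)
Lemma ge0_of_derive (F F' : R -> R) : (forall x, is_derive x 1 F (F' x)) ->
  F 0 = 0 -> (forall x, 0 <= x -> 0 <= F' x) -> forall x, 0 <= x -> 0 <= F x.
Proof.
move=> dF F0 F'0 x; rewrite le_eqVlt => /predU1P[<-|x0]; first by rewrite F0.
have cF : {within `[0, x], continuous F}.
  apply: continuous_subspaceT => y; apply: differentiable_continuous.
  by apply/derivable1_diffP; have [] := dF y.
have [c] := MVT x0 (fun y _ => dF y) cF.
rewrite in_itv/= => /andP[c0 cx]; rewrite F0 !subr0 => ->.
by rewrite mulr_ge0 ?F'0 ?ltW.
Qed.

Lemma sin_le x : 0 <= x -> sin x <= x.
Proof.
move=> x0; rewrite -subr_ge0.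
apply: (@ge0_of_derive (fun t => t - sin t) (fun t => 1 - cos t)) => //.
by rewrite sin0 subr0.
Qed.

Lemma cos_ge x : 1 - x ^+ 2 / 2 <= cos x.
Proof.
rewrite -cos_norm -real_normK ?num_real//; move: (normr_ge0 x).
move: `|x| => {}x x0; rewrite -subr_ge0.
apply: (@ge0_of_derive (fun t => cos t - (1 - t ^+ 2 / 2)) (fun t => t - sin t)) => //.
- by move=> t; apply: is_derive_eq; rewrite /GRing.scale/=; field.
- by rewrite cos0 expr0n/= mul0r subr0 subrr.
by move=> t t0; rewrite subr_ge0 sin_le.
Qed.

Lemma sin_ge x : 0 <= x -> x - x ^+ 3 / 6 <= sin x.
Proof.
move=> x0; rewrite -subr_ge0.
apply: (@ge0_of_derive (fun t => sin t - (t - t ^+ 3 / 6))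
  (fun t => cos t - (1 - t ^+ 2 / 2))) => //.
- by move=> t; apply: is_derive_eq; rewrite /GRing.scale/=; field.
- by rewrite sin0 expr0n/= mul0r !subr0.
by move=> t t0; rewrite subr_ge0 cos_ge.
Qed.

Lemma cos_le x : cos x <= 1 - x ^+ 2 / 2 + x ^+ 4 / 24.
Proof.
rewrite -cos_norm -[x ^+ 2]real_normK ?num_real//.
have -> : x ^+ 4 = `|x| ^+ 4 by rewrite -[LHS]/(x ^+ (2 * 2)) -[RHS]/(`|x| ^+ (2 * 2)) !exprM real_normK ?num_real.
move: (normr_ge0 x); move: `|x| => {}x x0; rewrite -subr_ge0.
apply: (@ge0_of_derive (fun t => 1 - t ^+ 2 / 2 + t ^+ 4 / 24 - cos t)
  (fun t => sin t - (t - t ^+ 3 / 6))) => //.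
- by move=> t; apply: is_derive_eq; rewrite /GRing.scale/=; field.
- by rewrite cos0 !expr0n/= !mul0r; lra.
by move=> t t0; rewrite subr_ge0 sin_ge.
Qed.

Lemma expR_le_linear t : 0 <= t -> expR t - 1 <= t * expR t.
Proof.
move=> t0; have := expR_ge1Dx (- t); rewrite expRN => h.
have e0 := expR_gt0 t.
have : (1 - t) * expR t <= 1 by rewrite -ler_pdivlMr// mul1r.
lra.
Qed.

Lemma expR_le_quad t : 0 <= t -> expR t - 1 - t <= t ^+ 2 * expR t.
Proof.
move=> t0; rewrite -subr_ge0.
apply: (@ge0_of_derive (fun t => t ^+ 2 * expR t - (expR t - 1 - t))
  (fun t => 2 * t * expR t + t ^+ 2 * expR t - (expR t - 1))) => //.
- by move=> u; apply: is_derive_eq; rewrite /GRing.scale/=; ring.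
- by rewrite expR0 expr0n/= mul0r; ring.
move=> u u0; have := expR_le_linear u0.
have := mulr_ge0 u0 (expR_ge0 u); have := mulr_ge0 (sqr_ge0 u) (expR_ge0 u); lra.
Qed.

Lemma expR_le_cubic t : expR t - 1 - t - t ^+ 2 / 2 <= `|t| ^+ 3 * expR `|t|.
Proof.
have [t0|t0] := leP 0 t.
  rewrite ger0_norm// -subr_ge0.
  apply: (@ge0_of_derive (fun t => t ^+ 3 * expR t - (expR t - 1 - t - t ^+ 2 / 2))
    (fun t => 3 * t ^+ 2 * expR t + t ^+ 3 * expR t - (expR t - 1 - t))) => //.
  - by move=> u; apply: is_derive_eq; rewrite /GRing.scale/=; field.
  - by rewrite expR0 !expr0n/= mul0r; ring.
  move=> u u0; have := expR_le_quad u0.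
  have := mulr_ge0 (sqr_ge0 u) (expR_ge0 u).
  have := mulr_ge0 (exprn_ge0 3 u0) (expR_ge0 u); lra.
(* For negative [t] the left side is nonpositive, which is the alternating Taylor bound of the
   exponential. *)
apply: (@le_trans _ _ 0); last by rewrite mulr_ge0 ?exprn_ge0 ?expR_ge0.
have s0 : 0 <= - t by lra.
rewrite -subr_ge0 (_ : 0 - _ = 1 - (- t) + (- t) ^+ 2 / 2 - expR (- (- t))); last first.
  by rewrite opprK; field.
move: (- t) s0 => {t0}t t0.
apply: (@ge0_of_derive (fun t => 1 - t + t ^+ 2 / 2 - expR (- t))
   (fun t => expR (- t) - (1 + (- t)))) => //.
- by move=> u; apply: is_derive_eq; rewrite /GRing.scale/=; field.
- by rewrite oppr0 expR0 !expr0n/= mul0r; ring.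
by move=> u u0; rewrite subr_ge0 expR_ge1Dx.
Qed.

(** Half-angle formula: [expR t + expR (- t) - 2] is the square of
    [expR (t / 2) - expR (- (t / 2))], to which the first-order bound [sq] applies. *)
Lemma expR_ge_quad t : 2 + t ^+ 2 <= expR t + expR (- t).
Proof.
have sq x : 0 <= x -> 2 * x <= expR x - expR (- x).
  move=> x0; rewrite -subr_ge0.
  apply: (@ge0_of_derive (fun x => expR x - expR (- x) - 2 * x)
    (fun x => (expR x - (1 + x)) + (expR (- x) - (1 + (- x))))) => //.
  - by move=> u; apply: is_derive_eq; rewrite /GRing.scale/=; ring.
  - by rewrite oppr0 expR0; ring.
  by move=> u _; rewrite addr_ge0// subr_ge0 expR_ge1Dx.
wlog t0 : t / 0 <= t.
  move=> h; have [/h//|t0] := leP 0 t.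
  have := h (- t); rewrite oppr_ge0 => /(_ (ltW t0)).
  by rewrite opprK sqrrN [expR (- t) + _]addrC.
have := sq (t / 2); rewrite divr_ge0// => /(_ isT) h.
have -> : expR t + expR (- t) = (expR (t / 2) - expR (- (t / 2))) ^+ 2 + 2.
  rewrite sqrrB -!expRM_natl -mulNrn -expRD subrr expR0.
  rewrite !(mulrC 2%:R) mulNr !divfK//; ring.
rewrite addrC lerD2r (_ : t ^+ 2 = (2 * (t / 2)) ^+ 2); last by field.
have t20 : 0 <= 2 * (t / 2) by rewrite mulr_ge0 ?divr_ge0.
by rewrite lerXn2r// nnegrE (le_trans t20).
Qed.

End exp_cos_inequalities.

Section gauss.
Context {R : realType}.
Implicit Types (x y z s b t : R).

(** The deviation 0 is included as a point mass, so that the family is closed under composition and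
    the limit may be degenerate. *)
Definition gauss x s : probability (measurableTypeR R) R :=
  if s == 0 then (\d_(x : measurableTypeR R) : probability _ R)
  else normal_prob x s.

Lemma gauss_normal x s : s != 0 -> gauss x s = normal_prob x s.
Proof. by move=> s0; rewrite /gauss (negbTE s0). Qed.

Lemma centered_normal_gauss (v : R) : 0 <= v ->
  centered_normal v = gauss 0 (Num.sqrt v).
Proof.
move=> v0; rewrite /centered_normal /gauss sqrtr_eq0.
by rewrite [v <= 0]le_eqVlt ltNge v0 orbF.
Qed.

Lemma mean_gauss0 x (h : R -> R) : measurable_fun setT h -> mean (gauss x 0) h = h x.
Proof.
move=> mh; rewrite /gauss eqxx /mean /Rintegral integral_dirac//.
  by rewrite diracT mul1e.
exact/measurable_EFinP.
Qed.

(** Lets [t] tend to 0 in the bounds that extract moments from exponential moments. *)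
Lemma le_of_small_perturbation (a c K : R) :
  (forall t, 0 < t -> t <= 1 -> a <= c + t * K) -> a <= c.
Proof.
move=> h; apply/ler_addgt0Pr => e e0.
have K0 : 0 < `|K| + 1 by rewrite ltr_wpDl.
have := h (Num.min 1 (e / (`|K| + 1))).
rewrite lt_min ltr01 divr_gt0// ge_min lexx => /(_ isT isT) /le_trans; apply.
rewrite lerD2l; set t := Num.min _ _.
have t0 : 0 <= t by rewrite le_min ler01 divr_ge0 ?ltW.
have te : t <= e / (`|K| + 1) by rewrite ge_min lexx orbT.
rewrite (@le_trans _ _ (t * (`|K| + 1)))//.
  by rewrite ler_wpM2l// (le_trans (ler_norm K))// lerDl.
by rewrite -ler_pdivlMr.
Qed.

(** * Moments of the standardized normal law from its exponential moments *)

Section standardized.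
Variables (x s : R).
Hypothesis s0 : 0 < s.
Local Notation W := (fun z : measurableTypeR R => (z - x) / s).
Local Notation E := (mean (normal_prob x s)).

Lemma measurable_standardized : measurable_fun setT W.
Proof. by apply: measurable_funM => //; exact: measurable_funB. Qed.

Let expR_intE t : (\int[normal_prob x s]_z (expR (t * W z))%:E = (expR (t ^+ 2 / 2))%:E)%E.
Proof.
rewrite (_ : t ^+ 2 / 2 = (t / s) ^+ 2 * s ^+ 2 / 2); last by field; rewrite gt_eqF.
rewrite -(ge0_integral_normal_expR x)//; apply: eq_integral => z _.
by rewrite mulrA mulrAC.
Qed.

Lemma integ_normal_expR t : integ (normal_prob x s) (fun z => expR (t * W z)).
Proof.
apply/integrableP; split.
  apply/measurable_EFinP/measurableT_comp => //; apply: measurable_funM => //.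
  exact: measurable_standardized.
under eq_integral do rewrite /= ger0_norm ?expR_ge0//.
by rewrite expR_intE ltry.
Qed.

Lemma mean_normal_expR t : E (fun z => expR (t * W z)) = expR (t ^+ 2 / 2).
Proof. by rewrite /mean /Rintegral expR_intE. Qed.

Let cosh2 t z := expR (t * W z) + expR (- t * W z).

Let integ_cosh2 t : integ (normal_prob x s) (cosh2 t).
Proof. by apply: integD; exact: integ_normal_expR. Qed.

Let mean_cosh2 t : E (cosh2 t) = 2 * expR (t ^+ 2 / 2).
Proof.
rewrite meanD; [|exact: integ_normal_expR..].
by rewrite !mean_normal_expR sqrrN; ring.
Qed.

Let expR_le_cosh2 t z : 0 <= t -> expR (t * `|W z|) <= cosh2 t z.
Proof.
rewrite /cosh2 => t0; have [w0|w0] := leP 0 (W z).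
  by rewrite ger0_norm// lerDl expR_ge0.
by rewrite ltr0_norm// mulrN -mulNr lerDr expR_ge0.
Qed.

(** Cube of [u / 3 <= expR (u / 3)]: the origin of 27 here and of 54 in the third absolute
    moment. *)
Lemma cube_le_expR (u : R) : 0 <= u -> u ^+ 3 <= 27 * expR u.
Proof.
move=> u0; have -> : expR u = expR (u / 3) ^+ 3.
  by rewrite -expRM_natl; congr expR; field.
have -> : u ^+ 3 = 27 * (u / 3) ^+ 3 by field.
rewrite ler_pM2l// lerXn2r ?nnegrE ?expR_ge0 ?divr_ge0//.
by rewrite (le_trans _ (expR_ge1Dx _))// lerDr.
Qed.

Lemma integ_normal_cube : integ (normal_prob x s) (fun z => `|W z| ^+ 3).
Proof.
refine (@integ_le _ _ _ (normal_prob x s) _ (fun z => 27 * cosh2 1 z) _ _ _).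
- by apply: measurable_funX; apply: measurableT_comp => //; exact: measurable_standardized.
- move=> z; rewrite ger0_norm ?exprn_ge0// (le_trans (cube_le_expR _))// ler_pM2l//.
  by rewrite -[X in expR X]mul1r expR_le_cosh2.
- exact: integZ.
Qed.

Lemma mean_normal_cube : E (fun z => `|W z| ^+ 3) <= 54 * expR (1 / 2).
Proof.
have -> : 54 * expR (1 / 2) = E (fun z => 27 * cosh2 1 z).
  by rewrite meanZ// mean_cosh2 expr1n; ring.
apply: ler_mean; [exact: integ_normal_cube|exact: integZ|] => z.
rewrite (le_trans (cube_le_expR _))// ler_pM2l//.
by rewrite -[X in expR X]mul1r expR_le_cosh2.
Qed.

Lemma integ_normal_sqr : integ (normal_prob x s) (fun z => W z ^+ 2).
Proof.
refine (@integ_le _ _ _ (normal_prob x s) _ (fun z => 1 + `|W z| ^+ 3) _ _ _).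
- by apply: measurable_funX; exact: measurable_standardized.
- move=> z; rewrite ger0_norm ?sqr_ge0// -real_normK ?num_real//.
  have := normr_ge0 (W z); move: `|W z| => u u0.
  have [u1|u1] := leP u 1.
    by rewrite (@le_trans _ _ 1) ?exprn_ile1// lerDl exprn_ge0.
  by rewrite (@le_trans _ _ (u ^+ 3)) ?lerDr// ler_eXn2l ?ltW.
- by apply: integD; [exact: integ_cst|exact: integ_normal_cube].
Qed.

Lemma integ_normal_id : integ (normal_prob x s) W.
Proof.
refine (@integ_le _ _ _ (normal_prob x s) _ (fun z => 1 + W z ^+ 2) _ _ _).
- exact: measurable_standardized.
- move=> z; rewrite -[W z ^+ 2]real_normK ?num_real//.
  have := normr_ge0 (W z); move: `|W z| => u u0; nra.
- by apply: integD; [exact: integ_cst|exact: integ_normal_sqr].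
Qed.

Let expR_half t : 0 <= t -> t <= 1 -> expR (t ^+ 2 / 2) <= 1 + t ^+ 2.
Proof.
move=> t0 t1; set u := t ^+ 2 / 2.
have u0 : 0 <= u by rewrite divr_ge0 ?sqr_ge0.
have u1 : u <= 1 / 2 by rewrite ler_pM2r ?invr_gt0// expr_le1.
have -> : t ^+ 2 = 2 * u by rewrite /u; field.
have := expR_le_linear u0; have := expR_ge0 u; nra.
Qed.

(** Averaging [1 + c * W <= expR (c * W)] at [c = t] and [c = - t] gives [|E W| <= t] for all small
    [t]. *)
Lemma mean_normal_id : E W = 0.
Proof.
have bound t : 0 < t -> t <= 1 -> `|E W| <= t.
  move=> t0 t1.
  have key c : c ^+ 2 = t ^+ 2 -> 1 + c * E W <= 1 + t ^+ 2.
    move=> ct; apply: le_trans (expR_half (ltW t0) t1).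
    rewrite -ct -mean_normal_expR -meanZ; last exact: integ_normal_id.
    rewrite -[X in X + _](mean_cst (normal_prob x s)) -meanD; last 2 first.
      exact: integ_cst.
      by apply: integZ; exact: integ_normal_id.
    apply: ler_mean => [||z]; last exact: expR_ge1Dx.
      by apply: integD; [exact: integ_cst|apply: integZ; exact: integ_normal_id].
    exact: integ_normal_expR.
  have := key t erefl; have := key (- t) (sqrrN t).
  rewrite ler_norml; move: (E W) => e h1 h2; apply/andP; split; nra.
apply/eqP; rewrite -normr_eq0 eq_le normr_ge0 andbT.
apply: (@le_of_small_perturbation _ _ 1) => t t0 t1.
by rewrite add0r mulr1 bound.
Qed.

(** The upper bound averages [expR_ge_quad], the lower one [expR_le_cubic], whose remainder is of
    order [t ^+ 3]; after division by [t ^+ 2], [t] tends to 0. *)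
Lemma mean_normal_sqr : E (fun z => W z ^+ 2) = 1.
Proof.
apply/eqP; rewrite eq_le; apply/andP; split.
  apply: (@le_of_small_perturbation _ _ 1) => t t0 t1.
  have : 2 + t ^+ 2 * E (fun z => W z ^+ 2) <= 2 * expR (t ^+ 2 / 2).
    rewrite -mean_cosh2 -meanZ; last exact: integ_normal_sqr.
    rewrite -[X in X + _](mean_cst (normal_prob x s)) -meanD; last 2 first.
      exact: integ_cst.
      by apply: integZ; exact: integ_normal_sqr.
    apply: ler_mean => [||z] //.
      by apply: integD; [exact: integ_cst|apply: integZ; exact: integ_normal_sqr].
    by rewrite -exprMn /cosh2 mulNr expR_ge_quad.
  have u0 : 0 <= t ^+ 2 / 2 by rewrite divr_ge0 ?sqr_ge0.
  have := expR_le_linear u0; have := expR_half (ltW t0) t1.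
  have t2 : 0 < t ^+ 2 by rewrite exprn_gt0.
  move: (E _) (expR _) => e q q1 q2 h.
  rewrite -(ler_pM2l t2); nra.
(* [K] is the mean of [27 * cosh2 2], which for [t <= 1] dominates the cubic remainder divided by
   [t ^+ 3]. *)
pose K := 27 * (2 * expR (2 ^+ 2 / 2)) : R.
apply: (@le_of_small_perturbation _ _ (2 * K)) => t t0 t1.
have cube z : `|t * W z| ^+ 3 * expR `|t * W z| <= t ^+ 3 * (27 * cosh2 2 z).
  rewrite normrM (gtr0_norm t0) exprMn -mulrA ler_pM2l ?exprn_gt0//.
  rewrite (@le_trans _ _ (27 * expR (2 * `|W z|)))//; last by rewrite ler_pM2l// expR_le_cosh2.
  have -> : 2 * `|W z| = `|W z| + `|W z| by ring.
  rewrite expRD mulrA ler_pM ?exprn_ge0 ?expR_ge0 ?cube_le_expR//.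
  by rewrite ler_expR ler_piMl.
have : expR (t ^+ 2 / 2) <= 1 + t * E W + t ^+ 2 / 2 * E (fun z => W z ^+ 2) + t ^+ 3 * K.
  have -> : K = E (fun z => 27 * cosh2 2 z).
    by rewrite meanZ// mean_cosh2.
  rewrite -mean_normal_expR -[X in X + _ + _ + _](mean_cst (normal_prob x s)).
  have i1 := integ_cst (normal_prob x s) 1.
  have i2 := integZ t integ_normal_id.
  have i3 := integZ (t ^+ 2 / 2) integ_normal_sqr.
  have i5 := integZ 27 (integ_cosh2 2).
  have i4 := integZ (t ^+ 3) i5.
  rewrite -meanZ; last exact: integ_normal_id.
  rewrite -meanZ; last exact: integ_normal_sqr.
  rewrite -meanZ// -meanD// -meanD//; last exact: integD.
  rewrite -meanD//; last by apply: integD => //; exact: integD.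
  apply: ler_mean => [||z]; first exact: integ_normal_expR.
    by apply: integD => //; apply: integD => //; exact: integD.
  have := expR_le_cubic (t * W z); have := cube z.
  rewrite exprMn; lra.
rewrite mean_normal_id mulr0 addr0 => h.
have := expR_ge1Dx (t ^+ 2 / 2).
have t2 : 0 < t ^+ 2 by rewrite exprn_gt0.
move: (E _) (expR _) h => e q h h2; rewrite -(ler_pM2l t2).
rewrite exprS in h; nra.
Qed.

End standardized.

End gauss.

Lemma gauss_sqr (R : realType) (s : R) : 0 <= s ->
  integ (gauss 0 s) (fun z => z ^+ 2) /\ mean (gauss 0 s) (fun z => z ^+ 2) = s ^+ 2.
Proof.
rewrite le_eqVlt => /predU1P[<-|s0].
  have ms : measurable_fun setT (fun z : measurableTypeR R => z ^+ 2) by exact: measurable_funX.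
  split; last by rewrite (mean_gauss0 0 ms).
  rewrite /integ /gauss eqxx; apply/integrableP; split; first exact/measurable_EFinP.
  rewrite integral_dirac//; last by apply: measurableT_comp => //; exact/measurable_EFinP.
  by rewrite diracT mul1e ltry.
rewrite (gauss_normal 0 (lt0r_neq0 s0)).
have e : (fun z : measurableTypeR R => z ^+ 2) = (fun z => s ^+ 2 * ((z - 0) / s) ^+ 2).
  by apply/funext => z; field; exact: lt0r_neq0.
rewrite e; split; first exact/integZ/integ_normal_sqr.
by rewrite meanZ ?mean_normal_sqr ?mulr1//; exact: integ_normal_sqr.
Qed.

#[local] Opaque mean gauss.

(** * Lindeberg's estimate *)

Section taylor_class.
Context {R : realType}.
Implicit Types (x y z s b t : R) (h u : R -> R).

(* Stands for boundedness of [u], its first two derivatives [u1], [u2] and its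
   third derivative. *)
Definition taylor2 u (u1 u2 : R -> R) (C : R) :=
  (forall x, [/\ `|u x| <= C, `|u1 x| <= C & `|u2 x| <= C]) /\
  (forall x y, `|u (x + y) - u x - u1 x * y - u2 x * (y ^+ 2 / 2)| <= C * `|y| ^+ 3).

Lemma taylor2_ge0 u u1 u2 C : taylor2 u u1 u2 C -> 0 <= C.
Proof. by move=> [/(_ 0)[h _ _] _]; exact: le_trans h. Qed.

(** Lindeberg's form of the remainder, cubic for small [y] and quadratic for large [y], so that
    second moments suffice. For [|y| > 1] the four terms are at most [C (1 + 1 + |y| + y^2 / 2)],
    whence the 4. *)
Lemma taylor2_min u u1 u2 C x y : taylor2 u u1 u2 C ->
  `|u (x + y) - u x - u1 x * y - u2 x * (y ^+ 2 / 2)| <=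
  4 * C * (y ^+ 2 * Num.min 1 `|y|).
Proof.
move=> tu; have C0 := taylor2_ge0 tu; have [ub ut] := tu.
have [y1|y1] := leP `|y| 1.
  rewrite (le_trans (ut _ _))// -[y ^+ 2]real_normK ?num_real//.
  by have := exprn_ge0 3 (normr_ge0 y); rewrite -mulrA -!exprSr; nra.
rewrite mulr1.
have [h0 h1 h2] := ub x; have [h3 _ _] := ub (x + y).
rewrite -[y ^+ 2]real_normK ?num_real//.
have e1 : `|u1 x * y| <= C * `|y| by rewrite normrM ler_wpM2r.
have e2 : `|u2 x * (`|y| ^+ 2 / 2)| <= C * (`|y| ^+ 2 / 2).
  by rewrite normrM (ger0_norm (_ : 0 <= `|y| ^+ 2 / 2)) ?divr_ge0 ?sqr_ge0// ler_wpM2r ?divr_ge0 ?sqr_ge0.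
rewrite (le_trans (ler_normB _ _))// (le_trans (lerD (ler_normB _ _) e2))//.
rewrite -!addrA (le_trans (lerD (ler_normB _ _) (lexx _)))//.
move: e1 e2 h0 h3; move: `|u1 x * y| `|u x| `|u (x + y)| => a c e.
have := mulr_ge0 C0 (normr_ge0 y); nra.
Qed.

Lemma taylor2_lip u u1 u2 C x y : taylor2 u u1 u2 C ->
  `|u (x + y) - u x| <= C * (`|y| + `|y| ^+ 2 + `|y| ^+ 3).
Proof.
move=> tu; have C0 := taylor2_ge0 tu; have [ub ut] := tu.
have [_ h1 h2] := ub x.
have e1 : `|u1 x * y| <= C * `|y| by rewrite normrM ler_wpM2r.
have e2 : `|u2 x * (y ^+ 2 / 2)| <= C * (`|y| ^+ 2 / 2).
  rewrite normrM -[y ^+ 2]real_normK ?num_real//.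
  by rewrite (ger0_norm (_ : 0 <= `|y| ^+ 2 / 2)) ?divr_ge0 ?sqr_ge0// ler_wpM2r ?divr_ge0 ?sqr_ge0.
have e3 := ut x y.
have -> : u (x + y) - u x = (u (x + y) - u x - u1 x * y - u2 x * (y ^+ 2 / 2))
   + u1 x * y + u2 x * (y ^+ 2 / 2) by ring.
rewrite (le_trans (ler_normD _ _))// (le_trans (lerD (ler_normD _ _) e2))//.
have := mulr_ge0 C0 (sqr_ge0 `|y|); lra.
Qed.

Lemma taylor2_continuous u u1 u2 C : taylor2 u u1 u2 C -> continuous u.
Proof.
move=> tu x; apply/cvgrPdist_le => e e0.
have C0 := taylor2_ge0 tu.
have C1 : 0 < 3 * (C + 1) by rewrite mulr_gt0// ltr_wpDl.
apply/nbhs_ballP; exists (Num.min 1 (e / (3 * (C + 1)))) => /=.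
  by rewrite lt_min ltr01 divr_gt0.
move=> z; rewrite /ball/= lt_min => /andP[z1 z2].
rewrite distrC -[z](subrK x) [z - x + x]addrC (le_trans (taylor2_lip _ _ tu))//.
move: z1 z2; rewrite distrC ltr_pdivlMr//.
have := normr_ge0 (z - x); move: `|z - x| => r r0 r1 re.
have : r ^+ 2 <= r by rewrite -[leRHS]expr1 ler_wiXn2l// ltW.
have : r ^+ 3 <= r by rewrite -[leRHS]expr1 ler_wiXn2l// ltW.
nra.
Qed.

Lemma taylor2_measurable u u1 u2 C : taylor2 u u1 u2 C -> measurable_fun setT u.
Proof. by move=> /taylor2_continuous; exact: continuous_measurable_fun. Qed.

End taylor_class.

(** * Gaussian averages of test functions *)

Section gauss_means.
Context {R : realType}.
Implicit Types (x y z s b t : R) (h u : R -> R).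

Lemma ge0_mean_gauss_comp x s b h (M : R) : 0 <= s -> 0 <= b ->
  measurable_fun setT h -> (forall z, 0 <= h z) -> (forall z, h z <= M) ->
  measurable_fun setT (fun y => mean (gauss y b) h) /\
  mean (gauss x s) (fun y => mean (gauss y b) h) =
  mean (gauss x (Num.sqrt (s ^+ 2 + b ^+ 2))) h.
Proof.
move=> s0 b0 mh h0 hM.
have [->|bn0] := eqVneq b 0.
  rewrite (_ : (fun y => mean (gauss y 0) h) = h); last first.
    by apply/funext => y; exact: mean_gauss0.
  by rewrite expr0n/= addr0 sqrtr_sqr ger0_norm.
have bp : 0 < b by rewrite lt_neqAle eq_sym bn0.
have ih y c : integ (gauss y c) h.
  by apply: (@integ_bounded _ _ _ _ _ M) => // z; rewrite ger0_norm.
have mE y c : 0 < c -> (\int[normal_prob y c]_z (h z)%:E = (mean (gauss y c) h)%:E)%E.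
  move=> c0; have := ih y c; rewrite gauss_normal ?gt_eqF//; exact: integral_mean.
have mm : measurable_fun setT (fun y => mean (gauss y b) h).
  apply/measurable_EFinP.
  rewrite (_ : _ \o _ = fun y => \int[normal_prob y b]_z (h z)%:E)%E; last first.
    by apply/funext => y /=; rewrite mE.
  rewrite (_ : (fun y => _) = (fun y => \int[lebesgue_measure]_z
      (h z * normal_pdf y b z)%:E)%E); last first.
    apply/funext => y; rewrite ge0_integral_normal//.
    exact/measurable_EFinP.
  apply: (@measurable_fun_fubini_tonelli_F _ _ _ _ _ lebesgue_measure
    (fun p => (h p.2 * normal_pdf p.1 b p.2)%:E)).
    apply/measurable_EFinP/measurable_funM; first exact: measurableT_comp.
    under eq_fun do rewrite normal_pdfE0 ?gt_eqF//.
    apply: measurable_funM => //; apply: measurableT_comp => //.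
    apply: measurable_funM => //; apply: measurableT_comp => //.
    by apply: measurable_funX; apply: measurable_funB.
  by move=> p; rewrite lee_fin mulr_ge0// normal_pdf_ge0.
split; first exact: mm.
have [->|sn0] := eqVneq s 0.
  rewrite (_ : Num.sqrt _ = b); first exact: (mean_gauss0 x mm).
  by rewrite expr0n/= add0r sqrtr_sqr ger0_norm.
have sp : 0 < s by rewrite lt_neqAle eq_sym sn0.
have c0 : 0 < Num.sqrt (s ^+ 2 + b ^+ 2).
  by rewrite sqrtr_gt0 ltr_wpDl ?sqr_ge0// exprn_gt0.
have := ge0_integral_normal_comp x sp bp h0 mh.
move: (Num.sqrt _) c0 => c c0.
under [in LHS]eq_integral => y _ do rewrite (mE y _ bp).
rewrite (mE x _ c0) => e; rewrite (gauss_normal x sn0).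
have iK : integ (normal_prob x s) (fun y => mean (gauss y b) h).
  refine (@integ_bounded _ _ _ (normal_prob x s) _ M mm _) => y; apply: (normr_mean_le (ih y b)) => z.
  by rewrite ger0_norm; [exact: hM|exact: h0].
by apply: EFin_inj; rewrite -(integral_mean iK) e.
Qed.

Lemma bounded_integ_gauss x s h (M : R) : measurable_fun setT h ->
  (forall z, `|h z| <= M) -> integ (gauss x s) h.
Proof. by move=> mh hM; exact: (@integ_bounded _ _ _ (gauss x s) h M mh hM). Qed.

(** Adding [M] makes [h] nonnegative, as the version based on Tonelli requires. *)
Lemma mean_gauss_comp x s b h (M : R) : 0 <= s -> 0 <= b ->
  measurable_fun setT h -> (forall z, `|h z| <= M) ->
  measurable_fun setT (fun y => mean (gauss y b) h) /\
  mean (gauss x s) (fun y => mean (gauss y b) h) =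
  mean (gauss x (Num.sqrt (s ^+ 2 + b ^+ 2))) h.
Proof.
move=> s0 b0 mh hM.
have ih y c : integ (gauss y c) h by exact: bounded_integ_gauss hM.
have hl z : - M <= h z <= M by rewrite -ler_norml.
have shift y c : mean (gauss y c) h = mean (gauss y c) (fun z => h z + M) - M.
  by rewrite meanD ?mean_cst ?addrK//; exact: integ_cst.
have hM0 z : 0 <= h z + M by have /andP[] := hl z; lra.
have hMM z : h z + M <= M + M by have /andP[] := hl z; lra.
have mhM : measurable_fun setT (fun z => h z + M) by exact: measurable_funD.
have [mm e] := ge0_mean_gauss_comp x s0 b0 mhM hM0 hMM.
split; first by under eq_fun do rewrite shift; exact: measurable_funB.
have -> : mean (gauss x s) (fun y => mean (gauss y b) h) =
    mean (gauss x s) (fun y => mean (gauss y b) (fun z => h z + M) - M).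
  by apply: eq_mean => y; exact: shift.
have iM y : integ (gauss y b) (fun z => h z + M).
  by apply: integD; [exact: ih|exact: integ_cst].
have iK : integ (gauss x s) (fun y => mean (gauss y b) (fun z => h z + M)).
  refine (@integ_bounded _ _ _ (gauss x s) _ (M + M) mm _) => y.
  apply: (normr_mean_le (iM y)) => z.
  by rewrite ger0_norm; [exact: hMM|exact: hM0].
apply: (etrans (meanB iK (integ_cst (gauss x s) M))).
apply: (etrans _ (esym (shift x (Num.sqrt (s ^+ 2 + b ^+ 2))))).
exact: (congr2 (fun a c => a - c) e (mean_cst (gauss x s) M)).
Qed.

(** The linear term averages to 0 and the quadratic one to the variance; the constant is that of
    [mean_normal_cube]. *)
Lemma mean_gauss_taylor x s u u1 u2 C : 0 <= s -> taylor2 u u1 u2 C ->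
  `|mean (gauss x s) u - u x - s ^+ 2 / 2 * u2 x| <= C * (54 * expR (1 / 2)) * s ^+ 3.
Proof.
move=> s0 tu; have mu := taylor2_measurable tu.
have C0 := taylor2_ge0 tu.
move: s0; rewrite le_eqVlt => /predU1P[<-|s0].
  rewrite (mean_gauss0 x mu) subrr !expr0n/= mul0r mul0r subrr normr0.
  by rewrite mulr0.
rewrite gauss_normal ?gt_eqF//.
pose W z := (z - x) / s.
have zW z : z = x + s * W z by rewrite /W mulrC divfK ?gt_eqF// addrC subrK.
have i1 : integ (normal_prob x s) W := integ_normal_id x s0.
have i2 : integ (normal_prob x s) (fun z => W z ^+ 2) := integ_normal_sqr x s0.
have i3 : integ (normal_prob x s) (fun z => `|W z| ^+ 3) := integ_normal_cube x s0.
have iu : integ (normal_prob x s) u.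
  by refine (@integ_bounded _ _ _ (normal_prob x s) _ C mu _) => z; have [] := tu.1 z.
pose r z := u z - (u x + s * u1 x * W z + s ^+ 2 / 2 * u2 x * W z ^+ 2).
have j0 := integ_cst (normal_prob x s) (u x).
have j1 := integZ (s * u1 x) i1.
have j2 := integZ (s ^+ 2 / 2 * u2 x) i2.
have j3 : integ (normal_prob x s)
   (fun z => u x + s * u1 x * W z + s ^+ 2 / 2 * u2 x * W z ^+ 2).
  by apply: integD => //; exact: integD.
have ir : integ (normal_prob x s) r by exact: integB.
have -> : mean (normal_prob x s) u - u x - s ^+ 2 / 2 * u2 x = mean (normal_prob x s) r.
  rewrite /r meanB// meanD//; last exact: integD.
  rewrite meanD// mean_cst !meanZ// (mean_normal_id x s0) (mean_normal_sqr x s0).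
  by ring.
rewrite (le_trans (normr_mean ir))//.
have -> : C * (54 * expR (1 / 2)) * s ^+ 3 = (C * s ^+ 3) * (54 * expR (1 / 2)) by ring.
apply: (@le_trans _ _ ((C * s ^+ 3) * mean (normal_prob x s) (fun z => `|W z| ^+ 3))).
  rewrite -meanZ//; apply: ler_mean => [||z]; [exact: integ_norm|exact: integZ|].
  have := tu.2 x (s * W z); rewrite -zW normrM (gtr0_norm s0) => hz.
  rewrite -mulrA -exprMn; apply: le_trans hz; rewrite (_ : r z = u z - u x - u1 x * (s * W z) -
    u2 x * ((s * W z) ^+ 2 / 2))//.
  by rewrite /r; move: (W z) => w; field.
apply: ler_wpM2l; last exact: (mean_normal_cube x s0).
by rewrite mulr_ge0 ?exprn_ge0 ?(ltW s0).
Qed.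

End gauss_means.

(** * Replacement of i.i.d. summands by Gaussian steps *)

Section iid_sums.
Context {d : measure_display} {T : measurableType d} {R : realType}.
Variable P : probability T R.
Context {S : countType}.
Variable U : nat -> T -> S.
Hypothesis iidU : iid P U.

Definition partial_sum (G : S -> R) m w := \sum_(i < m) G (U i w).

Lemma partial_sum_mkseq G m w :
  partial_sum G m w = \sum_(s <- mkseq (U^~ w) m) G s.
Proof. by rewrite big_map -{2}(subn0 m) -/(index_iota 0 m) big_mkord. Qed.

Lemma partial_sumS G m w : partial_sum G m.+1 w = partial_sum G m w + G (U m w).
Proof. by rewrite /partial_sum big_ord_recr. Qed.

Lemma partial_sum0 G w : partial_sum G 0 w = 0.
Proof. by rewrite /partial_sum big_ord0. Qed.

Lemma discrete_partial_sum G m : discrete_rv (partial_sum G m).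
Proof.
have [dU _ _] := iidU.
rewrite (_ : partial_sum G m = fun w => \sum_(s <- mkseq (U^~ w) m) G s).
  exact: (discrete_comp (fun v => \sum_(s <- v) G s) (discrete_mkseq _ dU)).
by apply/funext => w; exact: partial_sum_mkseq.
Qed.

Lemma discrete_iid (S' : Type) (G : S -> S') i : discrete_rv (fun w => G (U i w)).
Proof. by have [dU _ _] := iidU; exact: discrete_comp. Qed.

Lemma bounded_iid (G : S -> R) (M : R) i : (forall s, `|G s| <= M) ->
  bounded_rv (fun w => G (U i w)).
Proof.
by move=> GM; apply: (@bounded_discrete _ _ _ _ M) => //; exact: discrete_iid.
Qed.

Lemma mean_iid (G : S -> R) (M : R) i : (forall s, `|G s| <= M) ->
  mean P (fun w => G (U i w)) = mean P (fun w => G (U 0%N w)).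
Proof.
by have [dU lU _] := iidU; move=> GM; apply: (mean_same_law (dU _) (dU _) (lU _) GM).
Qed.

Lemma mean_partial_sum_step G (F : R -> R -> R) (M : R) m :
  (forall w s, `|F (partial_sum G m w) (G s)| <= M) ->
  mean P (fun w => F (partial_sum G m w) (G (U m w))) =
  mean P (fun w => mean P (fun w' => F (partial_sum G m w') (G (U 0%N w)))).
Proof.
move=> FM.
(* The bound [M] is known only at values that the partial sum takes, so [F] is replaced by 0 on
   words that never occur. *)
pose F' (v : seq S) s := if `[< exists w, v = mkseq (U^~ w) m >]
  then F (\sum_(s <- v) G s) (G s) else 0.
have F'E w s : F (partial_sum G m w) (G s) = F' (mkseq (U^~ w) m) s.
  by rewrite /F' asboolT ?partial_sum_mkseq//; exists w.
have M0 (w : T) (s : S) : 0 <= M by apply: le_trans (FM w s).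
transitivity (mean P (fun w => F' (mkseq (U^~ w) m) (U m w))).
  by apply: eq_mean => w; exact: F'E.
rewrite (@iid_mean _ _ _ P _ U F' M m iidU); last first.
  move=> v s; rewrite /F'; case: asboolP => [[w ->]|_].
    by rewrite -partial_sum_mkseq.
  (* Bounding the default 0 needs [0 <= M], hence a point of [T]; a probability space is not
     empty. *)
  rewrite normr0; have [[w _]|nT] := pselect (exists w : T, True); first exact: M0.
  exfalso; have := probability_setT P; rewrite (_ : setT = set0) ?measure0.
    by move=> /esym/eqP; rewrite onee_eq0.
  by rewrite -subset0 => w _; apply: nT; exists w.
by apply: eq_mean => w; apply: eq_mean => w'; rewrite F'E.
Qed.

(** Averaging keeps the constant [C]; the induction in [lindeberg] expands such averages and would
    not survive a loss at each step. *)
Lemma taylor2_mean (Z : T -> R) (u u1 u2 : R -> R) C (c : R) : discrete_rv Z ->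
  taylor2 u u1 u2 C ->
  taylor2 (fun x => mean P (fun w => u (x + c * Z w)))
          (fun x => mean P (fun w => u1 (x + c * Z w)))
          (fun x => mean P (fun w => u2 (x + c * Z w))) C.
Proof.
move=> dZ [ub ut].
have ib (v : R -> R) x : (forall y, `|v y| <= C) -> integ P (fun w => v (x + c * Z w)).
  move=> vC; apply: (@integ_bounded _ _ _ _ _ C) => //.
  exact: (discrete_measurable (discrete_comp (fun y => v (x + c * y)) dZ)).
have b0 y : `|u y| <= C by have [] := ub y.
have b1 y : `|u1 y| <= C by have [] := ub y.
have b2 y : `|u2 y| <= C by have [] := ub y.
split=> [x|x y].
  by split; apply: normr_mean_le => // *; exact: ib.
have i0 := ib _ (x + y) b0; have i1 := ib _ x b0.
have j2 := ib _ x b1; have j3 := ib _ x b2.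
have i2 := integZ y j2; have i3 := integZ (y ^+ 2 / 2) j3.
rewrite ![mean P _ * _]mulrC -(meanZ _ j2) -(meanZ _ j3) -(meanB i0 i1).
rewrite -(meanB (integB i0 i1) i2) -(meanB (integB (integB i0 i1) i2) i3).
apply: normr_mean_le => [|w]; first exact: integB (integB (integB i0 i1) i2) i3.
rewrite (_ : x + y + c * Z w = x + c * Z w + y); last by ring.
by have := ut (x + c * Z w) y; rewrite [u1 _ * y]mulrC [u2 _ * _]mulrC.
Qed.

(* Tail of the second moment of [Y] at scale [1 / c]. *)
Definition lindeberg_tail (Y : T -> R) (c : R) :=
  mean P (fun w => Y w ^+ 2 * Num.min 1 (c * `|Y w|)).

Lemma lindeberg_tail_bound (c y : R) : 0 <= c ->
  0 <= y ^+ 2 * Num.min 1 (c * `|y|) <= y ^+ 2.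
Proof.
move=> c0; have m0 : 0 <= Num.min 1 (c * `|y|) by rewrite le_min ler01 mulr_ge0.
apply/andP; split; first by apply: mulr_ge0 => //; exact: sqr_ge0.
by rewrite ler_piMr ?sqr_ge0// ge_min lexx.
Qed.

Lemma integ_lindeberg_tail (Y : T -> R) c : 0 <= c -> measurable_fun setT Y ->
  integ P (fun w => Y w ^+ 2) ->
  integ P (fun w => Y w ^+ 2 * Num.min 1 (c * `|Y w|)).
Proof.
move=> c0 mY iY; apply: (integ_le _ _ iY).
  apply: measurable_funM; first exact: measurable_funX.
  apply: measurable_minr => //; apply: measurable_funM => //.
  exact: measurableT_comp.
move=> w; have /andP[] := lindeberg_tail_bound (Y w) c0.
by move=> h h'; rewrite ger0_norm.
Qed.

Lemma lindeberg_tail_cvg (Y : T -> R) (c : nat -> R) : (forall n, 0 <= c n) ->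
  c n @[n --> \oo] --> 0 -> measurable_fun setT Y -> integ P (fun w => Y w ^+ 2) ->
  lindeberg_tail Y (c n) @[n --> \oo] --> 0.
Proof.
move=> c0 cc mY iY; rewrite -[X in _ --> X](mean_cst P 0).
apply: (cvg_mean _ _ iY) => //.
- by move=> n; apply: integ_measurable; exact: integ_lindeberg_tail.
- move=> n w; have /andP[] := lindeberg_tail_bound (Y w) (c0 n).
  by move=> h h'; rewrite ger0_norm.
- move=> w; apply: (@squeeze_cvgr _ _ _ _ (fun=> 0) (fun n => Y w ^+ 2 * (c n * `|Y w|))).
  + apply: nearW => n; have /andP[-> _] := lindeberg_tail_bound (Y w) (c0 n).
    by rewrite ler_wpM2l ?sqr_ge0// ge_min lexx orbT.
  + exact: cvg_cst.
  + rewrite -[X in _ --> X](mulr0 (Y w ^+ 2)); apply: cvgM; first exact: cvg_cst.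
    by rewrite -[X in _ --> X](mul0r `|Y w|); apply: cvgM => //; exact: cvg_cst.
Qed.

(** The first-order term vanishes since [Y] is centered, and [taylor2_min] bounds the remainder by a
    tail that needs no third moment. *)
Lemma mean_taylor (Y : T -> R) (u u1 u2 : R -> R) C c x : 0 <= c ->
  discrete_rv Y -> integ P Y -> integ P (fun w => Y w ^+ 2) -> mean P Y = 0 ->
  taylor2 u u1 u2 C ->
  `|mean P (fun w => u (x + c * Y w)) - u x -
    c ^+ 2 * mean P (fun w => Y w ^+ 2) / 2 * u2 x| <=
  4 * C * c ^+ 2 * lindeberg_tail Y c.
Proof.
move=> c0 dY iY iY2 Y0 tu; have mY := discrete_measurable dY.
have C0 := taylor2_ge0 tu.
have iu : integ P (fun w => u (x + c * Y w)).
  apply: (@integ_bounded _ _ _ _ _ C) => [|w]; last by have [] := tu.1 (x + c * Y w).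
  exact: (discrete_measurable (discrete_comp (fun y => u (x + c * y)) dY)).
have i1 := integZ (u1 x * c) iY; have i2 := integZ (u2 x * c ^+ 2 / 2) iY2.
have i0 := integ_cst P (u x).
have e : mean P (fun w => u (x + c * Y w)) - u x -
    c ^+ 2 * mean P (fun w => Y w ^+ 2) / 2 * u2 x =
  mean P (fun w => u (x + c * Y w) - u x - u1 x * c * Y w - u2 x * c ^+ 2 / 2 * Y w ^+ 2).
  rewrite (meanB (integB (integB iu i0) i1) i2) (meanB (integB iu i0) i1) (meanB iu i0).
  by rewrite mean_cst (meanZ _ iY) (meanZ _ iY2) Y0; ring.
rewrite e (le_trans (normr_mean (integB (integB (integB iu i0) i1) i2)))//.
have it := integ_lindeberg_tail c0 mY iY2.
rewrite -(meanZ _ it); apply: ler_mean => [||w].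
- exact/integ_norm/(integB (integB (integB iu i0) i1) i2).
- exact: integZ.
have := taylor2_min x (c * Y w) tu.
rewrite normrM (ger0_norm c0) => h.
rewrite (_ : u2 x * c ^+ 2 / 2 * Y w ^+ 2 = u2 x * ((c * Y w) ^+ 2 / 2)); last by ring.
rewrite -[u1 x * c * _]mulrA; apply: le_trans h _.
by rewrite exprMn !mulrA.
Qed.

Lemma normr_half_le (a b C : R) : `|a| <= C -> `|b / 2 * a| <= C * `|b| / 2.
Proof.
move=> aC; rewrite normrM normrM [`|2^-1|]ger0_norm//.
by rewrite [C * _]mulrC mulrAC ler_wpM2r// ler_wpM2l.
Qed.

(** Induction on [m], uniformly in the starting point [x]: one step of the walk is exchanged for one
    Gaussian step in front of the averaged test function, and the induction hypothesis exchanges the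
    others behind it. The two step variances need not agree, which costs the middle term. *)
Lemma lindeberg (G : S -> R) (h h1 h2 : R -> R) C (c s : R) m x : 0 <= c -> 0 <= s ->
  integ P (fun w => G (U 0%N w)) -> integ P (fun w => G (U 0%N w) ^+ 2) ->
  mean P (fun w => G (U 0%N w)) = 0 -> taylor2 h h1 h2 C ->
  `|mean P (fun w => h (x + c * partial_sum G m w)) -
    mean (gauss x (Num.sqrt m%:R * s)) h| <=
  m%:R * (4 * C * c ^+ 2 * lindeberg_tail (fun w => G (U 0%N w)) c +
    C * `|c ^+ 2 * mean P (fun w => G (U 0%N w) ^+ 2) - s ^+ 2| / 2 +
    C * (54 * expR (1 / 2)) * s ^+ 3).
Proof.
move=> c0 s0 iG iG2 G0 th; have C0 := taylor2_ge0 th.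
have mh := taylor2_measurable th.
have hC y : `|h y| <= C by have [] := th.1 y.
set v := mean P (fun w => G _ ^+ 2); set eta := (X in m%:R * X).
elim: m x => [|m ih] x.
  rewrite sqrtr0 mul0r (mean_gauss0 _ mh) mul0r.
  under eq_mean do rewrite partial_sum0 mulr0 addr0.
  by rewrite mean_cst subrr normr0.
pose uj y := mean P (fun w => h (y + c * partial_sum G m w)).
pose gj y := mean (gauss y (Num.sqrt m%:R * s)) h.
have tuj := taylor2_mean c (discrete_partial_sum G m) th.
have ujC y : `|uj y| <= C by have [] := tuj.1 y.
have muj : measurable_fun setT uj := taylor2_measurable tuj.
have e1 : mean P (fun w => h (x + c * partial_sum G m.+1 w)) =
          mean P (fun w => uj (x + c * G (U 0%N w))).
  transitivity (mean P (fun w => h (x + c * G (U m w) + c * partial_sum G m w))).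
    by apply: eq_mean => w; rewrite partial_sumS mulrDr addrA addrAC.
  exact: (mean_partial_sum_step (F := fun a b => h (x + c * b + c * a))).
have s1 : Num.sqrt m.+1%:R * s = Num.sqrt (s ^+ 2 + (Num.sqrt m%:R * s) ^+ 2).
  rewrite exprMn sqr_sqrtr ?ler0n// -{1}[s ^+ 2]mul1r -mulrDl nat1r.
  by rewrite sqrtrM ?ler0n// sqrtr_sqr ger0_norm.
have t0 : 0 <= Num.sqrt m%:R * s by rewrite mulr_ge0.
have [mg e2] := mean_gauss_comp x s0 t0 mh hC.
rewrite e1 s1 -e2 -/gj.
have gjC y : `|gj y| <= C.
  exact: (normr_mean_le (bounded_integ_gauss y (Num.sqrt m%:R * s) mh hC) hC).
have iuj := bounded_integ_gauss x s muj ujC.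
have igj := bounded_integ_gauss x s mg gjC.
(* Both averages of [uj] are expanded to second order at [x]: the values [uj x] cancel and the
   second-order terms leave the variance mismatch. *)
have e3 : mean P (fun w => uj (x + c * G (U 0%N w))) - mean (gauss x s) gj =
  (mean P (fun w => uj (x + c * G (U 0%N w))) - uj x - c ^+ 2 * v / 2 * mean P (fun w => h2 (x + c * partial_sum G m w)))
  - (mean (gauss x s) uj - uj x - s ^+ 2 / 2 * mean P (fun w => h2 (x + c * partial_sum G m w)))
  + (c ^+ 2 * v - s ^+ 2) / 2 * mean P (fun w => h2 (x + c * partial_sum G m w))
  + mean (gauss x s) (fun y => uj y - gj y).
  by rewrite (meanB iuj igj); field.
have e4 : m.+1%:R * eta = eta + m%:R * eta by rewrite -nat1r mulrDl mul1r.
rewrite e3 e4 (le_trans (ler_normD _ _)) => [//|]; apply: lerD; last first.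
  by apply: (normr_mean_le (integB iuj igj)) => y; exact: ih.
have b1 := mean_taylor x c0 (discrete_iid G 0) iG iG2 G0 tuj.
have b2 := mean_gauss_taylor x s0 tuj.
have [_ _ b3] := tuj.1 x.
rewrite (le_trans (ler_normD _ _)) => [//|].
rewrite /eta [leRHS]addrAC; apply: lerD.
  by apply: (le_trans (ler_normB _ _)); exact: lerD b1 b2.
exact: normr_half_le b3.
Qed.

End iid_sums.

(** * Block sums: law of large numbers and finiteness of the variance *)

Lemma ex_nat_ge (R : realType) (c : R) : exists n0, forall n, (n0 <= n)%N -> c <= n%:R.
Proof.
exists (Num.bound `|c|) => n nn; apply: (le_trans (ler_norm c)).
rewrite (le_trans (ltW (archi_boundP (normr_ge0 c))))//.
by rewrite ler_nat.
Qed.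

Section clip.
Context {R : realType}.
Implicit Types (K x a b c : R).

Definition clip K x := Num.max (- K) (Num.min K x).

Lemma clip_le K x : 0 <= K -> `|clip K x| <= K.
Proof.
move=> K0; rewrite ler_norml /clip le_max lexx/= ge_max.
by rewrite ge_min lexx/= andbT; lra.
Qed.

Lemma clip_dist_le K x : 0 <= K -> `|x - clip K x| <= `|x|.
Proof.
move=> K0; rewrite /clip; have [h|h] := leP K x.
  by rewrite max_r ?ger0_norm; lra.
have [h'|h'] := leP (- K) x; first by rewrite subrr normr0.
by rewrite !ler0_norm; lra.
Qed.

Lemma clip_id K x : `|x| <= K -> clip K x = x.
Proof.
rewrite ler_norml => /andP[h1 h2]; rewrite /clip.
by rewrite min_r// max_r.
Qed.

Lemma min_addr_le a b c : 0 <= a -> 0 <= b -> 0 <= c ->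
  Num.min (a + b) c <= Num.min a c + Num.min b c.
Proof.
move=> a0 b0 c0.
by have [h1|h1] := leP (a + b) c; have [h2|h2] := leP a c; have [h3|h3] := leP b c; lra.
Qed.

Lemma min_sum_le n (F : 'I_n -> R) c : 0 <= c -> (forall i, 0 <= F i) ->
  Num.min (\sum_i F i) c <= \sum_i Num.min (F i) c.
Proof.
move=> c0; elim: n F => [|n ih] F F0.
  by rewrite !big_ord0 ge_min lexx.
rewrite !big_ord_recr/= (le_trans (min_addr_le _ _ _))// ?sumr_ge0//.
by rewrite lerD2r ih.
Qed.

End clip.

(** * Weak law of large numbers *)

Section wlln.
Context {d : measure_display} {T : measurableType d} {R : realType}.
Variable P : probability T R.
Context {S : countType}.
Variable U : nat -> T -> S.
Hypothesis iidU : iid P U.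
Local Notation psum := (partial_sum U).

Lemma partial_sum_le (G : S -> R) (M : R) m w : (forall s, `|G s| <= M) ->
  `|psum G m w| <= m%:R * M.
Proof.
move=> GM; apply: (le_trans (ler_norm_sum _ _ _)).
rewrite mulr_natl -[m in leRHS]card_ord -sumr_const.
by apply: ler_sum => i _; exact: GM.
Qed.

Lemma mean_sqr_partial_sum (G : S -> R) (M : R) m : (forall s, `|G s| <= M) ->
  mean P (fun w => G (U 0%N w)) = 0 ->
  mean P (fun w => psum G m w ^+ 2) <= m%:R * M ^+ 2.
Proof.
move=> GM G0; elim: m => [|m ih].
  under eq_mean do rewrite partial_sum0 expr0n/=.
  by rewrite mean_cst mul0r.
have bG : bounded_rv (fun w => G (U 0%N w)) := bounded_iid iidU 0 GM.
have bW : bounded_rv (psum G m).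
  apply: (@bounded_discrete _ _ _ _ (m%:R * M)) => [|w]; last exact: partial_sum_le.
  exact: (discrete_partial_sum iidU).
have -> : mean P (fun w => psum G m.+1 w ^+ 2) =
    mean P (fun w => mean P (fun w' => (psum G m w' + G (U 0%N w)) ^+ 2)).
  transitivity (mean P (fun w => (psum G m w + G (U m w)) ^+ 2)).
    by apply: eq_mean => w; rewrite partial_sumS.
  apply: (mean_partial_sum_step iidU (F := fun a b => (a + b) ^+ 2)
     (M := (m%:R * M + M) ^+ 2)) => w s.
  rewrite normrX lerXn2r ?nnegrE ?normr_ge0//.
    by rewrite addr_ge0 ?mulr_ge0 ?(le_trans _ (GM s)).
  by rewrite (le_trans (ler_normD _ _))// lerD ?partial_sum_le.
have bW2 := bounded_integ P (boundedX 2 bW); have iW := bounded_integ P bW.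
have bG2 := bounded_integ P (boundedX 2 bG); have iG := bounded_integ P bG.
have -> : mean P (fun w => mean P (fun w' => (psum G m w' + G (U 0%N w)) ^+ 2)) =
   mean P (fun w => mean P (fun w' => psum G m w' ^+ 2) +
     2 * mean P (psum G m) * G (U 0%N w) + G (U 0%N w) ^+ 2).
  apply: eq_mean => w.
  have -> : mean P (fun w' => (psum G m w' + G (U 0%N w)) ^+ 2) =
    mean P (fun w' => psum G m w' ^+ 2 + 2 * G (U 0%N w) * psum G m w' + G (U 0%N w) ^+ 2).
    by apply: eq_mean => w'; ring.
  have i1 := integZ (2 * G (U 0%N w)) iW.
  rewrite (meanD (integD bW2 i1) (integ_cst _ _)) (meanD bW2 i1) (meanZ _ iW) mean_cst.
  by ring.
have i1 := integZ (2 * mean P (psum G m)) iG.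
have i0 := integ_cst P (mean P (fun w' => psum G m w' ^+ 2)).
rewrite (meanD (integD i0 i1) bG2) (meanD i0 i1) (meanZ _ iG) G0 mulr0 addr0 mean_cst.
rewrite -natr1 mulrDl mul1r lerD//; apply: mean_le_cst => // w.
by rewrite -real_normK ?num_real// lerXn2r ?nnegrE ?normr_ge0// (le_trans _ (GM (U 0%N w))).
Qed.

Lemma mean_partial_sum_ge0 (G : S -> R) (M : R) m : (forall s, `|G s| <= M) ->
  mean P (psum G m) = m%:R * mean P (fun w => G (U 0%N w)).
Proof.
move=> GM; rewrite mean_sum; last by move=> i _; exact: (bounded_integ P (bounded_iid iidU i GM)).
rewrite (eq_bigr (fun=> mean P (fun w => G (U 0%N w)))).
  by rewrite sumr_const card_ord mulr_natl.
by move=> i _; exact: (mean_iid iidU i GM).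
Qed.

(** Truncation: Chebyshev for the clipped and centered part, Markov for the sum of the clipping
    errors. Clipped centered terms are at most [2 * K], so 64 is 16 times 4. *)
Lemma wlln_bound (G : S -> R) (K del : R) m : integ P (fun w => G (U 0%N w)) ->
  0 <= K -> 0 < del -> (0 < m)%N ->
  mean P (fun w => `|G (U 0%N w) - clip K (G (U 0%N w))|) <= del / 4 ->
  pr P (fun w => m%:R * del < `|psum G m w - m%:R * mean P (fun w => G (U 0%N w))|) <=
  64 * K ^+ 2 / (del ^+ 2 * m%:R) +
  2 * mean P (fun w => `|G (U 0%N w) - clip K (G (U 0%N w))|) / del.
Proof.
move=> iG K0 d0 m0; set dK := mean P (fun w => `|_|) => dKd.
have mp : 0 < m%:R :> R by rewrite ltr0n.
pose GK s : R := clip K (G s); pose muK := mean P (fun w => GK (U 0%N w)).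
pose D s : R := `|G s - GK s|.
have bGK : bounded_rv (fun w => GK (U 0%N w)).
  by apply: (bounded_iid iidU 0) => s; exact: clip_le.
have iGK := bounded_integ P bGK.
pose Gc s := GK s - muK.
have muKK : `|muK| <= K by apply: (normr_mean_le iGK) => w; exact: clip_le.
have GcM s : `|Gc s| <= 2 * K.
  by rewrite (le_trans (ler_normB _ _))// mulr_natl mulr2n lerD// clip_le.
have Gc0 : mean P (fun w => Gc (U 0%N w)) = 0.
  by rewrite (meanB iGK (integ_cst _ _)) mean_cst subrr.
(* The errors are capped because means of i.i.d. terms are compared for bounded functions; a cap at
   [m * del] is harmless at the level [m * del / 2] used below. *)
pose Dm s : R := Num.min (D s) (m%:R * del).
have md0 : 0 < m%:R * del by rewrite mulr_gt0.
have DmM s : `|Dm s| <= m%:R * del.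
  by rewrite ger0_norm ?ge_min ?lexx ?orbT// le_min normr_ge0 ltW.
have mu_dist : `|mean P (fun w => G (U 0%N w)) - muK| <= dK.
  rewrite -(meanB iG iGK); apply: normr_mean; exact: integB.
have iD : integ P (fun w => D (U 0%N w)) by apply: integ_norm; exact: integB.
have iDm : integ P (psum Dm m).
  by apply: integ_sum => i _; exact: (bounded_integ P (bounded_iid iidU i DmM)).
have bA : bounded_rv (psum Gc m).
  apply: (@bounded_discrete _ _ _ _ (m%:R * (2 * K))) => [|w]; last exact: partial_sum_le.
  exact: (discrete_partial_sum iidU).
have iA := bounded_integ P (boundedX 2 bA).
(* The deviation [m * del] is shared out: a half to the clipping errors, a quarter to the shift of
   the mean, a quarter to the clipped sum. *)
have pt w : (m%:R * del < `|psum G m w - m%:R * mean P (fun w => G (U 0%N w))|)%R%:R <=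
   16 / (m%:R * del) ^+ 2 * psum Gc m w ^+ 2 + 2 / (m%:R * del) * psum Dm m w.
  have n1 : 0 <= 16 / (m%:R * del) ^+ 2 * psum Gc m w ^+ 2.
    by rewrite mulr_ge0 ?sqr_ge0// divr_ge0 ?sqr_ge0.
  have Dm0 : 0 <= psum Dm m w.
    by apply: sumr_ge0 => i _; rewrite le_min normr_ge0 ltW.
  have n2 : 0 <= 2 / (m%:R * del) * psum Dm m w.
    by apply: mulr_ge0 => //; apply: divr_ge0 => //; exact: ltW.
  case: (ltP _ _) => h; last by rewrite addr_ge0.
  have hm : Num.min (psum D m w) (m%:R * del) <= psum Dm m w.
    exact: (min_sum_le (F := fun i : 'I_m => D (U i w)) (ltW md0) (fun i => normr_ge0 _)).
  have [hD|hD] := leP (m%:R * del / 2) (psum D m w).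
    suff hx : 1 <= 2 / (m%:R * del) * psum Dm m w by apply: (le_trans hx); rewrite lerDr.
    rewrite mulrAC ler_pdivlMr// mul1r -ler_pdivrMl// mulrC.
    by apply: le_trans hm; rewrite le_min hD/=; lra.
  suff hx : 1 <= 16 / (m%:R * del) ^+ 2 * psum Gc m w ^+ 2.
    by apply: (le_trans hx); rewrite lerDl.
  rewrite mulrAC ler_pdivlMr ?exprn_gt0// mul1r.
  have e : psum G m w - m%:R * mean P (fun w => G (U 0%N w)) =
     psum Gc m w + (\sum_(i < m) (G (U i w) - GK (U i w)))
       - m%:R * (mean P (fun w => G (U 0%N w)) - muK).
    by rewrite /partial_sum !sumrB sumr_const card_ord -mulr_natl; ring.
  have hA : m%:R * del / 4 < `|psum Gc m w|.
    have h2 : `|\sum_(i < m) (G (U i w) - GK (U i w))| <= psum D m w.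
      exact: ler_norm_sum.
    have h3 : `|m%:R * (mean P (fun w => G (U 0%N w)) - muK)| <= m%:R * (del / 4).
      by rewrite normrM normr_nat ler_wpM2l// (le_trans mu_dist).
    move: h; rewrite e => h.
    have := lt_le_trans h (ler_normB _ _).
    have := ler_normD (psum Gc m w) (\sum_(i < m) (G (U i w) - GK (U i w))).
    lra.
  have : (m%:R * del / 4) ^+ 2 <= psum Gc m w ^+ 2.
    rewrite -[leRHS]real_normK ?num_real// lerXn2r ?nnegrE ?normr_ge0 ?ltW//.
    by rewrite divr_gt0.
  by rewrite exprMn; lra.
have ib : integ P (fun w =>
    (m%:R * del < `|psum G m w - m%:R * mean P (fun w => G (U 0%N w))|)%R%:R).
  apply/bounded_integ/bounded_bool.
  exact: (discrete_comp (fun y => m%:R * del < `|y - m%:R * mean P (fun w => G (U 0%N w))|)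
    (discrete_partial_sum iidU G m)).
have i1 := integZ (16 / (m%:R * del) ^+ 2) iA.
have i2 := integZ (2 / (m%:R * del)) iDm.
apply: (le_trans (ler_mean ib (integD i1 i2) pt)).
rewrite (meanD i1 i2) (meanZ _ iA) (meanZ _ iDm); apply: lerD.
  apply: (le_trans (ler_wpM2l _ (mean_sqr_partial_sum m GcM Gc0))).
    by rewrite divr_ge0 ?sqr_ge0.
  by rewrite le_eqVlt; apply/orP; left; apply/eqP; field; rewrite !gt_eqF.
rewrite (mean_partial_sum_ge0 m DmM).
have : mean P (fun w => Dm (U 0%N w)) <= dK.
  apply: ler_mean => //; first exact: (bounded_integ P (bounded_iid iidU 0 DmM)).
  by move=> w; rewrite ge_min lexx.
move=> h; rewrite (_ : 2 / (m%:R * del) * (m%:R * mean P (fun w => Dm (U 0%N w))) =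
   2 * mean P (fun w => Dm (U 0%N w)) / del); last by field; rewrite !gt_eqF.
by rewrite ler_pM2r ?invr_gt0// ler_pM2l.
Qed.

Lemma wlln (G : S -> R) (del eps : R) : integ P (fun w => G (U 0%N w)) ->
  0 < del -> 0 < eps -> exists m0, forall m, (m0 <= m)%N ->
  pr P (fun w => m%:R * del < `|psum G m w - m%:R * mean P (fun w => G (U 0%N w))|) <= eps.
Proof.
move=> iG d0 e0.
pose D n := mean P (fun w => `|G (U 0%N w) - clip n%:R (G (U 0%N w))|).
have mG := integ_measurable iG.
have Dcvg : D n @[n --> \oo] --> 0.
  rewrite -[X in _ --> X](mean_cst P 0); apply: (cvg_mean _ _ (integ_norm iG)) => //.
  - move=> n; apply: discrete_measurable.
    exact: (discrete_iid iidU (fun s => `|G s - clip n%:R (G s)|) 0).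
  - by move=> n w; rewrite normr_id clip_dist_le.
  move=> w; apply: cvg_near_cst.
  have [n0 hn0] := ex_nat_ge `|G (U 0%N w)|.
  by exists n0 => // n /= /hn0 h; rewrite clip_id// subrr normr0.
have e40 : 0 < Num.min (del / 4) (eps * del / 4).
  by rewrite lt_min !divr_gt0 ?mulr_gt0.
have [K _ hK] := iffLR (cvgrPdist_le _ _) Dcvg _ e40.
have {hK} := hK K (leqnn K); rewrite /= sub0r normrN => /(le_trans (ler_norm _)).
rewrite le_min => /andP[D1 D2].
have [m0 hm0] := ex_nat_ge (64 * K%:R ^+ 2 / (del ^+ 2 * (eps / 2)) : R).
exists m0.+1 => m mm.
have m1 : (0 < m)%N by exact: leq_trans mm.
rewrite (le_trans (wlln_bound iG (ler0n _ K) d0 m1 D1))//.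
have mp : 0 < m%:R :> R by rewrite ltr0n.
have h1 : 64 * K%:R ^+ 2 / (del ^+ 2 * m%:R) <= eps / 2.
  have := hm0 m (ltnW mm).
  rewrite !ler_pdivrMr ?mulr_gt0 ?exprn_gt0 ?divr_gt0//.
  by move/le_trans; apply; rewrite le_eqVlt; apply/orP; left; apply/eqP; ring.
have h2 : 2 * D K / del <= eps / 2.
  by rewrite ler_pdivrMr//; lra.
by move: h1 h2; rewrite /D; lra.
Qed.

End wlln.

(** * Tightness at scale [sqrt m] forces a finite variance and mean zero *)

Section finite_variance.
Context {d : measure_display} {T : measurableType d} {R : realType}.
Variable P : probability T R.
Context {S : countType}.
Variable U : nat -> T -> S.
Hypothesis iidU : iid P U.
Variable G : S -> R.
Local Notation W := (partial_sum U G).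
Local Notation Y := (fun w => G (U 0%N w)).

(** Real and imaginary parts of the characteristic functions of the sum and of one summand. *)
Let cosm m t := mean P (fun w => cos (t * W m w)).
Let sinm m t := mean P (fun w => sin (t * W m w)).
Let cosy t := mean P (fun w => cos (t * Y w)).
Let siny t := mean P (fun w => sin (t * Y w)).

Let bounded_cos (Z : T -> R) t : discrete_rv Z -> bounded_rv (fun w => cos (t * Z w)).
Proof.
move=> dZ; apply: (@bounded_discrete _ _ _ _ 1) => [|w]; last exact: cos_max.
exact: (discrete_comp (fun z => cos (t * z)) dZ).
Qed.

Let bounded_sin (Z : T -> R) t : discrete_rv Z -> bounded_rv (fun w => sin (t * Z w)).
Proof.
move=> dZ; apply: (@bounded_discrete _ _ _ _ 1) => [|w]; last exact: sin_max.
exact: (discrete_comp (fun z => sin (t * z)) dZ).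
Qed.

Let dW m : discrete_rv (W m) := discrete_partial_sum iidU G m.
Let dY : discrete_rv Y := discrete_iid iidU G 0.

Let icW m t : integ P (fun w => cos (t * W m w)) := bounded_integ P (bounded_cos t (dW m)).
Let isW m t : integ P (fun w => sin (t * W m w)) := bounded_integ P (bounded_sin t (dW m)).
Let icY t : integ P (fun w => cos (t * Y w)) := bounded_integ P (bounded_cos t dY).
Let isY t : integ P (fun w => sin (t * Y w)) := bounded_integ P (bounded_sin t dY).

Let cosmS m t : cosm m.+1 t = cosm m t * cosy t - sinm m t * siny t.
Proof.
transitivity (mean P (fun w => cos (t * (W m w + G (U m w))))).
  by apply: eq_mean => w; rewrite partial_sumS.
rewrite (mean_partial_sum_step iidU (F := fun a b => cos (t * (a + b))) (M := 1)); last first.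
  by move=> *; exact: cos_max.
transitivity (mean P (fun w => cosm m t * cos (t * Y w) - sinm m t * sin (t * Y w))).
  apply: eq_mean => w.
  transitivity (mean P (fun w' => cos (t * Y w) * cos (t * W m w') -
      sin (t * Y w) * sin (t * W m w'))).
    by apply: eq_mean => w'; rewrite mulrDr cosD; ring.
  rewrite (meanB (integZ _ (icW m t)) (integZ _ (isW m t))) (meanZ _ (icW m t)) (meanZ _ (isW m t)).
  by rewrite /cosm /sinm; ring.
by rewrite (meanB (integZ _ (icY t)) (integZ _ (isY t))) (meanZ _ (icY t)) (meanZ _ (isY t)).
Qed.

Let sinmS m t : sinm m.+1 t = sinm m t * cosy t + cosm m t * siny t.
Proof.
transitivity (mean P (fun w => sin (t * (W m w + G (U m w))))).
  by apply: eq_mean => w; rewrite partial_sumS.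
rewrite (mean_partial_sum_step iidU (F := fun a b => sin (t * (a + b))) (M := 1)); last first.
  by move=> *; exact: sin_max.
transitivity (mean P (fun w => sinm m t * cos (t * Y w) + cosm m t * sin (t * Y w))).
  apply: eq_mean => w.
  transitivity (mean P (fun w' => cos (t * Y w) * sin (t * W m w') +
      sin (t * Y w) * cos (t * W m w'))).
    by apply: eq_mean => w'; rewrite mulrDr sinD; ring.
  rewrite (meanD (integZ _ (isW m t)) (integZ _ (icW m t))) (meanZ _ (icW m t)) (meanZ _ (isW m t)).
  by rewrite /cosm /sinm; ring.
by rewrite (meanD (integZ _ (icY t)) (integZ _ (isY t))) (meanZ _ (icY t)) (meanZ _ (isY t)).
Qed.

Let modulus m t : cosm m t ^+ 2 + sinm m t ^+ 2 = (cosy t ^+ 2 + siny t ^+ 2) ^+ m.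
Proof.
elim: m => [|m ih].
  rewrite /cosm /sinm; under eq_mean do rewrite partial_sum0 mulr0 cos0.
  under [X in _ + X ^+ 2]eq_mean do rewrite partial_sum0 mulr0 sin0.
  by rewrite !mean_cst expr0n expr1n addr0.
by rewrite [RHS]exprS -ih cosmS sinmS; ring.
Qed.

(** The difference of two independent copies has the squared modulus as its characteristic function.
    The integrand is nonnegative, so it may be restricted to events. *)
Let symmetrized t : mean P (fun w' => mean P (fun w => 1 - cos (t * (Y w - Y w')))) =
  1 - (cosy t ^+ 2 + siny t ^+ 2).
Proof.
transitivity (mean P (fun w' => 1 - (cosy t * cos (t * Y w') + siny t * sin (t * Y w')))).
  apply: eq_mean => w'.
  transitivity (mean P (fun w => 1 - (cos (t * Y w') * cos (t * Y w) +
      sin (t * Y w') * sin (t * Y w)))).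
    by apply: eq_mean => w; rewrite mulrBr cosB; ring.
  rewrite (meanB (integ_cst _ _) (integD (integZ _ (icY t)) (integZ _ (isY t)))).
  rewrite mean_cst (meanD (integZ _ (icY t)) (integZ _ (isY t))) (meanZ _ (icY t)) (meanZ _ (isY t)).
  by rewrite /cosy /siny; ring.
rewrite (meanB (integ_cst _ _) (integD (integZ _ (icY t)) (integZ _ (isY t)))).
rewrite mean_cst (meanD (integZ _ (icY t)) (integZ _ (isY t))) (meanZ _ (icY t)) (meanZ _ (isY t)).
by rewrite !expr2.
Qed.

(** Tightness keeps the characteristic function of the sum away from 0 at [t = tau / sqrt m]. Its
    squared modulus is [q ^+ m], at most [expR (- m (1 - q))], so [m (1 - q)] is bounded. *)
Let char_bound (A tau : R) m : 0 < A -> 0 < tau -> tau * A <= 1 / 2 -> (0 < m)%N ->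
  pr P (fun w => A * Num.sqrt m%:R < `|W m w|) <= 1 / 4 ->
  m%:R * (1 - (cosy (tau / Num.sqrt m%:R) ^+ 2 + siny (tau / Num.sqrt m%:R) ^+ 2)) <= 10.
Proof.
move=> A0 t0 tA m0; set t := tau / _; set b := fun w => _ < _ => tight.
have sm0 : 0 < Num.sqrt m%:R :> R by rewrite sqrtr_gt0 ltr0n.
have tt0 : 0 <= t := divr_ge0 (ltW t0) (ltW sm0).
have db : discrete_rv b.
  exact: (discrete_comp (fun y => A * Num.sqrt m%:R < `|y|) (dW m)).
have ib := bounded_integ P (bounded_bool (R := R) db).
(* Off the exceptional event the cosine is at least 7/8, on it at least -1; both are at least
   [3/4 - 7/4 b], whose mean is at least 3/4 - 7/16 = 5/16. *)
have c1 : 5 / 16 <= cosm m t.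
  apply: (@le_trans _ _ (mean P (fun w => 3 / 4 - 7 / 4 * (b w)%:R))).
    rewrite (meanB (integ_cst _ _) (integZ _ ib)) mean_cst (meanZ _ ib).
    by move: tight; rewrite /pr; lra.
  apply: ler_mean => [||w]; [exact: integB (integ_cst _ _) (integZ _ ib)|exact: icW|].
  rewrite /b; case: (ltP _ _) => h /=.
    by have := cos_geN1 (t * W m w); lra.
  have u : `|t * W m w| <= 1 / 2.
    rewrite normrM (ger0_norm tt0).
    apply: (@le_trans _ _ (t * (A * Num.sqrt m%:R))); first exact: ler_wpM2l.
    by rewrite /t [A * _]mulrC mulrA divfK ?gt_eqF.
  have := cos_ge (t * W m w).
  have : (t * W m w) ^+ 2 <= (1 / 2) ^+ 2.
    by rewrite -real_normK ?num_real// lerXn2r ?nnegrE ?normr_ge0.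
  by rewrite mulr0; lra.
set q := cosy t ^+ 2 + siny t ^+ 2.
have q0 : 0 <= q by rewrite addr_ge0 ?sqr_ge0.
(* The square of 5/16 exceeds 1/11, and [1 + u <= expR u <= 11] will give the bound 10. *)
have qm : 1 / 11 <= q ^+ m.
  rewrite -modulus (@le_trans _ _ (cosm m t ^+ 2)) ?lerDl ?sqr_ge0//.
  rewrite (@le_trans _ _ ((5 / 16) ^+ 2))//; first by lra.
  by rewrite lerXn2r ?nnegrE// (le_trans _ c1).
have : q ^+ m <= expR (- (m%:R * (1 - q))).
  rewrite -mulrN expRM_natl lerXn2r ?nnegrE ?expR_ge0//.
  by have := expR_ge1Dx (- (1 - q)); lra.
rewrite expRN => h.
have := expR_ge1Dx (m%:R * (1 - q)).
move: (m%:R * (1 - q)) h => u h; have e0 := expR_gt0 u.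
have : 1 / 11 <= (expR u)^-1 by exact: le_trans h.
rewrite -[leRHS]mul1r ler_pdivlMr//; lra.
Qed.

(** Monotone convergence turns a uniform bound on real means of truncations into integrability. *)
Lemma integ_truncations (Z : T -> R) (C : R) : measurable_fun setT Z ->
  (forall w, 0 <= Z w) ->
  (forall n : nat, mean P (fun w => Z w * (Z w <= n%:R)%R%:R) <= C) -> integ P Z.
Proof.
move=> mZ Z0 hC; apply/integrableP; split; first exact/measurable_EFinP.
pose Zn n w := Z w * (Z w <= n%:R)%R%:R.
have mZn n : measurable_fun setT (Zn n).
  apply: measurable_funM => //.
  rewrite (_ : (fun w => _) = (fun w => if Z w <= n%:R then 1 else 0)); last first.
    by apply/funext => w; case: ifP.
  by apply: measurable_fun_ifT => //; exact: measurable_fun_ler.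
have Zn0 n w : 0 <= Zn n w by rewrite mulr_ge0.
have iZn n : integ P (Zn n).
  apply: (@integ_bounded _ _ _ _ _ n%:R) => // w; rewrite ger0_norm// /Zn.
  by case: (leP (Z w) n%:R); rewrite ?mulr1 ?mulr0.
have lZ w : (Zn n w)%:E @[n --> \oo] --> (Z w)%:E.
  apply: cvg_near_cst; have [n0 hn0] := ex_nat_ge (Z w).
  by exists n0 => // n /= /hn0 h; rewrite /Zn h mulr1.
apply: (@le_lt_trans _ _ C%:E); last exact: ltry.
have -> : (\int[P]_w `|(EFin \o Z) w| = \int[P]_w (limn (fun n => (Zn n w)%:E)))%E.
  apply: eq_integral => w _; rewrite (cvg_lim _ (lZ w))//=.
  by rewrite ger0_norm.
have nd w n m : (n <= m)%N -> ((Zn n w)%:E <= (Zn m w)%:E)%E.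
  move=> nm; rewrite lee_fin ler_wpM2l//.
  case: (leP (Z w) n%:R) => h; last exact: ler0n.
  suff -> : Z w <= m%:R by [].
  by rewrite (le_trans h)// ler_nat.
have cv := @cvg_monotone_convergence _ _ _ P setT measurableT (fun n w => (Zn n w)%:E)
  (fun n => (measurable_EFinP _ _).2 (mZn n)) (fun n w _ => Zn0 n w) (fun w _ n m => nd w n m).
rewrite -(cvg_lim _ cv)//; apply: lime_le; first by apply/cvg_ex; eexists; exact: cv.
by apply: nearW => n; rewrite (integral_mean (iZn n)) lee_fin; exact: hC.
Qed.

Let one_minus_cos_ge (u : R) : `|u| <= 1 -> u ^+ 2 / 4 <= 1 - cos u.
Proof.
move=> u1; have := cos_le u.
have u2 : u ^+ 2 <= 1 by rewrite -real_normK ?num_real// expr_le1.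
have -> : u ^+ 4 = u ^+ 2 * u ^+ 2 by rewrite -exprD.
have := sqr_ge0 u; move: (u ^+ 2) u2 => v v1 v0; nra.
Qed.

(** If [|Y'| <= K] and [|Y| > 2 K], then [|Y - Y'|] lies between [|Y| / 2] and [3 |Y| / 2], so the
    symmetrized cosine controls [Y ^+ 2] itself. The event for [Y'] has probability at least 1/2,
    which turns 16 into 32; the values [|Y| <= 2 K] account for [4 * K ^+ 2]. *)
Let truncated_bound (K t : R) : 0 <= K -> 0 < t ->
  1 / 2 <= pr P (fun w => `|Y w| <= K) ->
  mean P (fun w => Y w ^+ 2 * (`|Y w| <= 1 / (2 * t))%R%:R) <=
  4 * K ^+ 2 + 32 / t ^+ 2 * (1 - (cosy t ^+ 2 + siny t ^+ 2)).
Proof.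
move=> K0 t0 hK.
pose b w := `|Y w| <= K; pose a w := (2 * K < `|Y w|) && (`|Y w| <= 1 / (2 * t)).
have db : discrete_rv b by exact: (discrete_comp (fun y => `|y| <= K) dY).
have da : discrete_rv a.
  exact: (discrete_comp (fun y => (2 * K < `|y|) && (`|y| <= 1 / (2 * t))) dY).
pose Z w := Y w ^+ 2 * (a w)%:R.
have t20 : 0 < 1 / (2 * t) by rewrite divr_gt0// mulr_gt0.
have bZ : bounded_rv Z.
  apply: (@bounded_discrete _ _ _ _ ((1 / (2 * t)) ^+ 2)).
    exact: (discrete_comp
      (fun y => y ^+ 2 * ((2 * K < `|y|) && (`|y| <= 1 / (2 * t)))%R%:R) dY).
  move=> w; rewrite /Z normrM normrX /a; case: andP => [[_ h]|_].
    by rewrite normr1 mulr1 lerXn2r// nnegrE ltW.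
  by rewrite normr0 mulr0 sqr_ge0.
have iZ := bounded_integ P bZ.
have ib := bounded_integ P (bounded_bool (R := R) db).
have cc w' : integ P (fun w => 1 - cos (t * (Y w - Y w'))).
  apply: (@integ_bounded _ _ _ _ _ 2) => [|v].
    exact: (discrete_measurable (discrete_comp (fun y => 1 - cos (t * (y - Y w'))) dY)).
  by rewrite ger0_norm ?subr_ge0 ?cos_le1//; have := cos_geN1 (t * (Y v - Y w')); lra.
have inner w' : (b w')%:R * (t ^+ 2 / 16 * mean P Z) <=
    mean P (fun w => 1 - cos (t * (Y w - Y w'))).
  rewrite /b; case: (leP (`|Y w'|) K) => h; last first.
    by rewrite mul0r mean_ge0// => w; rewrite subr_ge0 cos_le1.
  rewrite mul1r -(meanZ _ iZ); apply: ler_mean => [||w]; [exact: integZ|exact: cc|].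
  rewrite /Z /a; case: andP => [[h1 h2]|_]; last by rewrite mulr0 mulr0 subr_ge0 cos_le1.
  rewrite mulr1.
  have u1 : `|Y w - Y w'| <= 3 / 2 * `|Y w| by rewrite (le_trans (ler_normB _ _))//; lra.
  have u2 : `|Y w| / 2 <= `|Y w - Y w'| by have := lerB_dist (Y w) (Y w'); lra.
  have u3 : `|t * (Y w - Y w')| <= 1.
    rewrite normrM (gtr0_norm t0) (@le_trans _ _ (t * (3 / 2 * (1 / (2 * t)))))//.
      by rewrite ler_wpM2l ?(ltW t0)// (le_trans u1)// ler_wpM2l.
    rewrite (_ : t * (3 / 2 * (1 / (2 * t))) = 3 / 4); first by lra.
    by field; rewrite gt_eqF.
  apply: le_trans (one_minus_cos_ge u3).
  rewrite exprMn -[Y w ^+ 2]real_normK ?num_real// -[(Y w - _) ^+ 2]real_normK ?num_real//.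
  have -> : t ^+ 2 / 16 * `|Y w| ^+ 2 = t ^+ 2 * ((`|Y w| / 2) ^+ 2) / 4 by field.
  rewrite ler_pM2r ?invr_gt0// ler_wpM2l ?sqr_ge0// lerXn2r ?nnegrE//.
have outer : pr P b * (t ^+ 2 / 16 * mean P Z) <= 1 - (cosy t ^+ 2 + siny t ^+ 2).
  rewrite -symmetrized mulrC -(meanZ _ ib); apply: ler_mean => [||w].
  - exact: integZ.
  - apply: (@integ_bounded _ _ _ _ _ 2) => [|w'].
      exact: (discrete_measurable (discrete_comp
        (fun y => mean P (fun w => 1 - cos (t * (Y w - y)))) dY)).
    apply: (normr_mean_le (cc w')) => w.
    by rewrite ger0_norm ?subr_ge0 ?cos_le1//; have := cos_geN1 (t * (Y w - Y w')); lra.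
  - by rewrite mulrC inner.
have Z0 : 0 <= mean P Z by apply: mean_ge0 => w; rewrite mulr_ge0 ?sqr_ge0.
have t2 : 0 < t ^+ 2 by rewrite exprn_gt0.
have : mean P Z <= 32 / t ^+ 2 * (1 - (cosy t ^+ 2 + siny t ^+ 2)).
  rewrite -mulrA -ler_pdivrMl// mulrC [_^-1 * _]mulrC ler_pdivlMr//.
  apply: le_trans outer; rewrite -/(pr P b) in hK.
  have p : 0 <= t ^+ 2 / 16 * mean P Z by rewrite mulr_ge0 ?divr_ge0 ?(ltW t2).
  by have := ler_wpM2r p hK; lra.
move=> hZ; have -> : 4 * K ^+ 2 = mean P (fun=> 4 * K ^+ 2) by rewrite mean_cst.
apply: (le_trans _ (lerD (lexx _) hZ)).
rewrite -(meanD (integ_cst _ _) iZ); apply: ler_mean => [||w].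
- apply: (@integ_bounded _ _ _ _ _ ((1 / (2 * t)) ^+ 2)).
    exact: (discrete_measurable (discrete_comp
      (fun y => y ^+ 2 * (`|y| <= 1 / (2 * t))%R%:R) dY)).
  move=> w; rewrite normrM normrX; case: (leP `|Y w| _) => h.
    by rewrite normr1 mulr1 lerXn2r// nnegrE ltW.
  by rewrite normr0 mulr0 sqr_ge0.
- exact: integD (integ_cst _ _) iZ.
have q0 : 0 <= 4 * K ^+ 2 by rewrite mulr_ge0 ?sqr_ge0.
rewrite /Z /a; case: (leP `|Y w| (1 / (2 * t))) => h; last by rewrite mulr0 andbF mulr0 addr0.
rewrite andbT; case: (leP `|Y w| (2 * K)) => h'; last by rewrite lerDr.
rewrite mulr1 mulr0 addr0 -[Y w ^+ 2]real_normK ?num_real//.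
have -> : 4 * K ^+ 2 = (2 * K) ^+ 2 by ring.
by rewrite lerXn2r ?nnegrE// mulr_ge0.
Qed.

(** Along [t = tau / sqrt m] the truncation level [1 / (2 t)] tends to infinity, while [char_bound]
    keeps [(1 - q) / t ^+ 2] bounded. All truncated second moments thus share one bound. *)
Lemma integ_sqr_of_tight (A : R) m0 : 0 < A ->
  (forall m, (m0 <= m)%N -> pr P (fun w => A * Num.sqrt m%:R < `|W m w|) <= 1 / 4) ->
  integ P (fun w => Y w ^+ 2).
Proof.
move=> A0 tight.
have [K0 hK0] : exists K : nat, 1 / 2 <= pr P (fun w => `|Y w| <= K%:R).
  have : pr P (fun w => `|Y w| <= n%:R) @[n --> \oo] --> (1 : R).
    rewrite -[X in _ --> X](mean_cst P 1) /pr.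
    apply: (cvg_mean _ _ (integ_cst P 1)) => //.
    - move=> n; apply: discrete_measurable.
      exact: (discrete_comp (fun y => (`|y| <= n%:R)%R%:R) dY).
    - by move=> n w; rewrite normr_nat lern1 leq_b1.
    - move=> w; apply: cvg_near_cst; have [n0 hn0] := ex_nat_ge `|Y w|.
      by exists n0 => // n /= /hn0 ->.
  have h2 : 0 < 1 / 2 :> R by [].
  move=> /cvgrPdist_le/(_ _ h2)[K _ /(_ K (leqnn K))] /= h; exists K.
  by move: h; rewrite ler_norml => /andP[_]; lra.
pose tau := 1 / (2 * A) : R.
have tau0 : 0 < tau by rewrite divr_gt0// mulr_gt0.
have tau2 : 0 < 4 * tau ^+ 2 by rewrite mulr_gt0// exprn_gt0.
have tA : tau * A <= 1 / 2.
  by rewrite (_ : tau * A = 1 / 2)// /tau; field; rewrite gt_eqF.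
apply: (@integ_truncations _ (4 * K0%:R ^+ 2 + 320 / tau ^+ 2)) => [|w|n].
- by apply: measurable_funX; exact: discrete_measurable.
- exact: sqr_ge0.
have [m1 hm1] := ex_nat_ge (4 * tau ^+ 2 * n%:R).
pose m := (maxn m0 (maxn m1 1))%N.
have mm0 : (m0 <= m)%N by exact: leq_maxl.
have mm1 : (m1 <= m)%N by rewrite /m; lia.
have mp : (0 < m)%N by rewrite /m; lia.
have sm0 : 0 < Num.sqrt m%:R :> R by rewrite sqrtr_gt0 ltr0n.
have m0' : 0 < m%:R :> R by rewrite ltr0n.
have t0 : 0 < tau / Num.sqrt m%:R by rewrite divr_gt0.
have hc := char_bound A0 tau0 tA mp (tight m mm0).
have ht := truncated_bound (ler0n _ K0) t0 hK0.
have t2 : (tau / Num.sqrt m%:R) ^+ 2 = tau ^+ 2 / m%:R.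
  by rewrite exprMn exprVn sqr_sqrtr ?ler0n.
apply: (@le_trans _ _ (mean P (fun w => Y w ^+ 2 *
    (`|Y w| <= 1 / (2 * (tau / Num.sqrt m%:R)))%R%:R))); last first.
  apply: (le_trans ht); rewrite lerD2l t2.
  set q := 1 - _ in hc *.
  rewrite (_ : 32 / (tau ^+ 2 / m%:R) * q = 32 / tau ^+ 2 * (m%:R * q)); last first.
    by field; rewrite !gt_eqF.
  rewrite (_ : 320 / tau ^+ 2 = 32 / tau ^+ 2 * 10); last by field; rewrite gt_eqF.
  by rewrite ler_wpM2l// divr_ge0 ?sqr_ge0.
have p0 : 0 < 1 / (2 * (tau / Num.sqrt m%:R)) by rewrite divr_gt0// mulr_gt0.
have e1 : (1 / (2 * (tau / Num.sqrt m%:R))) ^+ 2 = m%:R / (4 * tau ^+ 2).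
  by rewrite exprMn expr1n mul1r exprVn exprMn t2; field; rewrite !gt_eqF.
have le1 w : Y w ^+ 2 * (Y w ^+ 2 <= n%:R)%R%:R <=
    Y w ^+ 2 * (`|Y w| <= 1 / (2 * (tau / Num.sqrt m%:R)))%R%:R.
  apply: ler_wpM2l; first exact: sqr_ge0.
  case: (leP (Y w ^+ 2) n%:R) => h; last exact: ler0n.
  suff -> : `|Y w| <= 1 / (2 * (tau / Num.sqrt m%:R)) by [].
  rewrite -(@ler_pXn2r _ 2) ?nnegrE ?normr_ge0 ?(ltW p0)// e1 real_normK ?num_real//.
  apply: (le_trans h); rewrite (ler_pdivlMr _ _ tau2) mulrC.
  exact: hm1.
apply: ler_mean => //.
- apply: (@integ_bounded _ _ _ _ _ n%:R).
    exact: (discrete_measurable (discrete_comp (fun y => y ^+ 2 * (y ^+ 2 <= n%:R)%R%:R) dY)).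
  move=> w; rewrite ger0_norm; last by apply: mulr_ge0 => //; exact: sqr_ge0.
  by case: (leP (Y w ^+ 2) n%:R) => h; rewrite ?mulr1 ?mulr0.
- apply: (@integ_bounded _ _ _ _ _ ((1 / (2 * (tau / Num.sqrt m%:R))) ^+ 2)).
    exact: (discrete_measurable (discrete_comp
      (fun y => y ^+ 2 * (`|y| <= 1 / (2 * (tau / Num.sqrt m%:R)))%R%:R) dY)).
  move=> w; rewrite normrM normrX; case: (leP `|Y w| _) => h.
    by rewrite normr1 mulr1 lerXn2r// nnegrE ltW.
  by rewrite normr0 mulr0 sqr_ge0.
Qed.

(** With a nonzero mean the law of large numbers makes [|W m|] at least [m |mu| / 2] with
    probability 3/4, against a bound of order [sqrt m] with probability 3/4. *)
Lemma mean0_of_tight (A : R) m0 : 0 < A -> integ P Y ->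
  (forall m, (m0 <= m)%N -> pr P (fun w => A * Num.sqrt m%:R < `|W m w|) <= 1 / 4) ->
  mean P Y = 0.
Proof.
move=> A0 iY tight; apply/eqP/negPn/negP => mu0.
set mu := mean P Y in mu0 *.
have mu1 : 0 < `|mu| by rewrite normr_gt0.
have h4 : 0 < 1 / 4 :> R by [].
have mu2 : 0 < `|mu| / 2 by rewrite divr_gt0.
have [m1 hm1] := wlln iidU iY mu2 h4.
have [m2 hm2] := ex_nat_ge ((4 * A / `|mu|) ^+ 2).
pose m := (maxn m0 (maxn m1 (maxn m2 1)))%N.
have := tight m (leq_maxl _ _).
have mm1 : (m1 <= m)%N by rewrite /m; lia.
have mm2 : (m2 <= m)%N by rewrite /m; lia.
have := hm1 m mm1; rewrite -/mu.
have m0' : 0 < m%:R :> R by rewrite ltr0n /m; lia.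
have sm0 : 0 < Num.sqrt m%:R :> R by rewrite sqrtr_gt0.
have key : A * Num.sqrt m%:R <= m%:R * (`|mu| / 4).
  have : 4 * A / `|mu| <= Num.sqrt m%:R.
    rewrite -(@ler_pXn2r _ 2) ?nnegrE ?(ltW sm0) ?divr_ge0 ?mulr_ge0 ?(ltW A0)//.
    by rewrite sqr_sqrtr ?ler0n ?hm2.
  rewrite ler_pdivrMr// => h; rewrite -[in leRHS](@sqr_sqrtr _ m%:R) ?ler0n//.
  by rewrite expr2 -mulrA mulrC ler_pM2l// mulrA ler_pdivlMr// mulrC.
set b1 := fun w => _ < _; set b2 := fun w => _ < _ => p1 p2.
have d1 : discrete_rv b1.
  exact: (discrete_comp (fun y => m%:R * (`|mu| / 2) < `|y - m%:R * mu|) (dW m)).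
have d2 : discrete_rv b2.
  exact: (discrete_comp (fun y => A * Num.sqrt m%:R < `|y|) (dW m)).
have i1 := bounded_integ P (bounded_bool (R := R) d1).
have i2 := bounded_integ P (bounded_bool (R := R) d2).
have : 1 <= pr P b1 + pr P b2; last by lra.
rewrite -(meanD i1 i2) -[leLHS](mean_cst P 1); apply: ler_mean => [||w].
- exact: integ_cst.
- exact: integD.
rewrite -natrD ler1n /b1 /b2; case: (ltP _ `|W m w|) => h2; first by rewrite addn1.
case: (ltP _ _) => h1 //.
exfalso; have := lerB_dist (m%:R * mu) (W m w); rewrite distrC.
rewrite normrM normr_nat; move: h1 h2 key.
move: `|W m w - _| `|W m w| (Num.sqrt _) => a b s h1 h2 key.
have m0mu : 0 < m%:R * `|mu| by rewrite mulr_gt0.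
lra.
Qed.

End finite_variance.

(** * Convergence in distribution through smooth test functions *)

Section splines.
Context {R : realType}.
Implicit Types (x y t a b : R) (u v : R -> R).

Let pos x : R := Num.max x 0.

(** The third derivative of the cubed positive part is 0 or 6, whence the constant 1. Its translates
    are the building blocks of the splines. *)
Let cub_taylor x y :
  `|pos (x + y) ^+ 3 - pos x ^+ 3 - 3 * pos x ^+ 2 * y - 6 * pos x * (y ^+ 2 / 2)|
  <= `|y| ^+ 3.
Proof.
rewrite /pos; have [x0|x0] := leP x 0; have [xy0|xy0] := leP (x + y) 0.
- by rewrite !expr0n/= !mulr0 !mul0r !subr0 normr0 exprn_ge0.
- rewrite !expr0n/= !mulr0 !mul0r !subr0 normrX lerXn2r ?nnegrE ?normr_ge0//.
  by rewrite !ger0_norm; lra.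
- have y0 : y < 0 by lra.
  rewrite (ltr0_norm y0).
  rewrite !expr0n/= ler_norml.
  rewrite (_ : 0 - x ^+ 3 - 3 * x ^+ 2 * y - 6 * x * (y ^+ 2 / 2) = y ^+ 3 - (x + y) ^+ 3); last by field.
  have xy : y <= x + y by lra.
  have h1 : 0 <= (- (x + y)) ^+ 3 by rewrite exprn_ge0// oppr_ge0.
  have h2 : (- (x + y)) ^+ 3 <= (- y) ^+ 3.
    by rewrite lerXn2r ?nnegrE//; lra.
  have eN (v : R) : (- v) ^+ 3 = - v ^+ 3 by ring.
  by move: h1 h2; rewrite !eN => h1 h2; apply/andP; split; lra.
- rewrite -normrX; rewrite (_ : (x + y) ^+ 3 - x ^+ 3 - 3 * x ^+ 2 * y - 6 * x * (y ^+ 2 / 2) = y ^+ 3)//.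
  by field.
Qed.

(* Difference of the primitives of the quadratic B-spline with knots 0, 1, 2, 3:
   a nondecreasing function, 0 before 0 and 1 after 3. *)
Definition ramp x : R :=
  (pos x ^+ 3 - 3 * pos (x - 1) ^+ 3 + 3 * pos (x - 2) ^+ 3 - pos (x - 3) ^+ 3) / 6.

Let ramp1 x : R :=
  (pos x ^+ 2 - 3 * pos (x - 1) ^+ 2 + 3 * pos (x - 2) ^+ 2 - pos (x - 3) ^+ 2) / 2.

Let ramp2 x : R := pos x - 3 * pos (x - 1) + 3 * pos (x - 2) - pos (x - 3).

Let pos_ge x : 0 <= x -> pos x = x.
Proof. by move=> x0; rewrite /pos max_l. Qed.

Let pos_le x : x <= 0 -> pos x = 0.
Proof. by move=> x0; rewrite /pos max_r. Qed.

Lemma ramp_le0 x : x <= 0 -> ramp x = 0 /\ ramp1 x = 0 /\ ramp2 x = 0.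
Proof.
move=> x0; rewrite /ramp /ramp1 /ramp2.
rewrite (pos_le x0) (@pos_le (x - 1)) ?(@pos_le (x - 2)) ?(@pos_le (x - 3)); try lra;
by rewrite !expr0n/=; lra.
Qed.

Lemma ramp_ge3 x : 3 <= x -> ramp x = 1 /\ ramp1 x = 0 /\ ramp2 x = 0.
Proof.
move=> x0; rewrite /ramp /ramp1 /ramp2.
rewrite (@pos_ge x) ?(@pos_ge (x - 1)) ?(@pos_ge (x - 2)) ?(@pos_ge (x - 3)); try lra;
by split; [field|split; [field|ring]].
Qed.

Let ramp_01 s : 0 <= s <= 1 -> ramp s = s ^+ 3 / 6 /\ ramp1 s = s ^+ 2 / 2 /\ ramp2 s = s.
Proof.
move=> /andP[s0 s1]; rewrite /ramp /ramp1 /ramp2.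
rewrite (@pos_ge s) ?(@pos_le (s - 1)) ?(@pos_le (s - 2)) ?(@pos_le (s - 3)); try lra;
by rewrite ?expr0n/=; split; [field|split; [field|ring]].
Qed.

Let ramp_12 s : 0 <= s <= 1 -> ramp (1 + s) = (1 + 3 * s + 3 * s ^+ 2 - 2 * s ^+ 3) / 6 /\
  ramp1 (1 + s) = (1 + 2 * s - 2 * s ^+ 2) / 2 /\ ramp2 (1 + s) = 1 - 2 * s.
Proof.
move=> /andP[s0 s1]; rewrite /ramp /ramp1 /ramp2.
rewrite (@pos_ge (1 + s)) ?(@pos_ge (1 + s - 1)) ?(@pos_le (1 + s - 2)) ?(@pos_le (1 + s - 3)); try lra;
by rewrite ?expr0n/=; split; [field|split; [field|ring]].
Qed.

Let ramp_23 s : 0 <= s <= 1 -> ramp (2 + s) = 1 - (1 - s) ^+ 3 / 6 /\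
  ramp1 (2 + s) = (1 - s) ^+ 2 / 2 /\ ramp2 (2 + s) = s - 1.
Proof.
move=> /andP[s0 s1]; rewrite /ramp /ramp1 /ramp2.
rewrite (@pos_ge (2 + s)) ?(@pos_ge (2 + s - 1)) ?(@pos_ge (2 + s - 2)) ?(@pos_le (2 + s - 3)); try lra;
by rewrite ?expr0n/=; split; [field|split; [field|ring]].
Qed.

Let ramp_cases (Q : R -> Prop) : (forall x, x <= 0 -> Q x) -> (forall x, 3 <= x -> Q x) ->
  (forall s, 0 <= s <= 1 -> Q s) -> (forall s, 0 <= s <= 1 -> Q (1 + s)) ->
  (forall s, 0 <= s <= 1 -> Q (2 + s)) -> forall x, Q x.
Proof.
move=> h0 h3 h01 h12 h23 x.
have [/h0//|x0] := leP x 0; have [x1|x1] := leP x 1; first by apply: h01; lra.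
have [x2|x2] := leP x 2; first by rewrite (_ : x = 1 + (x - 1)); [apply: h12; lra|ring].
have [x3|x3] := leP x 3; first by rewrite (_ : x = 2 + (x - 2)); [apply: h23; lra|ring].
by apply: h3; exact: ltW.
Qed.

Lemma ramp_bound x : [/\ 0 <= ramp x <= 1, `|ramp1 x| <= 1 & `|ramp2 x| <= 1].
Proof.
move: x; apply: ramp_cases => [x /ramp_le0[->[-> ->]]|x /ramp_ge3[->[-> ->]]| s s01 | s s01 | s s01].
- by rewrite normr0; split; lra.
- by rewrite normr0; split; lra.
- have [-> [-> ->]] := ramp_01 s01; move: s01 => /andP[s0 s1].
  have h1 : s ^+ 3 <= 1 by rewrite exprn_ile1.
  have h2 : s ^+ 2 <= 1 by rewrite exprn_ile1.
  have h3 := exprn_ge0 3 s0; have h4 := exprn_ge0 2 s0.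
  by split; rewrite ?ger0_norm ?divr_ge0//; lra.
- have [-> [-> ->]] := ramp_12 s01; move: s01 => /andP[s0 s1].
  have h1 : s ^+ 3 <= s ^+ 2 by rewrite ler_wiXn2l.
  have h2 : s ^+ 2 <= s by rewrite -[leRHS]expr1 ler_wiXn2l.
  have h3 := exprn_ge0 3 s0; have h4 := exprn_ge0 2 s0.
  by split; rewrite ?ler_norml; try lra; nra.
- have [-> [-> ->]] := ramp_23 s01; move: s01 => /andP[s0 s1].
  have r0 : 0 <= 1 - s by lra.
  have h1 : (1 - s) ^+ 3 <= 1 by rewrite exprn_ile1//; lra.
  have h2 : (1 - s) ^+ 2 <= 1 by rewrite exprn_ile1//; lra.
  have h3 := exprn_ge0 3 r0; have h4 := exprn_ge0 2 r0.
  by split; rewrite ?ler_norml; lra.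
Qed.

(** The coefficients 1, 3, 3, 1 divided by 6 add up to 4/3, below the constant 2. *)
Lemma ramp_taylor2 : taylor2 ramp ramp1 ramp2 2.
Proof.
split=> [x|x y].
  have [/andP[h0 h1] h2 h3] := ramp_bound x.
  by split; [rewrite ger0_norm//; lra|lra|lra].
have c0 := cub_taylor x y; have c1 := cub_taylor (x - 1) y.
have c2 := cub_taylor (x - 2) y; have c3 := cub_taylor (x - 3) y.
have sh k : x + y - k = x - k + y by ring.
rewrite /ramp /ramp1 /ramp2 !sh.
move: c0 c1 c2 c3; rewrite !ler_norml => /andP[? ?] /andP[? ?] /andP[? ?] /andP[? ?].
have y3 : 0 <= `|y| ^+ 3 by rewrite exprn_ge0.
by apply/andP; split; lra.
Qed.

(** The cubic B-spline with knots 0, ..., 4. In this form its integer translates telescope, which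
    makes them a partition of unity. *)
Definition bump x := ramp x - ramp (x - 1).

Lemma bump_ge0 x : 0 <= bump x.
Proof.
rewrite /bump.
have [x0|x0] := leP x 0; first by rewrite !(ramp_le0 _).1//; lra.
have [x4|x4] := leP 4 x; first by rewrite !(ramp_ge3 _).1//; lra.
have [x1|x1] := leP x 1.
  rewrite (@ramp_01 x _).1; last lra.
  rewrite (@ramp_le0 (x - 1) _).1; last lra.
  by rewrite subr0 divr_ge0// exprn_ge0// ltW.
have [x2|x2] := leP x 2.
  have s01 : 0 <= x - 1 <= 1 by lra.
  rewrite [X in ramp X - _](_ : x = 1 + (x - 1)); last by ring.
  rewrite (ramp_12 s01).1 (ramp_01 s01).1; move: (x - 1) s01 => s /andP[s0 s1].
  have h1 : s ^+ 3 <= s ^+ 2 by rewrite ler_wiXn2l.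
  by have := exprn_ge0 3 s0; have := exprn_ge0 2 s0; lra.
have [x3|x3] := leP x 3.
  have s01 : 0 <= x - 2 <= 1 by lra.
  rewrite [X in ramp X - _](_ : x = 2 + (x - 2)); last by ring.
  rewrite [X in _ - ramp X](_ : x - 1 = 1 + (x - 2)); last by ring.
  rewrite (ramp_23 s01).1 (ramp_12 s01).1; move: (x - 2) s01 => s /andP[s0 s1].
  have h2 : s ^+ 2 <= s by rewrite -[leRHS]expr1 ler_wiXn2l.
  have := exprn_ge0 3 s0; have := exprn_ge0 2 s0.
  rewrite (_ : (1 - s) ^+ 3 = 1 - 3 * s + 3 * s ^+ 2 - s ^+ 3); last by ring.
  by nra.
have s01 : 0 <= x - 3 <= 1 by lra.
rewrite (@ramp_ge3 x _).1; last lra.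
rewrite [X in _ - ramp X](_ : x - 1 = 2 + (x - 3)); last by ring.
rewrite (ramp_23 s01).1; move: (x - 3) s01 => s /andP[s0 s1].
by have : 0 <= (1 - s) ^+ 3; [rewrite exprn_ge0//; lra|lra].
Qed.

Lemma bump_eq0 x : x <= 0 \/ 4 <= x -> bump x = 0.
Proof.
rewrite /bump => -[h|h]; first by rewrite !(ramp_le0 _).1//; lra.
by rewrite !(ramp_ge3 _).1//; lra.
Qed.

Lemma taylor2D u u1 u2 C v v1 v2 C' : taylor2 u u1 u2 C -> taylor2 v v1 v2 C' ->
  taylor2 (fun x => u x + v x) (fun x => u1 x + v1 x) (fun x => u2 x + v2 x) (C + C').
Proof.
move=> [ub ut] [vb vt]; split=> [x|x y].
  have [? ? ?] := ub x; have [? ? ?] := vb x.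
  by split; rewrite (le_trans (ler_normD _ _))// lerD.
rewrite [leRHS]mulrDl; apply: (le_trans _ (lerD (ut x y) (vt x y))).
apply: (le_trans _ (ler_normD _ _)); rewrite le_eqVlt; apply/orP; left; apply/eqP.
by congr (`|_|); ring.
Qed.

Lemma taylor2Z u u1 u2 C a : taylor2 u u1 u2 C ->
  taylor2 (fun x => a * u x) (fun x => a * u1 x) (fun x => a * u2 x) (`|a| * C).
Proof.
move=> [ub ut]; split=> [x|x y].
  by have [? ? ?] := ub x; split; rewrite normrM ler_wpM2l.
rewrite -[leRHS]mulrA; apply: (le_trans _ (ler_wpM2l (normr_ge0 a) (ut x y))).
rewrite -normrM le_eqVlt; apply/orP; left; apply/eqP.
by congr (`|_|); ring.
Qed.

Lemma taylor2_affine u u1 u2 C a b : 1 <= a -> taylor2 u u1 u2 C ->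
  taylor2 (fun x => u (a * x + b)) (fun x => a * u1 (a * x + b))
    (fun x => a ^+ 2 * u2 (a * x + b)) (a ^+ 3 * C).
Proof.
move=> a1 tu; have C0 := taylor2_ge0 tu; have [ub ut] := tu.
have a0 : 0 <= a by exact: le_trans a1.
have h1 : a <= a ^+ 3 by rewrite ler_eXnr.
have h2 : a ^+ 2 <= a ^+ 3 by rewrite ler_weXn2l.
have h3 : 1 <= a ^+ 3 by rewrite exprn_ege1.
split=> [x|x y].
  have [e0 e1 e2] := ub (a * x + b); split.
  - by rewrite (le_trans e0)// ler_peMl.
  - by rewrite normrM (ger0_norm a0) ler_pM.
  - by rewrite normrM (ger0_norm (exprn_ge0 2 a0)) ler_pM ?exprn_ge0.
have := ut (a * x + b) (a * y); rewrite normrM (ger0_norm a0) => hu.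
rewrite [a ^+ 3 * C]mulrC -[leRHS]mulrA -exprMn.
apply: (le_trans _ hu); rewrite le_eqVlt; apply/orP; left; apply/eqP.
rewrite (_ : a * (x + y) + b = a * x + b + a * y); last by ring.
by congr (`|_|); field.
Qed.

Lemma taylor2_sum n (u u1 u2 : nat -> R -> R) (C : nat -> R) :
  (forall k, taylor2 (u k) (u1 k) (u2 k) (C k)) ->
  taylor2 (fun x => \sum_(k < n) u k x) (fun x => \sum_(k < n) u1 k x)
    (fun x => \sum_(k < n) u2 k x) (\sum_(k < n) C k).
Proof.
move=> tu; elim: n => [|n ih].
  rewrite big_ord0; split=> [x|x y]; first by rewrite !big_ord0 normr0.
  by rewrite !big_ord0 !mul0r !subr0 normr0.
have eS (w : nat -> R -> R) : (fun x => \sum_(k < n.+1) w k x) =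
    (fun x => \sum_(k < n) w k x + w n x) by apply/funext => x; rewrite big_ord_recr.
by rewrite !eS big_ord_recr/=; exact: taylor2D.
Qed.

(** [4 / n.+1] is the width of a bump on the mesh [1 / n.+1]. Only [x] is confined to the segment,
    as the nodes near its ends may lie outside. *)
Lemma uniformly_continuous_on_segment (h : R -> R) (K e : R) : continuous h -> 0 < e ->
  exists n : nat, forall x y, - K <= x <= K -> `|y - x| < 4 / n.+1%:R -> `|h y - h x| <= e.
Proof.
move=> ch e0.
have e2 : 0 < e / 2 by rewrite divr_gt0.
have hc (x : R) : exists2 del : R, 0 < del & forall y : R, `|x - y| < del -> `|h x - h y| <= e / 2.
  have /cvgrPdist_le/(_ _ e2)/nbhs_ballP[del /= d0 hd] := ch x.
  by exists del => // y xy; apply: hd; rewrite -ball_normE.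
have tri (a b c : R) : `|a - c| <= `|a - b| + `|b - c| := ler_distD b a c.
have /compact_near_coveringP cov := @segment_compact R (- K) K.
have loc (x : R) : exists2 del : R, 0 < del & exists n0 : nat, forall x' n, `|x - x'| < del ->
    (n0 <= n)%N -> forall y, `|y - x'| < 4 / n.+1%:R -> `|h y - h x'| <= e.
  have [del d0 hd] := hc x; exists (del / 2); first by rewrite divr_gt0.
  have [n0 hn0] := ex_nat_ge (8 / del); exists n0 => x' n xx' nn y yx'.
  have n1 : (4 / n.+1%:R : R) <= del / 2.
    have hn8 : 8 <= n%:R * del by rewrite -ler_pdivrMr//; exact: hn0.
    have np : 0 < n.+1%:R :> R by rewrite ltr0n.
    by rewrite (ler_pdivrMr _ _ np) -natr1; lra.
  have hx' : `|h x - h x'| <= e / 2 by apply: hd; lra.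
  have hy : `|h x - h y| <= e / 2.
    have yx2 := lt_le_trans yx' n1; clear yx' n1; rewrite distrC in yx2.
    apply: hd; rewrite (le_lt_trans (tri x x' y))//.
    by rewrite [del]splitr; exact: ltrD.
  by have := tri (h y) (h x) (h x'); rewrite [`|h y - h x|]distrC; lra.
have /(_ _)[|n _ /(_ n (leqnn n))/= hn] := cov nat \oo
  (fun n x => forall y, `|y - x| < 4 / n.+1%:R -> `|h y - h x| <= e) _.
  move=> x _; have [del d0 [n0 hl]] := loc x.
  exists (ball (x : R) del, [set n | (n0 <= n)%N]); first split => /=.
  - exact: nbhsx_ballx.
  - by exists n0.
  move=> [x' n] /= [hb nn].
  have hx : `|(x : R) - x'| < del by rewrite -ball_normE in hb.
  exact: (hl x' n hx nn).
exists n => x y xK yx.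
by apply: hn => //=; rewrite in_itv.
Qed.

Lemma bump_sum (a x : R) N :
  \sum_(k < N + N) bump (a * x - (k%:R - N%:R)) = ramp (a * x + N%:R) - ramp (a * x - N%:R).
Proof.
pose r (k : nat) := - ramp (a * x - (k%:R - N%:R)).
rewrite -(big_mkord xpredT (fun k => bump (a * x - (k%:R - N%:R)))).
rewrite (eq_bigr (fun k => r k.+1 - r k)) => [|k _].
  rewrite telescope_sumr// /r opprK natrD addrK sub0r opprK.
  by rewrite addrC.
by rewrite /r /bump opprK [RHS]addrC -natr1; congr (_ - ramp _); ring.
Qed.

(** Bumps weighted by node values of [h] have total weight at most 1, which bounds [u] by [M]
    everywhere. Where the weight is 1, [u x] is an average of values of [h] at nodes within [4 / a]
    of [x]. *)
Lemma spline_approximation (h : R -> R) (M K e : R) : continuous h ->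
  (forall x, `|h x| <= M) -> 0 < e -> exists (u u1 u2 : R -> R) (C : R),
  [/\ taylor2 u u1 u2 C, forall x, `|u x| <= M &
      forall x, - K <= x <= K -> `|u x - h x| <= e].
Proof.
move=> ch hM e0; have M0 : 0 <= M := le_trans (normr_ge0 _) (hM 0).
have [n hn] := uniformly_continuous_on_segment K ch e0.
pose a : R := n.+1%:R.
have a1 : 1 <= a by rewrite ler1n.
have a0 : 0 < a by exact: lt_le_trans a1.
(* The nodes range over [- N, ..., N - 1]; for [|x| <= K] this [N] puts the argument of the first
   ramp of [bump_sum] beyond 3 and that of the second below 0. *)
have [N hN] := ex_nat_ge (a * K + 3).
pose z (k : nat) : R := k%:R - N%:R.
pose u0 k x := h (z k / a) * bump (a * x - z k).
have tb : exists (b1 b2 : R -> R) (C : R), taylor2 bump b1 b2 C.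
  have t1 := taylor2_affine (-1) (lexx 1) ramp_taylor2.
  have t2 := taylor2D ramp_taylor2 (taylor2Z (-1) t1).
  eexists; eexists; eexists.
  rewrite (_ : bump = fun x => ramp x + -1 * ramp (1 * x + -1)); first exact: t2.
  by apply/funext => x; rewrite /bump mul1r mulN1r.
have [b1 [b2 [C tbC]]] := tb.
have tu k : taylor2 (u0 k) _ _ _ := taylor2Z (h (z k / a)) (taylor2_affine (- z k) a1 tbC).
have tsum := taylor2_sum (N + N) tu.
eexists; eexists; eexists; eexists; split; first exact: tsum.
  move=> x; apply: (le_trans (ler_norm_sum _ _ _)).
  apply: (@le_trans _ _ (M * \sum_(k < N + N) bump (a * x - z k))).
    rewrite mulr_sumr; apply: ler_sum => k _.
    by rewrite normrM (ger0_norm (bump_ge0 _)) ler_wpM2r ?bump_ge0.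
  rewrite bump_sum; have [/andP[_ r1] _ _] := ramp_bound (a * x + N%:R).
  by have [/andP[r2 _] _ _] := ramp_bound (a * x - N%:R); rewrite ler_piMr//; lra.
move=> x /andP[x1 x2].
have aK : `|a * x| <= a * K by rewrite normrM (gtr0_norm a0) ler_pM2l// ler_norml; lra.
have hNN := hN N (leqnn N).
have sum1 : \sum_(k < N + N) bump (a * x - z k) = 1.
  rewrite bump_sum; move: aK; rewrite ler_norml => /andP[? ?].
  by rewrite (@ramp_ge3 _ _).1 ?(@ramp_le0 _ _).1 ?subr0//; lra.
rewrite -[h x]mul1r -sum1 mulr_suml -sumrB (le_trans (ler_norm_sum _ _ _))//.
rewrite -[e]mulr1 -sum1 mulr_sumr; apply: ler_sum => k _.
rewrite /u0 [bump _ * h x]mulrC -mulrBl normrM (ger0_norm (bump_ge0 _)).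
have [hb|hb] := pselect (a * x - z k <= 0 \/ 4 <= a * x - z k).
  by rewrite (bump_eq0 hb) !mulr0.
rewrite ler_wpM2r ?bump_ge0//; apply: hn; first by rewrite x1 x2.
have [b0 b4] : 0 < a * x - z k /\ a * x - z k < 4.
  by split; rewrite ltNge; apply/negP => ?; apply: hb; [left|right].
rewrite (_ : z k / a - x = - ((a * x - z k) / a)); last by field; rewrite gt_eqF.
by rewrite normrN ger0_norm ?divr_ge0 ?ltW// ltr_pM2r ?invr_gt0.
Qed.

End splines.

Section weak_convergence.
Context {d : measure_display} {T : measurableType d} {R : realType}.
Variable P : probability T R.

(** Stated on any probability space, for use with the sums and with the normal limit; Chebyshev
    takes over outside [[- K, K]]. *)
Lemma mean_approx (d' : measure_display) (T' : measurableType d') (Q : probability T' R)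
    (Z : T' -> R) (h u : R -> R) (M K e V : R) :
  measurable_fun setT (h \o Z) -> measurable_fun setT (u \o Z) ->
  integ Q (fun w => Z w ^+ 2) ->
  (forall x, `|h x| <= M) -> (forall x, `|u x| <= M) -> 0 < K ->
  (forall x, - K <= x <= K -> `|u x - h x| <= e) -> 0 <= e ->
  mean Q (fun w => Z w ^+ 2) <= V ->
  `|mean Q (fun w => h (Z w)) - mean Q (fun w => u (Z w))| <= e + 2 * M / K ^+ 2 * V.
Proof.
move=> mh mu iZ hM uM K0 uh e0 ZV.
have M0 : 0 <= M := le_trans (normr_ge0 _) (hM 0).
have ih : integ Q (fun w => h (Z w)) := integ_bounded Q mh (fun w => hM (Z w)).
have iu : integ Q (fun w => u (Z w)) := integ_bounded Q mu (fun w => uM (Z w)).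
have K2 : 0 < K ^+ 2 by rewrite exprn_gt0.
have c0 : 0 <= 2 * M / K ^+ 2 by apply: divr_ge0; [exact: mulr_ge0|exact: ltW].
rewrite -(meanB ih iu); apply: (le_trans (normr_mean (integB ih iu))).
apply: (@le_trans _ _ (mean Q (fun w => e + 2 * M / K ^+ 2 * Z w ^+ 2))); last first.
  by rewrite (meanD (integ_cst _ _) (integZ _ iZ)) mean_cst (meanZ _ iZ) lerD2l ler_wpM2l.
apply: ler_mean => [||w]; [exact: integ_norm (integB ih iu)|exact: integD (integ_cst _ _) (integZ _ iZ)|].
have [hk|hk] := leP `|Z w| K.
  rewrite distrC (le_trans (uh _ _)) ?lerDl ?(mulr_ge0 c0 (sqr_ge0 _))//.
  by move: hk; rewrite ler_norml.
have hz : 2 * M <= 2 * M / K ^+ 2 * Z w ^+ 2.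
  rewrite mulrAC (ler_pdivlMr _ _ K2); apply: ler_wpM2l; first exact: mulr_ge0.
  rewrite -[Z w ^+ 2]real_normK ?num_real//.
  by apply: lerXn2r; rewrite ?nnegrE ?normr_ge0 ?(ltW K0) ?(ltW hk).
have := ler_normB (h (Z w)) (u (Z w)); have := hM (Z w); have := uM (Z w); lra.
Qed.

(** The common bound [V] on second moments supplies the tightness that lets a spline approximate [h]
    on one segment only. *)
Lemma weak_convergence (Yn : nat -> T -> R) (s V : R) :
  (forall n, discrete_rv (Yn n)) -> (forall n, integ P (fun w => Yn n w ^+ 2)) ->
  (forall n, mean P (fun w => Yn n w ^+ 2) <= V) ->
  integ (gauss 0 s) (fun z => z ^+ 2) -> mean (gauss 0 s) (fun z => z ^+ 2) <= V ->
  (forall u u1 u2 C, taylor2 u u1 u2 C ->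
     mean P (fun w => u (Yn n w)) @[n --> \oo] --> mean (gauss 0 s) u) ->
  forall h, continuous h -> (exists M : R, forall x, `|h x| <= M) ->
  mean P (fun w => h (Yn n w)) @[n --> \oo] --> mean (gauss 0 s) h.
Proof.
move=> dY iY YV iz zV cvgu h ch [M hM].
have M0 : 0 <= M := le_trans (normr_ge0 _) (hM 0).
have V0 : 0 <= V by apply: le_trans (YV 0%N); apply: mean_ge0 => w; exact: sqr_ge0.
have mh : measurable_fun setT h by exact: continuous_measurable_fun.
apply/cvgrPdist_le => e e0.
have e8 : 0 < e / 8 by rewrite divr_gt0.
(* Chosen so that the Chebyshev term [2 * M / K ^+ 2 * V] is at most [e / 8]; adding 1 keeps [K]
   positive. *)
pose K := Num.sqrt (16 * M * V / e) + 1.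
have s0 : 0 <= 16 * M * V / e by rewrite divr_ge0 ?mulr_ge0 ?(ltW e0).
have K0 : 0 < K by rewrite ltr_wpDl ?sqrtr_ge0.
have hK : 2 * M / K ^+ 2 * V <= e / 8.
  have : 16 * M * V / e <= K ^+ 2.
    rewrite -[leLHS](sqr_sqrtr s0) lerXn2r ?nnegrE ?sqrtr_ge0 ?(ltW K0)//.
    by rewrite lerDl.
  rewrite ler_pdivrMr// => hh.
  rewrite mulrAC ler_pdivrMr ?exprn_gt0//; lra.
have [u [u1 [u2 [C [tu uM uh]]]]] := spline_approximation K ch hM e8.
have mu := taylor2_measurable tu.
have dist n : `|mean P (fun w => h (Yn n w)) - mean P (fun w => u (Yn n w))| <= e / 4.
  have mY := discrete_measurable (dY n).
  have := mean_approx (measurableT_comp mh mY) (measurableT_comp mu mY) (iY n) hM uM K0 uh (ltW e8) (YV n).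
  by move=> hd; apply: (le_trans hd); lra.
have distz : `|mean (gauss 0 s) h - mean (gauss 0 s) u| <= e / 4.
  have := @mean_approx _ _ (gauss 0 s) id h u M K (e / 8) V mh mu iz hM uM K0 uh (ltW e8) zV.
  by move=> hd; apply: (le_trans hd); lra.
have e4 : 0 < e / 4 by rewrite divr_gt0.
have /cvgrPdist_le/(_ _ e4) := cvgu _ _ _ _ tu.
apply: filterS => n hn.
move: hn (dist n) distz; rewrite !ler_norml.
move: (mean _ _) (mean _ _) (mean _ _) (mean _ _) => a b c c'.
by move=> /andP[? ?] /andP[? ?] /andP[? ?]; apply/andP; split; lra.
Qed.

End weak_convergence.

(** * Moments of sums under mixing *)

Section mixing_moments.
Context {d : measure_display} {T : measurableType d} {R : realType}.
Variable P : probability T R.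
Context {E : finType}.
Variables (F : nat -> T -> E) (f : E -> R) (B D : R) (r : nat -> R).
Hypothesis dF : forall i, discrete_rv (F i).
Hypothesis B0 : 0 <= B.
Hypothesis fB : forall x, `|f x| <= B.
Hypothesis r0 : forall j, 0 <= r j.
Hypothesis rD : forall n, \sum_(j < n) r j <= D.

Definition word a k w := [seq F i w | i <- iota a k].

(* Decoupling: given the past, [f] of a letter [j] steps ahead has mean of
   order [r j]. *)
Hypothesis mix : forall a k j (z : seq E -> R),
  `|mean P (fun w => z (word a k w) * f (F (a + k + j) w))| <=
  r j * mean P (fun w => `|z (word a k w)|).

Definition word_sum a k w := \sum_(x <- word a k w) f x.

Lemma size_word a k w : size (word a k w) = k.
Proof. by rewrite size_map size_iota. Qed.

Lemma wordD a k l w : word a (k + l) w = word a k w ++ word (a + k) l w.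
Proof. by rewrite /word iotaD map_cat. Qed.

Lemma take_word a k l w : (k <= l)%N -> take k (word a l w) = word a k w.
Proof. by move=> /subnKC <-; rewrite wordD take_cat size_word ltnn subnn take0 cats0. Qed.

Lemma word_sumD a k l w : word_sum a (k + l) w = word_sum a k w + word_sum (a + k) l w.
Proof. by rewrite /word_sum wordD big_cat. Qed.

Lemma word_sum0 a w : word_sum a 0 w = 0.
Proof. by rewrite /word_sum big_nil. Qed.

Lemma word_sum1 a w : word_sum a 1 w = f (F a w).
Proof. by rewrite /word_sum big_seq1. Qed.

Lemma word_sumS a k w : word_sum a k.+1 w = word_sum a k w + f (F (a + k) w).
Proof. by rewrite -addn1 word_sumD word_sum1. Qed.

Lemma word_sum_bigE a k w : word_sum a k w = \sum_(j < k) f (F (a + j) w).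
Proof.
elim: k => [|k ih]; first by rewrite word_sum0 big_ord0.
by rewrite word_sumS ih big_ord_recr.
Qed.

Lemma discrete_word a k : discrete_rv (word a k).
Proof.
rewrite (_ : word a k = fun w => mkseq (fun i => F (a + i) w) k); last first.
  by apply/funext => w; rewrite /word /mkseq -[a in iota a]addn0 iotaDl -map_comp.
by apply: (discrete_mkseq (U := fun i => F (a + i))) => i; exact: dF.
Qed.

Lemma bounded_word a k (z : seq E -> R) : bounded_rv (fun w => z (word a k w)).
Proof.
apply: (@bounded_discrete _ _ _ _ (\sum_(t : k.-tuple E) `|z t|)).
  exact: discrete_comp (discrete_word a k).
move=> w; have sw : size (word a k w) == k by rewrite size_word.
by rewrite (bigD1 (Tuple sw))//= lerDl sumr_ge0.
Qed.

Lemma bounded_word_sum a k : bounded_rv (word_sum a k).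
Proof. exact: (bounded_word a k (fun v => \sum_(x <- v) f x)). Qed.

Lemma bounded_letter i : bounded_rv (fun w => f (F i w)).
Proof.
by apply: (@bounded_discrete _ _ _ _ B) => [|w]; [exact: discrete_comp (dF i)|exact: fB].
Qed.

Let D0 : 0 <= D. Proof. by have := rD 0; rewrite big_ord0. Qed.

Lemma mean_drift a k l (z : seq E -> R) :
  `|mean P (fun w => z (word a k w) * word_sum (a + k) l w)| <=
  D * mean P (fun w => `|z (word a k w)|).
Proof.
have -> : mean P (fun w => z (word a k w) * word_sum (a + k) l w) =
    \sum_(j < l) mean P (fun w => z (word a k w) * f (F (a + k + j) w)).
  rewrite -mean_sum => [|j _].
    by apply: eq_mean => w; rewrite word_sum_bigE mulr_sumr.
  by apply: bounded_integ; apply: boundedM; [exact: bounded_word|exact: bounded_letter].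
apply: (le_trans (ler_norm_sum _ _ _)).
apply: (@le_trans _ _ (\sum_(j < l) r j * mean P (fun w => `|z (word a k w)|))).
  by apply: ler_sum => j _; exact: mix.
by rewrite -mulr_suml; apply: ler_wpM2r => //; apply: mean_ge0.
Qed.

Definition sqr_const := 2 * (B * D) + B ^+ 2.

(** Abel summation along prefixes: the increment of [z] at letter [j] is decoupled from letter [k]
    over the gap [k - j - 1], and [r] summed over the gaps is at most [D]. Only the increments of
    [z] enter, not its size. *)
Lemma mean_letter_drift a k (z : seq E -> R) (c : R) : 0 <= c ->
  (forall j, (j < k)%N ->
     mean P (fun w => `|z (word a j.+1 w) - z (word a j w)|) <= c) ->
  z [::] = 0 ->
  `|mean P (fun w => z (word a k w) * f (F (a + k) w))| <= c * D.
Proof.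
move=> c0 zc z0.
pose dz (j : nat) (v : seq E) := z (take j.+1 v) - z (take j v).
have e j w : (j < k)%N -> z (word a j.+1 w) - z (word a j w) = dz j (word a j.+1 w).
  by move=> jk; rewrite /dz !take_word.
have -> : mean P (fun w => z (word a k w) * f (F (a + k) w)) =
    \sum_(j < k) mean P (fun w => dz j (word a j.+1 w) * f (F (a + j.+1 + (k - j.+1)) w)).
  rewrite -mean_sum => [|j _].
    apply: eq_mean => w; rewrite -[LHS](_ : \sum_(j < k) (z (word a j.+1 w) - z (word a j w)) * f (F (a + k) w) = _).
      by apply: eq_bigr => j _; rewrite e// -addnA subnKC.
    rewrite -mulr_suml; congr (_ * _).
    rewrite -(big_mkord xpredT (fun j => z (word a j.+1 w) - z (word a j w))).
    by rewrite telescope_sumr// z0 subr0.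
  by apply: bounded_integ; apply: boundedM; [exact: bounded_word|exact: bounded_letter].
apply: (le_trans (ler_norm_sum _ _ _)).
apply: (@le_trans _ _ (\sum_(j < k) r (k - j.+1) * c)).
  apply: ler_sum => j _; apply: (le_trans (mix _ _ _ _)); apply: ler_wpM2l => //.
  by under eq_mean do rewrite -e//; exact: zc.
have -> : \sum_(j < k) r (k - j.+1) * c = c * \sum_(j < k) r j.
  rewrite -mulr_suml mulrC; congr (_ * _).
  rewrite [RHS](reindex_inj rev_ord_inj)/=.
  by apply: eq_bigr => j _.
by apply: ler_wpM2l.
Qed.

Let bS := bounded_word_sum.
Let bF := bounded_letter.

(** The prefix sums have increments at most [B], so the cross term with a new letter costs a
    constant. *)
Lemma mean_sqr_word_sum a k : mean P (fun w => word_sum a k w ^+ 2) <= k%:R * sqr_const.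
Proof.
elim: k => [|k ih].
  under eq_mean do rewrite word_sum0 expr0n/=.
  by rewrite mean_cst mul0r.
have i1 := bounded_integ P (boundedX 2 (bS a k)).
have i2 := bounded_integ P (boundedM (bS a k) (bF (a + k))).
have i3 := bounded_integ P (boundedX 2 (bF (a + k))).
have -> : mean P (fun w => word_sum a k.+1 w ^+ 2) = mean P (fun w => word_sum a k w ^+ 2) +
    2 * mean P (fun w => word_sum a k w * f (F (a + k) w)) +
    mean P (fun w => f (F (a + k) w) ^+ 2).
  rewrite -(meanZ _ i2) -(meanD i1 (integZ 2 i2)) -(meanD (integD i1 (integZ 2 i2)) i3).
  by apply: eq_mean => w; rewrite word_sumS; ring.
have -> : k.+1%:R * sqr_const = k%:R * sqr_const + 2 * (B * D) + B ^+ 2.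
  by rewrite -natr1 /sqr_const; ring.
apply: lerD.
  apply: lerD; first exact: ih.
  apply: ler_wpM2l => //; apply: (le_trans (ler_norm _)).
  apply: (@mean_letter_drift a k (fun v => \sum_(x <- v) f x)) => [//|j jk|]; last by rewrite big_nil.
  apply: mean_le_cst => [|w].
    by apply/bounded_integ/bounded_norm/boundedB; exact: bS.
  by rewrite -!/(word_sum _ _ _) word_sumS addrC addKr fB.
apply: mean_le_cst => // w.
by rewrite -real_normK ?num_real// lerXn2r ?nnegrE ?normr_ge0.
Qed.

Let sqr_const0 : 0 <= sqr_const.
Proof. by rewrite /sqr_const addr_ge0 ?sqr_ge0// !mulr_ge0. Qed.

Let mean_abs_word_sum a k : mean P (fun w => `|word_sum a k w|) <= 1 + k%:R * sqr_const.
Proof.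
have i1 := bounded_integ P (boundedX 2 (bS a k)).
apply: (@le_trans _ _ (mean P (fun w => 1 + word_sum a k w ^+ 2))).
  apply: ler_mean => [||w].
  - exact/bounded_integ/bounded_norm/bS.
  - exact: integD (integ_cst _ _) i1.
  rewrite -[word_sum a k w ^+ 2]real_normK ?num_real//.
  by have := sqr_ge0 (`|word_sum a k w| - 1); have := normr_ge0 (word_sum a k w); nra.
by rewrite (meanD (integ_cst _ _) i1) mean_cst lerD2l mean_sqr_word_sum.
Qed.

Let cube_const := (3 * B + 3 * B ^+ 2) * sqr_const + 3 * B ^+ 2 + B ^+ 3.

Let cube_const0 : 0 <= cube_const.
Proof.
have h1 : 0 <= 3 * B + 3 * B ^+ 2 by rewrite addr_ge0 ?mulr_ge0 ?exprn_ge0.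
have h2 : 0 <= 3 * B ^+ 2 by rewrite mulr_ge0 ?exprn_ge0.
by rewrite /cube_const; apply: addr_ge0; [apply: addr_ge0 => //; exact: mulr_ge0|exact: exprn_ge0].
Qed.

Let mean_cube_increment a j : mean P (fun w => `|word_sum a j.+1 w ^+ 3 - word_sum a j w ^+ 3|)
  <= cube_const * (j%:R + 1).
Proof.
have i1 := bounded_integ P (boundedX 2 (bS a j)).
have i2 := bounded_integ P (bounded_norm (bS a j)).
pose c2 := 3 * B; pose c1 := 3 * B ^+ 2.
have p1 : 0 <= c1 by rewrite mulr_ge0 ?exprn_ge0.
have p2 : 0 <= c2 by rewrite mulr_ge0.
apply: (@le_trans _ _ (mean P (fun w => c2 * word_sum a j w ^+ 2 + c1 * `|word_sum a j w| + B ^+ 3))).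
  apply: ler_mean => [||w].
  - by apply/bounded_integ/bounded_norm/boundedB; apply: boundedX; exact: bS.
  - exact: integD (integD (integZ _ i1) (integZ _ i2)) (integ_cst _ _).
  rewrite word_sumS; have := fB (F (a + j) w).
  move: (word_sum a j w) (f _) => x y yB.
  rewrite (_ : (x + y) ^+ 3 - x ^+ 3 = 3 * y * x ^+ 2 + 3 * y ^+ 2 * x + y ^+ 3); last by ring.
  rewrite (le_trans (ler_normD _ _))// lerD//.
    rewrite (le_trans (ler_normD _ _))// lerD//.
      by rewrite normrM (ger0_norm (sqr_ge0 x)) ler_wpM2r ?sqr_ge0// normrM ger0_norm// ler_wpM2l.
    rewrite normrM ler_wpM2r// normrM ger0_norm// ler_wpM2l// ger0_norm ?sqr_ge0//.
    by rewrite -real_normK ?num_real// lerXn2r ?nnegrE ?normr_ge0.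
  by rewrite normrX lerXn2r ?nnegrE ?normr_ge0.
rewrite (meanD (integD (integZ _ i1) (integZ _ i2)) (integ_cst _ _)) (meanD (integZ _ i1) (integZ _ i2)).
rewrite (meanZ _ i1) (meanZ _ i2) mean_cst.
have h1 := ler_wpM2l p2 (mean_sqr_word_sum a j).
have h2 := ler_wpM2l p1 (mean_abs_word_sum a j).
have h3 : 0 <= B ^+ 3 by rewrite exprn_ge0.
apply: (le_trans (lerD (lerD h1 h2) (lexx _))); rewrite /cube_const -/c1 -/c2.
have j0 : 0 <= j%:R :> R by [].
have := mulr_ge0 (addr_ge0 p1 h3) j0; have := mulr_ge0 (addr_ge0 p1 p2) sqr_const0.
by move: (j%:R) sqr_const j0 => J Q J0; rewrite !mulrDl !mulrDr; lra.
Qed.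

Definition quart_const := 4 * (cube_const * D) + 6 * B ^+ 2 * sqr_const
  + 4 * B ^+ 3 * (1 + sqr_const) + B ^+ 4.

Lemma quart_const0 : 0 <= quart_const.
Proof.
rewrite /quart_const; apply: addr_ge0; last exact: exprn_ge0.
apply: addr_ge0; last by apply: mulr_ge0; [rewrite mulr_ge0 ?exprn_ge0|exact: addr_ge0].
apply: addr_ge0; first by rewrite mulr_ge0// mulr_ge0.
by apply: mulr_ge0 => //; rewrite mulr_ge0 ?exprn_ge0.
Qed.

(** Only the term [s ^+ 3 * y] of the expansion needs decoupling. The cube has increments of mean
    linear in the length, so each letter costs a multiple of [k + 1] and the total is quadratic. *)
Lemma mean_quart_word_sum a k :
  mean P (fun w => word_sum a k w ^+ 4) <= quart_const * k%:R ^+ 2.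
Proof.
elim: k => [|k ih].
  under eq_mean do rewrite word_sum0 expr0n/=.
  by rewrite mean_cst expr0n/= mulr0.
pose s w := word_sum a k w; pose y w := f (F (a + k) w).
have bs : bounded_rv s := bS a k; have by' : bounded_rv y := bF (a + k).
have i0 := bounded_integ P (boundedX 4 bs).
have i1 := bounded_integ P (boundedM (boundedX 3 bs) by').
have i2 := bounded_integ P (boundedX 2 bs).
have i3 := bounded_integ P (bounded_norm bs).
have yB w : `|y w| <= B := fB _.
apply: (@le_trans _ _ (mean P (fun w => s w ^+ 4 + 4 * (s w ^+ 3 * y w) +
   6 * B ^+ 2 * s w ^+ 2 + 4 * B ^+ 3 * `|s w| + B ^+ 4))).
  apply: ler_mean => [||w].
  - by apply/bounded_integ/boundedX; exact: bS.
  - exact: integD (integD (integD (integD i0 (integZ _ i1)) (integZ _ i2)) (integZ _ i3)) (integ_cst _ _).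
  rewrite word_sumS -/(s w) -/(y w); have := yB w; move: (s w) (y w) => x z zB.
  rewrite (_ : (x + z) ^+ 4 = x ^+ 4 + 4 * (x ^+ 3 * z) + 6 * z ^+ 2 * x ^+ 2 + 4 * (z ^+ 3 * x) + z ^+ 4); last by ring.
  have z2 : z ^+ 2 <= B ^+ 2 by rewrite -real_normK ?num_real// lerXn2r ?nnegrE ?normr_ge0.
  have z4 : z ^+ 4 <= B ^+ 4.
    rewrite -[z ^+ 4]/(z ^+ (2 * 2)) -[B ^+ 4]/(B ^+ (2 * 2)) !exprM.
    by rewrite lerXn2r ?nnegrE ?sqr_ge0.
  apply: lerD => //; apply: lerD.
    rewrite lerD2l; apply: ler_wpM2r; first exact: sqr_ge0.
    exact: ler_wpM2l.
  rewrite -[leRHS]mulrA; apply: ler_wpM2l => //.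
  rewrite (le_trans (ler_norm _))// normrM; apply: ler_wpM2r => //.
  by rewrite normrX lerXn2r ?nnegrE ?normr_ge0.
rewrite (meanD (integD (integD (integD i0 (integZ _ i1)) (integZ _ i2)) (integZ _ i3)) (integ_cst _ _)).
rewrite (meanD (integD (integD i0 (integZ _ i1)) (integZ _ i2)) (integZ _ i3)).
rewrite (meanD (integD i0 (integZ _ i1)) (integZ _ i2)) (meanD i0 (integZ _ i1)).
rewrite (meanZ _ i1) (meanZ _ i2) (meanZ _ i3) mean_cst.
have k0 : 0 <= k%:R :> R by [].
have h1 : mean P (fun w => s w ^+ 3 * y w) <= cube_const * (k%:R + 1) * D.
  apply: (le_trans (ler_norm _)).
  apply: (@mean_letter_drift a k (fun v => (\sum_(x <- v) f x) ^+ 3)) => [|j jk|]; last by rewrite big_nil expr0n.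
    by rewrite mulr_ge0// addr_ge0.
  apply: (le_trans (mean_cube_increment a j)); rewrite ler_wpM2l// lerD2r ler_nat ltnW//.
have h2 := mean_sqr_word_sum a k; have h3 := mean_abs_word_sum a k.
have p2 : 0 <= 6 * B ^+ 2 by rewrite mulr_ge0 ?exprn_ge0.
have p3 : 0 <= 4 * B ^+ 3 by rewrite mulr_ge0 ?exprn_ge0.
have p4 : 0 <= B ^+ 4 by rewrite exprn_ge0.
have q2 := ler_wpM2l p2 h2; have q3 := ler_wpM2l p3 h3.
apply: (@le_trans _ _ (quart_const * k%:R ^+ 2 + quart_const * (k%:R + 1))); last first.
  rewrite -natr1 -mulrDr ler_wpM2l ?quart_const0//; nra.
rewrite -!addrA; apply: lerD; first exact: ih.
apply: (@le_trans _ _ (4 * (cube_const * (k%:R + 1) * D) + (6 * B ^+ 2 * (k%:R * sqr_const) +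
   (4 * B ^+ 3 * (1 + k%:R * sqr_const) + B ^+ 4)))).
  by apply: lerD; [rewrite ler_wpM2l|apply: lerD => //; apply: lerD].
rewrite /quart_const.
have m2 := mulr_ge0 p2 sqr_const0; have m3 := mulr_ge0 p3 k0.
have m3' := mulr_ge0 p3 sqr_const0; have m4 := mulr_ge0 p4 k0.
move: (k%:R) k0 m3 m4 => K K0 m3 m4.
rewrite -subr_ge0 (_ : _ - _ = 6 * B ^+ 2 * sqr_const + 4 * B ^+ 3 * K + 4 * B ^+ 3 * sqr_const + B ^+ 4 * K); last by ring.
lra.
Qed.

(** Kolmogorov's inequality, with [mean_drift] in place of the martingale property. After a first
    exit at modulus [x >= lam] the cross term costs at most [2 D x], and [x^2 - 2 D x >= x^2 / 2]
    because [lam >= 4 D]. *)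
Lemma word_sum_maximal a n (lam : R) : 4 * D <= lam -> 0 < lam ->
  pr P (fun w => has (fun j => lam <= `|word_sum a j w|) (iota 0 n.+1)) <=
  2 * (n%:R * sqr_const) / lam ^+ 2.
Proof.
move=> Dlam lam0.
pose ss (v : seq E) := \sum_(x <- v) f x.
pose hit k (v : seq E) := has (fun j => lam <= `|ss (take j v)|) (iota 0 k.+1).
have hitE k l w : (k <= l)%N -> hit k (word a l w) = has (fun j => lam <= `|word_sum a j w|) (iota 0 k.+1).
  move=> kl; apply: eq_in_has => j; rewrite mem_iota add0n ltnS => /andP[_ jk].
  by rewrite take_word// (leq_trans jk).
pose m k w := has (fun j => lam <= `|word_sum a j w|) (iota 0 k.+1).
have mS k w : m k.+1 w = m k w || (lam <= `|word_sum a k.+1 w|).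
  by rewrite /m -[in iota 0 k.+2]addn1 iotaD has_cat/= orbF add0n.
have m0 w : m 0 w = false.
  by rewrite /m/= word_sum0 normr0 leNgt lam0.
(* Indicator of a first exit at step [k.+1], written as a function of the word so that the
   decoupling applies to it. *)
pose zeta k (v : seq E) : R := (hit k.+1 v && ~~ hit k v)%:R.
have zetaE k w : zeta k (word a k.+1 w) = (m k.+1 w)%:R - (m k w)%:R.
  rewrite /zeta !hitE// -/(m k.+1 w) -/(m k w) mS.
  by case: (m k w); case: (_ <= _); rewrite /= ?subrr ?subr0.
have bm k : bounded_rv (fun w => (m k w)%:R : R).
  rewrite (_ : (fun w => _) = fun w => (hit k (word a k w))%:R); last first.
    by apply/funext => w; rewrite hitE.
  exact: (bounded_word a k (fun v => (hit k v)%:R)).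
have step k : (k < n)%N -> lam ^+ 2 / 2 * (mean P (fun w => (m k.+1 w)%:R) - mean P (fun w => (m k w)%:R)) <=
  mean P (fun w => word_sum a n w ^+ 2 * (m k.+1 w)%:R) -
  mean P (fun w => word_sum a n w ^+ 2 * (m k w)%:R).
  move=> kn.
  have bz : bounded_rv (fun w => zeta k (word a k.+1 w)) := bounded_word a k.+1 (zeta k).
  have b2m j : bounded_rv (fun w => word_sum a n w ^+ 2 * (m j w)%:R).
    by apply: boundedM; [apply: boundedX; exact: bS|exact: bm].
  have i1 := bounded_integ P (bm k.+1); have i2 := bounded_integ P (bm k).
  rewrite -(meanB i1 i2) -(meanB (bounded_integ P (b2m k.+1)) (bounded_integ P (b2m k))).
  have -> : mean P (fun w => (m k.+1 w)%:R - (m k w)%:R) = mean P (fun w => zeta k (word a k.+1 w)).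
    by apply: eq_mean => w; rewrite zetaE.
  have -> : mean P (fun w => word_sum a n w ^+ 2 * (m k.+1 w)%:R - word_sum a n w ^+ 2 * (m k w)%:R) =
     mean P (fun w => word_sum a n w ^+ 2 * zeta k (word a k.+1 w)).
    by apply: eq_mean => w; rewrite zetaE; ring.
  pose z1 v := ss v * zeta k v.
  pose S' w := word_sum (a + k.+1) (n - k.+1) w.
  have bz1 : bounded_rv (fun w => z1 (word a k.+1 w)) := bounded_word a k.+1 z1.
  have drift := mean_drift a k.+1 (n - k.+1) z1.
  have j1 := bounded_integ P (boundedM (boundedX 2 (bS a k.+1)) bz).
  have j2 := bounded_integ P (boundedM bz1 (bS (a + k.+1) (n - k.+1))).
  have j3 := bounded_integ P (bounded_norm bz1).
  (* Expands the square at the exit time and drops the square of the later increment. *)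
  apply: (@le_trans _ _ (mean P (fun w => word_sum a k.+1 w ^+ 2 * zeta k (word a k.+1 w)) +
     2 * mean P (fun w => z1 (word a k.+1 w) * S' w))); last first.
    rewrite -(meanZ _ j2) -(meanD j1 (integZ 2 j2)); apply: ler_mean => [||w].
    - exact: integD j1 (integZ 2 j2).
    - by apply: bounded_integ; apply: boundedM => //; apply: boundedX; exact: bS.
    have zz : 0 <= zeta k (word a k.+1 w) by exact: ler0n.
    have -> : word_sum a n w = word_sum a k.+1 w + S' w by rewrite -word_sumD subnKC.
    rewrite /z1 /ss -/(word_sum a k.+1 w) -subr_ge0.
    rewrite [leRHS](_ : _ = S' w ^+ 2 * zeta k (word a k.+1 w)); last first.
      by rewrite -/(S' w); move: (word_sum _ _ _) (S' w) (zeta _ _) => x y z; ring.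
    by rewrite mulr_ge0 ?sqr_ge0.
  apply: (@le_trans _ _ (mean P (fun w => word_sum a k.+1 w ^+ 2 * zeta k (word a k.+1 w)) -
     2 * (D * mean P (fun w => `|z1 (word a k.+1 w)|)))); last first.
    rewrite lerD2l -mulrN ler_wpM2l// lerNl.
    by apply: le_trans drift; rewrite -normrN ler_norm.
  rewrite -(meanZ _ j3) -(meanZ _ (integZ D j3)) -(meanB j1 (integZ 2 (integZ D j3))).
  rewrite -(meanZ _ (bounded_integ P bz)); apply: ler_mean => [||w].
  - exact: integZ (bounded_integ P bz).
  - exact: integB j1 (integZ 2 (integZ D j3)).
  rewrite /z1 /ss -/(word_sum a k.+1 w) zetaE mS.
  case: (m k w) => /=; first by rewrite subrr !mulr0 normr0 !mulr0 subrr.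
  case: (leP lam _) => h; last by rewrite subrr !mulr0 normr0 !mulr0 subrr.
  rewrite subr0 !mulr1 -[word_sum a k.+1 w ^+ 2]real_normK ?num_real//.
  move: `|word_sum a k.+1 w| h => x lx; nra.
have sum_step : lam ^+ 2 / 2 * mean P (fun w => (m n w)%:R) <=
    mean P (fun w => word_sum a n w ^+ 2 * (m n w)%:R).
  suff : forall k, (k <= n)%N -> lam ^+ 2 / 2 * mean P (fun w => (m k w)%:R) <=
    mean P (fun w => word_sum a n w ^+ 2 * (m k w)%:R) by apply.
  elim=> [_|k ih kn].
    under eq_mean do rewrite m0; under [X in _ <= X]eq_mean do rewrite m0 mulr0.
    by rewrite mean_cst mulr0.
  by have := step k kn; have := ih (ltnW kn); rewrite mulrBr; lra.
rewrite -/(m n) /pr ler_pdivlMr ?exprn_gt0//.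
have : mean P (fun w => word_sum a n w ^+ 2 * (m n w)%:R) <= n%:R * sqr_const.
  apply: le_trans (mean_sqr_word_sum a n); apply: ler_mean => [||w].
  - by apply: bounded_integ; apply: boundedM => //; apply: boundedX; exact: bS.
  - by apply: bounded_integ; apply: boundedX; exact: bS.
  by rewrite ler_piMr ?sqr_ge0// lern1 leq_b1.
by move: sum_step; move: (mean P _) (mean P _) => u v; lra.
Qed.

End mixing_moments.

(** * Mixing of g-chains *)

Section house_of_cards_chain.
Context {R : realType}.
Variable a : nat -> R.
Hypothesis a01 : forall k, 0 <= a k <= 1.
Local Notation law := (chain_law (house_of_cards a)).

Lemma chain_law_ge0 M k : 0 <= law M k.
Proof.
elim: M k => [|M ih] k /=; first by rewrite ler0n.
apply: sumr_ge0 => j _; rewrite mulr_ge0 ?ih// /house_of_cards.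
by have /andP[a0 a1] := a01 j; case: ifP => // _; case: ifP => // _; rewrite subr_ge0.
Qed.

(* Values at the starting point [k] of the first [n] iterates of the transition
   operator applied to [C * 1_{0}]. *)
Fixpoint backward (C : R) n k : R :=
  if n is n'.+1 then a k * backward C n' k.+1 + (1 - a k) * backward C n' 0%N
  else C * (k == 0%N)%:R.

Lemma house_of_cards_sum (h : nat -> R) m j : (j < m)%N ->
  \sum_(k < m.+1) house_of_cards a j k * h k = a j * h j.+1 + (1 - a j) * h 0%N.
Proof.
move=> jm; rewrite big_ord_recl addrC; congr (_ + _).
rewrite (bigD1 (Ordinal jm))//= big1 => [|i ij].
  by rewrite /house_of_cards /bump/= eqxx addr0.
rewrite /house_of_cards /bump/= eqSS.
case: eqP => [e|_]; last by rewrite mul0r.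
by move/eqP: ij; case; apply/val_inj.
Qed.

(** Splits [m + n] steps at time [m], by which the chain cannot exceed [m]. *)
Lemma backward_forward C m n :
  backward C (m + n) 0 = \sum_(j < m.+1) law m j * backward C n j.
Proof.
elim: m n => [|m ih] n; first by rewrite add0n big_ord1/= mul1r.
rewrite addSnnS ih /=.
under eq_bigr => j _ do rewrite -(house_of_cards_sum (backward C n) (ltn_ord j)) mulr_sumr.
rewrite exchange_big/=; apply: eq_bigr => k _.
by rewrite mulr_suml; apply: eq_bigr => j _; rewrite mulrA.
Qed.

Lemma backward_return C n : backward C n 0 = C * law n 0.
Proof.
rewrite -[in LHS](addn0 n) backward_forward big_ord_recl big1 ?addr0/= => [|i _].
  by rewrite mulr1 mulrC.
by rewrite !mulr0.
Qed.

Lemma chain_law_total M : \sum_(k < M.+1) law M k = 1.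
Proof.
elim: M => [|M ih]; first by rewrite big_ord1.
rewrite /= exchange_big/= -[RHS]ih; apply: eq_bigr => j _.
rewrite -mulr_sumr -[RHS]mulr1; congr (_ * _).
have := house_of_cards_sum (fun=> 1) (ltn_ord j).
under eq_bigr do rewrite mulr1; move=> ->.
by ring.
Qed.

(** The state counts the steps since the last visit to 0, so [k] is reached only by [k] successive
    climbs. *)
Lemma chain_law_run M k : (k <= M)%N -> law M k = law (M - k) 0 * \prod_(j < k) a j.
Proof.
elim: k M => [|k ih] M; first by rewrite subn0 big_ord0 mulr1.
case: M => // M; rewrite ltnS => kM.
rewrite subSS big_ord_recr/= mulrA -ih//.
have kM' : (k < M.+1)%N by [].
rewrite (bigD1 (Ordinal kM'))//= big1 => [|i ij].
  by rewrite /house_of_cards eqxx addr0.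
rewrite /house_of_cards eqSS; case: eqP => [e|_]; last by rewrite mulr0.
by move/eqP: ij; case; apply/val_inj; rewrite /= e.
Qed.

(** The unit mass at one time is decomposed by the last visit to 0; a visit is followed by an
    uninterrupted climb with probability at least [p]. *)
Lemma sum_return_le (p : R) n : 0 < p -> (forall k, p <= \prod_(j < k) a j) ->
  \sum_(j < n) law j 0 <= p^-1.
Proof.
move=> p0 hp; case: n => [|n].
  by rewrite big_ord0 invr_ge0 ltW.
rewrite -[leRHS]mul1r ler_pdivlMr// -(chain_law_total n) mulr_suml.
rewrite [leRHS](reindex_inj rev_ord_inj)/=; apply: ler_sum => j _.
have jn : (j <= n)%N by rewrite -ltnS.
rewrite subSS (chain_law_run (leq_subr j n)) subKn//.
by rewrite ler_wpM2l// chain_law_ge0.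
Qed.

End house_of_cards_chain.

(** * Transfer operator of a g-function and coupling of pasts *)

Section transfer_operator.
Context {R : realType} {E : pointedFinType}.
Variable g : E -> Past E -> R.
Hypothesis gg : g_function g.
Local Notation a := (g_coef g).

Let g0 x u : 0 <= g x u. Proof. by have [_ /(_ x u)/andP[]] := gg. Qed.
Let g1 u : \sum_(x : E) g x u = 1. Proof. by have [_ _ /(_ u)] := gg. Qed.

Definition cons_past (x : E) (u : Past E) : Past E := fun n => if n is n'.+1 then u n' else x.

Definition transfer (h : Past E -> R) (u : Past E) : R :=
  \sum_(x : E) g x u * h (cons_past x u).

Let inf_has_lbound k (sigma : 'I_k -> E) x :
  has_lbound (range (fun w : Past E => g x (juxtapose sigma w))).
Proof. by exists 0 => _ [w _ <-]. Qed.

Let inf_ge0 k (sigma : 'I_k -> E) x : 0 <= inf (range (fun w : Past E => g x (juxtapose sigma w))).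
Proof.
apply: lb_le_inf; first by exists (g x (juxtapose sigma (fun=> point))), (fun=> point).
by move=> _ [w _ <-].
Qed.

Let juxtapose_id (u : Past E) k :
  juxtapose (fun j : 'I_k => u j) (fun n => u (n + k)%N) = u.
Proof.
apply/funext => n; rewrite /juxtapose; case: insubP => [j _ <-//|].
by rewrite -leqNgt => kn; rewrite subnK.
Qed.

Let juxtapose_agree (u v : Past E) k : (forall i, (i < k)%N -> u i = v i) ->
  juxtapose (fun j : 'I_k => u j) (fun n => v (n + k)%N) = v.
Proof.
move=> uv; rewrite -[RHS](juxtapose_id v k); congr juxtapose.
by apply/funext => j; rewrite uv.
Qed.

Let coef_le_inf k (sigma : 'I_k -> E) :
  a k <= \sum_(x : E) inf (range (fun w : Past E => g x (juxtapose sigma w))).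
Proof.
apply: ge_inf; last by exists sigma.
by exists 0 => _ [s _ <-]; apply: sumr_ge0 => x _; exact: inf_ge0.
Qed.

(** Pasts with the same last [k] letters extend one [sigma], so each infimum in [g_coef] lies below
    both values of [g]. *)
Lemma g_coef_overlap k (u v : Past E) : (forall i, (i < k)%N -> u i = v i) ->
  a k <= \sum_(x : E) Num.min (g x u) (g x v).
Proof.
move=> uv; apply: (le_trans (coef_le_inf (fun j => u j))); apply: ler_sum => x _.
rewrite le_min; apply/andP; split.
  by apply: ge_inf => //; exists (fun n => u (n + k)%N) => //; rewrite juxtapose_id.
by apply: ge_inf => //; exists (fun n => v (n + k)%N) => //; rewrite juxtapose_agree.
Qed.

Lemma g_coef_01 k : 0 <= a k <= 1.
Proof.
apply/andP; split.
  apply: lb_le_inf; first by eexists; exists (fun=> point).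
  by move=> _ [s _ <-]; apply: sumr_ge0 => x _; exact: inf_ge0.
apply: (le_trans (@g_coef_overlap k (fun=> point) (fun=> point) _)) => //.
by under eq_bigr do rewrite minxx; rewrite g1.
Qed.

(** Product coupling of two measures of equal mass, with the difference multiplied by [m] to avoid
    normalizing. *)
Lemma coupled_average_le (p q A A' : E -> R) (m beta : R) : 
  (forall x, 0 <= p x) -> (forall x, 0 <= q x) ->
  \sum_x p x = m -> \sum_x q x = m -> (forall x y, `|A x - A' y| <= beta) ->
  `|\sum_x p x * A x - \sum_x q x * A' x| <= m * beta.
Proof.
move=> p0 q0 pm qm Ab.
have m0 : 0 <= m by rewrite -pm; exact: sumr_ge0.
have [mz|mn] := eqVneq m 0.
  have pz x : p x = 0.
    by apply/le_anti; rewrite p0 -mz -pm (bigD1 x)//= lerDl sumr_ge0.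
  have qz x : q x = 0.
    by apply/le_anti; rewrite q0 -mz -qm (bigD1 x)//= lerDl sumr_ge0.
  rewrite mz mul0r !big1 ?subrr ?normr0// => x _; first by rewrite qz mul0r.
  by rewrite pz mul0r.
have mp : 0 < m by rewrite lt_neqAle eq_sym mn.
rewrite -(ler_pM2l mp) -[X in X * `|_|](gtr0_norm mp) -normrM.
have -> : m * (\sum_x p x * A x - \sum_x q x * A' x) =
    \sum_x \sum_y p x * q y * (A x - A' y).
  have e1 : \sum_x \sum_y p x * A x * q y = (\sum_x p x * A x) * m.
    by rewrite mulr_suml; apply: eq_bigr => x _; rewrite -mulr_sumr qm.
  have e2 : \sum_x \sum_y p x * (q y * A' y) = m * (\sum_x q x * A' x).
    by rewrite -[X in _ = X * _]pm mulr_suml; apply: eq_bigr => x _; rewrite -mulr_sumr.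
  rewrite mulrBr mulrC -e1 -e2 -sumrB; apply: eq_bigr => x _.
  by rewrite -sumrB; apply: eq_bigr => y _; ring.
apply: (le_trans (ler_norm_sum _ _ _)).
apply: (@le_trans _ _ (\sum_x \sum_y p x * q y * beta)).
  apply: ler_sum => x _; apply: (le_trans (ler_norm_sum _ _ _)).
  apply: ler_sum => y _; rewrite normrM (ger0_norm (mulr_ge0 (p0 x) (q0 y))).
  by rewrite ler_wpM2l// mulr_ge0.
rewrite le_eqVlt; apply/orP; left; apply/eqP.
rewrite mulrA -[X in _ = X * m * _]pm !mulr_suml; apply: eq_bigr => x _.
by rewrite -mulr_suml -mulr_sumr qm.
Qed.

(* Maximal coupling of one step: with probability at least [a k] both pasts
   receive the same letter and then agree on [k.+1] letters. *)
Lemma transfer_osc (h : Past E -> R) (beta : nat -> R) :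
  (forall k u v, (forall i, (i < k)%N -> u i = v i) -> `|h u - h v| <= beta k) ->
  forall k u v, (forall i, (i < k)%N -> u i = v i) ->
  `|transfer h u - transfer h v| <= a k * beta k.+1 + (1 - a k) * beta 0%N.
Proof.
move=> hb k u v uv.
pose c x := Num.min (g x u) (g x v); pose m := \sum_(x : E) c x.
have c0 x : 0 <= c x by rewrite le_min !g0.
have am : a k <= m := g_coef_overlap uv.
have m1 : m <= 1 by rewrite -(g1 u); apply: ler_sum => x _; rewrite ge_min lexx.
(* [beta] need not be monotone. Since [t <= beta 0], the weight [m] of the coupled part may be
   lowered to [a k]. *)
pose t := Num.min (beta k.+1) (beta 0%N).
have agree x i : (i < k.+1)%N -> cons_past x u i = cons_past x v i.
  by case: i => // i; rewrite ltnS /= => /uv.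
have b0 (w w' : Past E) : `|h w - h w'| <= beta 0%N by exact: hb.
have bt x : `|h (cons_past x u) - h (cons_past x v)| <= t.
  by rewrite le_min b0 hb//; exact: agree.
have t0 : t <= beta 0%N by rewrite ge_min lexx orbT.
have e : transfer h u - transfer h v =
  \sum_x c x * (h (cons_past x u) - h (cons_past x v)) +
  (\sum_x (g x u - c x) * h (cons_past x u) - \sum_x (g x v - c x) * h (cons_past x v)).
  by rewrite /transfer -!sumrB -big_split/=; apply: eq_bigr => x _; ring.
rewrite e (le_trans (ler_normD _ _))//.
have h1 : `|\sum_x c x * (h (cons_past x u) - h (cons_past x v))| <= m * t.
  rewrite (le_trans (ler_norm_sum _ _ _))// mulr_suml; apply: ler_sum => x _.
  by rewrite normrM (ger0_norm (c0 x)) ler_wpM2l.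
have h2 : `|\sum_x (g x u - c x) * h (cons_past x u) -
            \sum_x (g x v - c x) * h (cons_past x v)| <= (1 - m) * beta 0%N.
  apply: coupled_average_le => [x|x|||x y].
  - by rewrite subr_ge0 ge_min lexx.
  - by rewrite subr_ge0 ge_min lexx orbT.
  - by rewrite sumrB g1.
  - by rewrite sumrB g1.
  - exact: b0.
rewrite (le_trans (lerD h1 h2))//.
have a0 : 0 <= a k by have /andP[] := g_coef_01 k.
have t1 : t <= beta k.+1 by rewrite ge_min lexx.
have := ler_wpM2l a0 t1; have : 0 <= m - a k by rewrite subr_ge0.
move=> ma; have := ler_wpM2l ma t0; lra.
Qed.

(** At the start, pasts that share a letter give the same value and others differ by at most [C],
    which is [backward] at 0; [transfer_osc] is its recursion. *)
Lemma iter_transfer_osc (f : E -> R) (C : R) n : (forall x y, `|f x - f y| <= C) ->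
  forall k u v, (forall i, (i < k)%N -> u i = v i) ->
  `|iter n transfer (fun w => f (w 0%N)) u - iter n transfer (fun w => f (w 0%N)) v| <=
  backward a C n k.
Proof.
move=> fC; elim: n => [|n ih] k u v uv /=.
  case: k uv => [|k] uv; first by rewrite mulr1.
  by rewrite uv// subrr normr0 mulr0.
exact: transfer_osc.
Qed.

Lemma iter_transfer_bound (f : E -> R) (C : R) n : (forall x y, `|f x - f y| <= C) ->
  forall u v, `|iter n transfer (fun w => f (w 0%N)) u -
                iter n transfer (fun w => f (w 0%N)) v| <= C * rho g n.
Proof. by move=> fC u v; rewrite -backward_return; apply: iter_transfer_osc. Qed.

Lemma rho_ge0 n : 0 <= rho g n.
Proof. exact: chain_law_ge0 g_coef_01 n 0%N. Qed.

Lemma rho_summable : 0 < limn (fun n => \prod_(k < n) a k) ->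
  exists D, forall n, \sum_(j < n) rho g j <= D.
Proof.
set p := limn _ => p0; exists p^-1 => n; apply: sum_return_le => //; first exact: g_coef_01.
(* The partial products decrease, so their limit is a lower bound for each of them. *)
move=> k; apply: nonincreasing_cvgn_ge.
  apply/nonincreasing_seqP => i; rewrite big_ord_recr/=.
  have /andP[_ a1] := g_coef_01 i; rewrite ler_piMr// prodr_ge0// => j _.
  by have /andP[] := g_coef_01 j.
apply: nonincreasing_is_cvgn.
  apply/nonincreasing_seqP => i; rewrite big_ord_recr/=.
  have /andP[_ a1] := g_coef_01 i; rewrite ler_piMr// prodr_ge0// => j _.
  by have /andP[] := g_coef_01 j.
exists 0 => _ [i _ <-]; rewrite prodr_ge0// => j _.
by have /andP[] := g_coef_01 j.
Qed.

End transfer_operator.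

Section laws.
Context {d d' : measure_display} {T : measurableType d} {T' : measurableType d'} {R : realType}.
Variables (P : probability T R) (X : {RV P >-> T'}).

Lemma mean_distribution (h : T' -> R) : bounded_rv h ->
  mean (distribution P X) h = mean P (fun w => h (X w)).
Proof.
move=> bh; have [mh [M hM]] := bh.
have iX : integ P (fun w => h (X w)).
  apply: (integ_bounded P (M := M)) => [|w]; last exact: hM.
  exact: (measurableT_comp mh (measurable_funPT X)).
have ih : integ (distribution P X) h := bounded_integ _ bh.
have e : (\int[distribution P X]_y (h y)%:E = \int[P]_w (h (X w))%:E)%E.
  apply: (@integral_distribution _ _ _ _ _ P X (EFin \o h)) => //.
  exact/measurable_EFinP.
by apply: EFin_inj; rewrite -(integral_mean ih) -(integral_mean iX) e.
Qed.

End laws.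

Section configurations.
Context {I : Type} {E : pointedType} {D : set I}.
Local Notation confD := (g_sigma_algebraType (@coord_events I E D)).

Lemma measurable_coordinate i (B : set E) : D i -> measurable [set w : confD | B (w i)].
Proof. by move=> Di; apply: sub_sigma_algebra; exists i; split => //; exists B. Qed.

Lemma measurable_configuration d (T : measurableType d) (h : T -> confD) :
  (forall i (B : set E), D i -> measurable [set t | B (h t i)]) -> measurable_fun setT h.
Proof.
move=> mh; apply: (@measurability _ _ T confD setT h (@coord_events I E D) erefl).
by move=> _ [_ [i [Di [B ->]] <-]]; rewrite setTI; exact: mh.
Qed.

End configurations.

(** * Decoupling of the letters of a g-chain *)

Section g_chain_mixing.
Context {R : realType} {E : pointedFinType}.
Variables (g : E -> Past E -> R) (Q : probability (Omega E) R).
Hypotheses (gg : g_function g) (cQ : consistent g Q).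

Local Notation pastT := (g_sigma_algebraType (@coord_events int E [set i | i < 0])).

Definition shift (k : int) (w : Omega E) : Omega E := fun i => w (i + k).

Lemma shift_shift k l w : shift k (shift l w) = shift (k + l) w.
Proof. by apply/funext => i; rewrite /shift addrA. Qed.

Lemma shift0 w : shift 0 w = w.
Proof. by apply/funext => i; rewrite /shift addr0. Qed.

Lemma measurable_shift k : measurable_fun setT (shift k).
Proof.
by apply: measurable_configuration => i B _; exact: (@measurable_coordinate int E setT (i + k) B I).
Qed.

Lemma bounded_shift k (h : Omega E -> R) : bounded_rv h -> bounded_rv (fun w => h (shift k w)).
Proof.
move=> [mh [M hM]]; split; last by exists M.
exact: (measurableT_comp mh (measurable_shift k)).
Qed.

HB.instance Definition _ := isMeasurableFun.Build _ _ _ _ (shift 1) (measurable_shift 1).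

Let mean_shift1 (h : Omega E -> R) : bounded_rv h -> mean Q (fun w => h (shift 1 w)) = mean Q h.
Proof.
move=> bh; rewrite -(@mean_distribution _ _ _ _ _ Q (shift 1) h bh).
rewrite !meanE; congr fine; apply: eq_measure_integral => A mA _.
by have [sQ _] := cQ; exact: sQ.
Qed.

Lemma mean_shift (n : nat) (h : Omega E -> R) : bounded_rv h ->
  mean Q (fun w => h (shift n%:Z w)) = mean Q h.
Proof.
move=> bh; elim: n => [|n ih]; first by apply: eq_mean => w; rewrite shift0.
rewrite -{}ih -(mean_shift1 (bounded_shift n%:Z bh)); apply: eq_mean => w.
by rewrite shift_shift intS addrC.
Qed.

Lemma discrete_coordinate (i : int) : discrete_rv (fun w : Omega E => w i).
Proof. by move=> B; exact: (@measurable_coordinate int E setT i B I). Qed.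

Lemma bounded_past_measurable (Z : Omega E -> R) (M : R) :
  past_measurable Z -> (forall w, `|Z w| <= M) -> bounded_rv Z.
Proof.
move=> mZ ZM; split; last by exists M.
rewrite -[Z]/(Z \o (id : Omega E -> pastT)).
apply: (measurableT_comp mZ); apply: measurable_configuration => i B _.
exact: measurable_coordinate.
Qed.

Lemma past_measurable_shift (Z : Omega E -> R) (n : nat) :
  past_measurable Z -> past_measurable (fun w => Z (shift (- n%:Z) w)).
Proof.
move=> mZ; rewrite /past_measurable.
pose sh : pastT -> pastT := shift (- n%:Z).
have msh : measurable_fun setT sh; last exact: (measurableT_comp mZ msh).
apply: measurable_configuration => i B /= i0.
apply: (@measurable_coordinate int E [set i | i < 0] (i - n%:Z) B) => /=.
by rewrite subr_lt0 (lt_le_trans i0).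
Qed.

Lemma past_measurable_past (phi : Past E -> R) : measurable_fun setT phi ->
  past_measurable (fun w => phi (past w)).
Proof.
move=> mphi; rewrite /past_measurable.
pose ps : pastT -> Past E := @past E.
have mps : measurable_fun setT ps; last exact: (measurableT_comp mphi mps).
by apply: measurable_configuration => i B _; exact: (@measurable_coordinate int E [set i | i < 0] (- i.+1%:Z) B isT).
Qed.

Lemma measurable_cons_past x : measurable_fun setT (@cons_past E x).
Proof.
apply: measurable_configuration => -[|i] B _; last exact: (@measurable_coordinate nat E setT i B I).
exact: discrete_cst.
Qed.

Lemma bounded_cons_past (phi : Past E -> R) x : bounded_rv phi ->
  bounded_rv (fun u => phi (cons_past x u)).
Proof.
move=> [mphi [M hM]]; split; last by exists M.
exact: (measurableT_comp mphi (measurable_cons_past x)).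
Qed.

Lemma bounded_transfer (phi : Past E -> R) : bounded_rv phi -> bounded_rv (transfer g phi).
Proof.
move=> bphi; have [mg g01 g1] := gg; split.
  apply: measurable_sum => x; apply: measurable_funM; first exact: mg.
  by have [] := bounded_cons_past x bphi.
have [_ [M hM]] := bphi; exists M => u; rewrite /transfer (le_trans (ler_norm_sum _ _ _))//.
rewrite -[leRHS]mul1r -(g1 u) mulr_suml; apply: ler_sum => x _.
by have /andP[g0 _] := g01 x u; rewrite normrM ger0_norm// ler_wpM2l.
Qed.

Lemma past_shift1 w : past (shift 1 w) = cons_past (w 0) (past w).
Proof.
apply/funext => -[|n]; rewrite /past /shift/= ?addNr//.
by congr (w _); rewrite intS [1 + _]addrC opprD subrK.
Qed.

(** After splitting by the letter [x] at time 0, consistency applies to the past-measurable function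
    [Zx x]. *)
Let mean_transfer1 (Z : Omega E -> R) (M : R) (phi : Past E -> R) :
  past_measurable Z -> (forall w, `|Z w| <= M) -> bounded_rv phi ->
  mean Q (fun w => Z w * phi (past (shift 1 w))) = mean Q (fun w => Z w * transfer g phi (past w)).
Proof.
move=> mZ ZM bphi; have [mg g01 g1] := gg; have [_ [N hN]] := bphi.
have bZ := bounded_past_measurable mZ ZM.
pose Zx x w := Z w * phi (cons_past x (past w)).
have mZx x : past_measurable (Zx x).
  have [mphix _] := bounded_cons_past x bphi.
  exact: (measurable_funM mZ (past_measurable_past mphix)).
have ZxM x w : `|Zx x w| <= M * N by rewrite normrM ler_pM.
have bZx x : bounded_rv (Zx x) := bounded_past_measurable (mZx x) (ZxM x).
have bgx x : bounded_rv (fun w => g x (past w)).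
  apply: (bounded_past_measurable (past_measurable_past (mg x)) (M := 1)).
  by move=> w; have /andP[g0 gle] := g01 x (past w); rewrite ger0_norm.
have b0x x : bounded_rv (fun w : Omega E => (w 0 == x)%:R : R).
  by apply: bounded_bool; exact: (discrete_comp (fun y => y == x) (discrete_coordinate 0)).
have step x : mean Q (fun w => Zx x w * (w 0 == x)%:R) = mean Q (fun w => Zx x w * g x (past w)).
  have [_ hc] := cQ; have := hc x (Zx x) (mZx x) (ex_intro _ (M * N) (ZxM x)).
  rewrite !meanE => ->; congr fine; rewrite [RHS]integral_mkcond.
  apply: eq_integral => w _; rewrite patchE; case: ifPn => [/set_mem/= ->|/negP w0].
    by rewrite eqxx mulr1.
  by case: eqP => [e|_]; [exfalso; apply: w0; exact: mem_set|rewrite mulr0].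
transitivity (\sum_(x : E) mean Q (fun w => Zx x w * (w 0 == x)%:R)).
  rewrite -mean_sum; last by move=> x _; apply: bounded_integ; exact: boundedM.
  apply: eq_mean => w; rewrite (bigD1 (w 0))//= eqxx mulr1 big1 => [|x xw].
    by rewrite addr0 /Zx past_shift1.
  by rewrite eq_sym (negbTE xw) mulr0.
rewrite (eq_bigr _ (fun x _ => step x)) -mean_sum; last first.
  by move=> x _; apply: bounded_integ; exact: boundedM.
apply: eq_mean => w; rewrite /transfer mulr_sumr; apply: eq_bigr => x _.
by rewrite /Zx -mulrA [_ * g _ _]mulrC.
Qed.

(** Consistency concerns time 0 only. Stationarity moves [Z] back by [n] steps, where it stays
    past-measurable, and one transfer is made there. *)
Lemma mean_transfer (n : nat) (Z : Omega E -> R) (M : R) (phi : Past E -> R) :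
  past_measurable Z -> (forall w, `|Z w| <= M) -> bounded_rv phi ->
  mean Q (fun w => Z w * phi (past (shift n%:Z w))) =
  mean Q (fun w => Z w * iter n (transfer g) phi (past w)).
Proof.
move=> mZ ZM; have bZ := bounded_past_measurable mZ ZM.
have bpast (psi : Past E -> R) : bounded_rv psi -> bounded_rv (fun w => psi (past w)).
  move=> [mpsi [N psiN]].
  exact: (bounded_past_measurable (past_measurable_past mpsi) (fun w => psiN (past w))).
elim: n phi => [|n ih] phi bphi; first by apply: eq_mean => w; rewrite shift0.
rewrite iterSr -(ih _ (bounded_transfer bphi)).
have mZ' := past_measurable_shift n mZ.
have ZM' w : `|Z (shift (- n%:Z) w)| <= M by exact: ZM.
have bZ' := bounded_past_measurable mZ' ZM'.
have bT := bounded_transfer bphi.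
have e w : Z (shift (- n%:Z) (shift n%:Z w)) = Z w by rewrite shift_shift addNr shift0.
transitivity (mean Q (fun w => Z (shift (- n%:Z) w) * phi (past (shift 1 w)))).
  rewrite -(@mean_shift n (fun w => Z (shift (- n%:Z) w) * phi (past (shift 1 w)))).
    by apply: eq_mean => w; rewrite e shift_shift -intS.
  by apply: boundedM => //; apply: (@bounded_shift 1 (fun w => phi (past w))); exact: bpast.
rewrite (mean_transfer1 mZ' ZM' bphi).
rewrite -(@mean_shift n (fun w => Z (shift (- n%:Z) w) * transfer g phi (past w))).
  by apply: eq_mean => w; rewrite e.
by apply: boundedM => //; exact: bpast.
Qed.

Section centered.
Variables (f : E -> R) (C : R).
Hypothesis fC : forall x y, `|f x - f y| <= C.
Hypothesis f0 : mean Q (fun w => f (w 0)) = 0.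

Let phi (u : Past E) := f (u 0%N).

Let bounded_phi : bounded_rv phi.
Proof.
apply: (bounded_discrete (M := \sum_(x : E) `|f x|)) => [B|u].
  exact: (@measurable_coordinate nat E setT 0%N [set x | B (f x)]).
by rewrite (bigD1 (u 0%N))//= lerDl sumr_ge0.
Qed.

Let bounded_iter n : bounded_rv (iter n (transfer g) phi).
Proof. by elim: n => //= n; exact: bounded_transfer. Qed.

Let phi_shift (j : nat) w : phi (past (shift j.+1%:Z w)) = f (w j%:Z).
Proof. by rewrite /phi /past /shift; congr (f (w _)); lia. Qed.

(** The iterate has mean 0 under the law of the past, so its small oscillation is a bound on its
    size. *)
Lemma transfer_small j u : `|iter j.+1 (transfer g) phi u| <= C * rho g j.+1.
Proof.
set psi := iter _ _ _.
have bpsi : bounded_rv (fun w => psi (past w)).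
  have [mpsi [N psiN]] := bounded_iter j.+1.
  exact: (bounded_past_measurable (past_measurable_past mpsi) (fun w => psiN (past w))).
have psi0 : mean Q (fun w => psi (past w)) = 0.
  have m1 : past_measurable (fun _ : Omega E => 1 : R).
    by rewrite /past_measurable; exact: (@measurable_cst _ _ pastT _ setT (1 : R)).
  have M1 (w : Omega E) : `|(1 : R)| <= 1 by rewrite normr1.
  transitivity (mean Q (fun w => 1 * psi (past w))).
    by apply: eq_mean => w; rewrite mul1r.
  rewrite -(mean_transfer j.+1 m1 M1 bounded_phi) -f0.
  have bf : bounded_rv (fun w : Omega E => f (w 0)).
    apply: (bounded_discrete (M := \sum_(x : E) `|f x|)).
      exact: (discrete_comp f (discrete_coordinate 0)).
    by move=> w; rewrite (bigD1 (w 0))//= lerDl sumr_ge0.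
  rewrite -(mean_shift j bf); apply: eq_mean => w.
  by rewrite mul1r phi_shift /shift add0r.
have ipsi := bounded_integ Q bpsi.
have -> : psi u = mean Q (fun w => psi u - psi (past w)).
  by rewrite (meanB (integ_cst _ _) ipsi) mean_cst psi0 subr0.
apply: (normr_mean_le (integB (integ_cst _ _) ipsi)) => w.
exact: iter_transfer_bound.
Qed.

(** The letter at time [a + k + j] is the latest one of the past seen [j.+1] steps after time
    [a + k], whence the index of [rho]. *)
Lemma g_chain_decoupling (a k j : nat) (z : seq E -> R) :
  `|mean Q (fun w => z (word (fun i (w : Omega E) => w i%:Z) a k w) * f (w (a + k + j)%N%:Z))| <=
  C * rho g j.+1 * mean Q (fun w => `|z (word (fun i (w : Omega E) => w i%:Z) a k w)|).
Proof.
(* The word is moved so as to end at time -1. For [i >= k] the truncated subtraction also gives time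
   -1, so all indices are negative. *)
pose past_letter i (w : pastT) : E := w (- (k - i.+1).+1%:Z).
have dpl i : discrete_rv (past_letter i).
  by move=> B; apply: (@measurable_coordinate int E [set i | i < 0] _ B).
pose Z (w : Omega E) := z (word past_letter 0 k w).
have [mZ [M ZM]] : bounded_rv (Z : pastT -> R) := bounded_word dpl 0 k z.
have bZ : bounded_rv Z := bounded_past_measurable mZ ZM.
have ZE w : z (word (fun i (w : Omega E) => w i%:Z) a k w) = Z (shift (a + k)%N%:Z w).
  rewrite /Z; congr z; rewrite /word -[a in iota a]addn0 iotaDl -map_comp.
  apply/eq_in_map => i; rewrite mem_iota add0n/= => ik.
  rewrite /past_letter /shift; congr (w _); lia.
have bfj : bounded_rv (fun w : Omega E => f (w j%:Z)).
  apply: (bounded_discrete (M := \sum_(x : E) `|f x|)).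
    exact: (discrete_comp f (discrete_coordinate j%:Z)).
  by move=> w; rewrite (bigD1 (w j%:Z))//= lerDl sumr_ge0.
have eL : mean Q (fun w => z (word (fun i (w : Omega E) => w i%:Z) a k w) * f (w (a + k + j)%N%:Z)) =
    mean Q (fun w => Z w * iter j.+1 (transfer g) phi (past w)).
  transitivity (mean Q (fun w => Z (shift (a + k)%N%:Z w) * f (shift (a + k)%N%:Z w j%:Z))).
    by apply: eq_mean => w; rewrite ZE /shift -[j%:Z + _]PoszD [(j + _)%N]addnC.
  rewrite (mean_shift (a + k) (boundedM bZ bfj)) -(mean_transfer j.+1 mZ ZM bounded_phi).
  by apply: eq_mean => w; rewrite phi_shift.
have eR : mean Q (fun w => `|z (word (fun i (w : Omega E) => w i%:Z) a k w)|) =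
    mean Q (fun w => `|Z w|).
  rewrite -(mean_shift (a + k) (bounded_norm bZ)); apply: eq_mean => w.
  by rewrite ZE.
rewrite {}eL {}eR.
have bpsi : bounded_rv (fun w => iter j.+1 (transfer g) phi (past w)).
  have [mpsi [N psiN]] := bounded_iter j.+1.
  exact: (bounded_past_measurable (past_measurable_past mpsi) (fun w => psiN (past w))).
have iZpsi := bounded_integ Q (boundedM bZ bpsi).
apply: (le_trans (normr_mean iZpsi)).
rewrite -(meanZ _ (integ_norm (bounded_integ Q bZ))).
apply: ler_mean => [||w]; first exact: integ_norm.
  exact/integZ/integ_norm/(bounded_integ Q bZ).
by rewrite normrM mulrC ler_wpM2r// transfer_small.
Qed.

End centered.
End g_chain_mixing.

(** * Regeneration *)

(** A union over the countably many values of [N]; it handles letters read at random times. *)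
Lemma discrete_bind d (T : measurableType d) (S : countType) (S' : Type)
    (N : T -> S) (V : S -> T -> S') :
  discrete_rv N -> (forall s, discrete_rv (V s)) -> discrete_rv (fun w => V (N w) w).
Proof.
move=> dN dV B.
rewrite (_ : _ @^-1` B = \bigcup_n
    (if unpickle n is Some s then (N @^-1` [set s]) `&` (V s @^-1` B) else set0)).
  apply: bigcupT_measurable => n; case: unpickle => // s.
  by apply: measurableI; [exact: dN|exact: dV].
apply/seteqP; split=> [w Bw|w [n _]].
  by exists (pickle (N w)) => //; rewrite pickleK.
by case: unpickle => //= s [<-].
Qed.

Section regeneration_blocks.
Context {R : realType} {E : pointedFinType} {d : measure_display} {T : measurableType d}.
Variables (P : probability T R) (g : E -> Past E -> R) (X : {RV P >-> Omega E}).
Variable tau : int -> T -> int.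
Hypotheses (gg : g_function g) (htau : regeneration_process g X tau).

Definition letter (i : nat) (w : T) : E := X w i%:Z.

(** Numbered from block 1: the block of index 0 contains the origin and may follow another law. *)
Definition next_block (i : nat) (w : T) : seq E := block X tau i.+1%:Z w.

Definition ordered_times w := (forall i, tau i w < tau (i + 1) w) /\ tau 0 w <= 0 < tau 1 w.

Lemma ae_ordered_times : {ae P, forall w, ordered_times w}.
Proof. by have [] := htau. Qed.

Lemma discrete_X (i : int) : discrete_rv (fun w => X w i).
Proof.
move=> B; have mX : measurable_fun setT X := measurable_funPT X.
have := mX measurableT [set w : Omega E | B (w i)].
by rewrite setTI; apply; exact: discrete_coordinate.
Qed.

Lemma discrete_letter i : discrete_rv (letter i).
Proof. exact: discrete_X. Qed.

Lemma discrete_time i : discrete_rv (tau i).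
Proof. by apply: discrete_countable => k; have [mt _ _ _ _] := htau; exact: mt. Qed.

Lemma discrete_block i : discrete_rv (block X tau i).
Proof.
pose V (kl : int * int) (w : T) := [seq X w (kl.1 + j%:Z) | j <- iota 0 `|kl.2 - kl.1|%N].
apply: (discrete_bind (V := V) (discrete_pair (discrete_time i) (discrete_time (i + 1)))).
by move=> kl; apply: (discrete_mkseq (U := fun j w => X w (kl.1 + j%:Z))) => j; exact: discrete_X.
Qed.

Lemma discrete_next_block i : discrete_rv (next_block i).
Proof. exact: discrete_block. Qed.

Let discrete_eq i s : discrete_rv (fun w => next_block i w == s).
Proof. exact: (discrete_comp (fun v => v == s) (discrete_next_block i)). Qed.

Let pr_block i s : (P (next_block i @^-1` [set s]) = (pr P (fun w => next_block i w == s))%:E)%E.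
Proof.
rewrite -(pr_fine _ (discrete_eq i s)); congr (P _); apply/seteqP.
by split=> [w/= ->|w/= /eqP//]; exact/eqP.
Qed.

Let pr_mkseq n (v : seq (seq E)) : size v = n ->
  pr P (fun w => mkseq (next_block^~ w) n == v) =
  \prod_(i < n) pr P (fun w => next_block i w == nth [::] v i).
Proof.
move=> sv.
have [_ _ _ _ [ind _]] := htau.
have us : uniq [seq i.+1%:Z | i <- iota 0 n].
  by rewrite map_inj_uniq ?iota_uniq// => i j [].
have := ind _ (fun k => [set nth [::] v `|k|.-1]) us.
rewrite big_map -[n in iota 0 n]subn0 -/(index_iota 0 n) big_mkord.
rewrite (eq_bigr (fun i : 'I_n => (pr P (fun w => next_block i w == nth [::] v i))%:E)); last first.
  by move=> i _; rewrite -pr_block.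
rewrite prodEFin => e; apply: EFin_inj; rewrite -e -pr_fine; last first.
  exact: (discrete_comp (fun u => u == v) (discrete_mkseq n discrete_next_block)).
congr (P _); apply/seteqP; split=> w /=.
  move=> /eqP ev k /= /mapP[i]; rewrite mem_index_iota /= => ilt ->.
  by rewrite -ev nth_mkseq.
move=> h; apply/eqP; apply: (@eq_from_nth _ [::]); rewrite size_mkseq// => i ilt.
rewrite nth_mkseq//; apply: (h i.+1%:Z) => /=.
by rewrite map_f// mem_index_iota.
Qed.

Lemma iid_next_block : iid P next_block.
Proof.
have [_ _ _ _ [_ same]] := htau.
split; first exact: discrete_next_block.
  move=> i s; apply: EFin_inj; rewrite -!pr_block; exact: same.
move=> n v s; have [sv|sv] := eqVneq (size v) n; last first.
  have f0 w : (mkseq (next_block^~ w) n == v) = false.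
    by apply: contraNF sv => /eqP <-; rewrite size_mkseq.
  rewrite /pr (_ : mean P (fun w => (mkseq (next_block^~ w) n == v)%:R) = 0).
    rewrite mul0r -(mean_cst P 0); apply: eq_mean => w; by rewrite f0.
  by rewrite -(mean_cst P 0); apply: eq_mean => w; rewrite f0.
transitivity (pr P (fun w => mkseq (next_block^~ w) n.+1 == rcons v s)).
  apply: eq_mean => w.
  by rewrite /mkseq -[n.+1]addn1 iotaD map_cat cats1 eqseq_rcons.
rewrite pr_mkseq ?size_rcons ?sv// big_ord_recr/= nth_rcons sv ltnn eqxx pr_mkseq//.
by congr (_ * _); apply: eq_bigr => i _; rewrite nth_rcons sv ltn_ord.
Qed.

Lemma size_next_block i w : size (next_block i w) = `|tau (i.+1%:Z + 1) w - tau i.+1%:Z w|%N.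
Proof. by rewrite /next_block /block size_map size_iota. Qed.

Lemma size_next_blockE i w : ordered_times w ->
  (size (next_block i w))%:Z = tau (i.+1%:Z + 1) w - tau i.+1%:Z w.
Proof. by move=> [ord _]; rewrite size_next_block gez0_abs// subr_ge0 ltW. Qed.

(** The law is prescribed for the difference of times. The size is its absolute value, which agrees
    only where the times are ordered, hence almost surely. *)
Lemma pr_size_ge M : pr P (fun w => (M < size (next_block 0 w))%N) = rho g M.
Proof.
have [_ _ _ /(_ 1 M.+1 isT isT) hM _] := htau.
pose b w := (M.+1%:Z <= tau (1 + 1) w - tau 1 w)%R.
have db : discrete_rv b.
  exact: (discrete_comp (fun p : int * int => (M.+1%:Z <= p.1 - p.2)%R)
    (discrete_pair (discrete_time (1 + 1)) (discrete_time 1))).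
apply: EFin_inj; rewrite -hM -/b.
transitivity (pr P b)%:E; last first.
  by rewrite -(pr_fine P db); congr (P _); apply/seteqP; split.
congr EFin; rewrite /pr; apply: ae_eq_mean.
- apply: discrete_measurable.
  exact: (discrete_comp (fun v => (M < size v)%N%:R) (discrete_next_block 0)).
- exact/discrete_measurable/(discrete_comp (fun c : bool => c%:R)).
apply: filterS ae_ordered_times => w /(size_next_blockE 0) e.
by rewrite /b -e lez_nat.
Qed.

(** Tail-sum formula: the mean length is the sum of the return probabilities. *)
Lemma integ_size : 0 < limn (fun n => \prod_(k < n) g_coef g k) ->
  integ P (fun w => (size (next_block 0 w))%:R).
Proof.
move=> /(rho_summable gg)[D hD].
have dL : discrete_rv (fun w => (size (next_block 0 w))%:R : R).
  exact: (discrete_comp (fun v => (size v)%:R) (discrete_next_block 0)).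
apply: (@integ_truncations _ _ _ _ _ D).
- exact: discrete_measurable.
- by move=> w.
move=> n; have bM M : bounded_rv (fun w => (M < size (next_block 0 w))%N%:R : R).
  by apply: bounded_bool; exact: (discrete_comp (fun v => (M < size v)%N) (discrete_next_block 0)).
apply: (le_trans _ (hD n)).
rewrite (eq_bigr (fun j : 'I_n => pr P (fun w => (j < size (next_block 0 w))%N))); last first.
  by move=> j _; rewrite pr_size_ge.
rewrite -mean_sum; last by move=> j _; exact: bounded_integ.
apply: ler_mean.
- apply: bounded_integ; apply: (bounded_discrete (M := n%:R)).
    exact: (discrete_comp (fun y : R => y * (y <= n%:R)%R%:R) dL).
  move=> w; case: (boolP ((size (next_block 0 w))%:R <= n%:R :> R)%R) => h.
    by rewrite mulr1 ger0_norm.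
  by rewrite mulr0 normr0.
- by apply: integ_sum => j _; exact: bounded_integ.
move=> w; set l := size _.
case: (boolP (l%:R <= n%:R :> R)%R) => [|_]; last by rewrite mulr0; apply: sumr_ge0.
rewrite ler_nat => ln; rewrite mulr1 -natr_sum ler_nat.
rewrite -(subnKC ln) big_split_ord/= -[leqLHS]addn0 leq_add//.
rewrite (eq_bigr (fun=> 1%N)) => [|i _]; last by rewrite ltn_ord.
by rewrite sum1_card card_ord.
Qed.

Lemma mean_size_ge1 : 0 < limn (fun n => \prod_(k < n) g_coef g k) ->
  1 <= mean P (fun w => (size (next_block 0 w))%:R).
Proof.
(* [rho g 0] computes to 1 and is the probability that a block is nonempty. *)
move=> hp; rewrite -[leLHS]/(rho g 0).
have pos_le (l : nat) : (0 < l)%N%:R <= l%:R :> R by rewrite ler_nat; case: l.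
rewrite -pr_size_ge; apply: ler_mean => [||w].
- apply: bounded_integ; apply: bounded_bool.
  exact: (discrete_comp (fun v => (0 < size v)%N) (discrete_next_block 0)).
- exact: integ_size.
- exact: pos_le.
Qed.

Definition first_time w := `|tau 1 w|%N.

Lemma discrete_first_time : discrete_rv first_time.
Proof. exact: discrete_comp (discrete_time 1). Qed.

Definition total_size m w := (\sum_(i < m) size (next_block i w))%N.

(** The times before [tau m.+1] consist of a delay up to [tau 1] and of [m] whole blocks. *)
Lemma word_sum_next_block (f : E -> R) m w : ordered_times w ->
  word_sum letter f 0 (first_time w + total_size m w) w =
  word_sum letter f 0 (first_time w) w +
  partial_sum next_block (fun v => \sum_(x <- v) f x) m w.
Proof.
move=> ordw; have [ord /andP[_ t1]] := ordw.
have tE k : (first_time w + total_size k w)%N%:Z = tau k.+1%:Z w.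
  elim: k => [|k ih]; first by rewrite /total_size big_ord0 addn0 gtz0_abs.
  rewrite /total_size big_ord_recr/= addnA PoszD ih size_next_blockE//.
  by rewrite addrC subrK -PoszD addn1.
elim: m => [|m ih]; first by rewrite /total_size big_ord0 addn0 partial_sum0 addr0.
rewrite partial_sumS addrA -ih {1}/total_size big_ord_recr/= -/(total_size m w) addnA.
rewrite word_sumD add0n; congr (_ + _); rewrite /word_sum; congr bigop.
rewrite /word /next_block /block size_map size_iota.
rewrite -[in LHS](addn0 (_ + _)%N) iotaDl -map_comp; apply: eq_map => j /=.
by rewrite /letter PoszD tE.
Qed.

End regeneration_blocks.

(** * The central limit theorem for regenerative sums *)

Lemma inv_sqrt_cvg (R : realType) : (Num.sqrt n%:R)^-1 @[n --> \oo] --> (0 : R).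
Proof.
apply/cvgrPdist_le => e e0; have [n0 hn0] := ex_nat_ge ((e^-1) ^+ 2).
exists n0.+1 => // n /= nn; rewrite sub0r normrN ger0_norm ?invr_ge0 ?sqrtr_ge0//.
have np : 0 < n%:R :> R by rewrite ltr0n (leq_trans _ nn).
have sp : 0 < Num.sqrt n%:R :> R by rewrite sqrtr_gt0.
have e1 : e^-1 <= Num.sqrt n%:R.
  rewrite -[leLHS]ger0_norm ?invr_ge0 ?(ltW e0)// -sqrtr_sqr ler_wsqrtr//.
  by apply: hn0; exact: ltnW.
by rewrite -[leRHS]invrK lef_pV2 ?posrE ?invr_gt0.
Qed.

(** The subtraction truncates at 0, which only shortens the window around [n]. *)
Lemma window_subn n N t (a := (n - N)%N) : (t <= n + N)%N -> (n <= t + N)%N ->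
  [/\ (a + (t - a) = t)%N, (a + (n - a) = n)%N, (t - a <= N + N)%N & (n - a <= N + N)%N].
Proof. by rewrite /a => *; split; lia. Qed.

Section union_bounds.
Context {d : measure_display} {T : measurableType d} {R : realType}.
Variable P : probability T R.

Lemma pr_le_add3 (b b1 b2 b3 : T -> bool) :
  discrete_rv b -> discrete_rv b1 -> discrete_rv b2 -> discrete_rv b3 ->
  {ae P, forall w, b w -> [|| b1 w, b2 w | b3 w]} ->
  pr P b <= pr P b1 + pr P b2 + pr P b3.
Proof.
move=> db d1 d2 d3 hb.
pose c w := b w && [|| b1 w, b2 w | b3 w].
have dc : discrete_rv c.
  apply: (discrete_map2 andb db); apply: (discrete_map2 orb d1).
  exact: (discrete_map2 orb d2).
have i1 := bounded_integ P (bounded_bool d1).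
have i2 := bounded_integ P (bounded_bool d2).
have i3 := bounded_integ P (bounded_bool d3).
have ic := bounded_integ P (bounded_bool dc).
have -> : pr P b = pr P c.
  apply: ae_eq_mean.
  - exact: integ_measurable (bounded_integ P (bounded_bool db)).
  - exact: integ_measurable ic.
  apply: filterS hb => w; rewrite /c; case: (b w) => //= h.
  by rewrite h.
rewrite /pr -(meanD i1 i2) -(meanD (integD i1 i2) i3).
apply: ler_mean => // [|w]; first exact: integD (integD i1 i2) i3.
rewrite /c; case: (b w) => /=; last by rewrite !addr_ge0.
by case: (b1 w); case: (b2 w); case: (b3 w); rewrite /= ?mulr0n ?mulr1n; lra.
Qed.

Lemma mean_diff_le (Y Z : T -> R) (e M : R) (b : T -> bool) :
  bounded_rv Y -> bounded_rv Z -> discrete_rv b -> 0 <= M -> 0 <= e ->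
  (forall w, ~~ b w -> `|Y w - Z w| <= e) -> (forall w, `|Y w - Z w| <= M) ->
  `|mean P Y - mean P Z| <= e + M * pr P b.
Proof.
move=> bY bZ db M0 e0 he hM.
have iY := bounded_integ P bY; have iZ := bounded_integ P bZ.
have ib := bounded_integ P (bounded_bool db).
rewrite -(meanB iY iZ) (le_trans (normr_mean (integB iY iZ)))//.
rewrite /pr -(meanZ M ib) -[e in leRHS](mean_cst P) -(meanD (integ_cst P e) (integZ M ib)).
apply: ler_mean => [||w].
- exact: integ_norm (integB iY iZ).
- exact: integD (integ_cst P e) (integZ M ib).
case: (boolP (b w)) => bw; first by rewrite mulr1 (le_trans (hM w))// lerDr.
by rewrite mulr0 addr0; exact: he.
Qed.

Lemma pr_tail_nat (N : T -> nat) (e : R) : discrete_rv N -> 0 < e ->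
  exists K : nat, pr P (fun w => (K < N w)%N) <= e.
Proof.
move=> dN e0.
have : pr P (fun w => (n < N w)%N) @[n --> \oo] --> (0 : R).
  rewrite -[X in _ --> X](mean_cst P 0) /pr.
  apply: (cvg_mean _ _ (integ_cst P 1)) => //.
  - by move=> n; apply: discrete_measurable; exact: (discrete_comp (fun y => (n < y)%N%:R) dN).
  - by move=> n w; rewrite normr_nat lern1 leq_b1.
  - move=> w; apply: cvg_near_cst; exists (N w) => // n /= nN.
    by rewrite ltnNge nN.
move=> /cvgrPdist_le/(_ _ e0)[n _ /(_ n (leqnn n))].
by rewrite /= sub0r normrN (ger0_norm (pr_ge0 _ _)) => h; exists n.
Qed.

End union_bounds.

(** * Comparison of the sum up to time n with a sum of blocks *)

Section renewal_reward.
Context {d : measure_display} {T : measurableType d} {R : realType}.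
Variable P : probability T R.
Context {E : finType}.
Variables (F : nat -> T -> E) (f : E -> R) (B D : R) (r : nat -> R).
Hypothesis dF : forall i, discrete_rv (F i).
Hypothesis B0 : 0 <= B.
Hypothesis fB : forall x, `|f x| <= B.
Hypothesis r0 : forall j, 0 <= r j.
Hypothesis rD : forall n, \sum_(j < n) r j <= D.
Hypothesis mix : forall a k j (z : seq E -> R),
  `|mean P (fun w => z (word F a k w) * f (F (a + k + j)%N w))| <=
  r j * mean P (fun w => `|z (word F a k w)|).

Context {S : countType}.
Variables (U : nat -> T -> S) (len : S -> nat) (G : S -> R) (T1 : T -> nat).
Hypothesis iidU : iid P U.
Hypothesis dT1 : discrete_rv T1.
Hypothesis iL : integ P (fun w => (len (U 0%N w))%:R).
Local Notation mu := (mean P (fun w => (len (U 0%N w))%:R)).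
Hypothesis mu1 : 1 <= mu.

Local Notation total m w := (\sum_(i < m) len (U i w))%N.
Local Notation S_ n w := (word_sum F f 0 n w).
Local Notation W m w := (partial_sum U G m w).
Local Notation sq := (sqr_const B D).

(** The only link between letters and blocks: at the random end of block [m] the two sums differ by
    the delay term. *)
Hypothesis renewal : {ae P, forall w, forall m,
  S_ (T1 w + total m w)%N w = S_ (T1 w) w + W m w}.

Let D0 : 0 <= D. Proof. by have := rD 0; rewrite big_ord0. Qed.

Let sq0 : 0 <= sq.
Proof. by rewrite /sqr_const; have := mulr_ge0 B0 D0; have := sqr_ge0 B; lra. Qed.

Let mu0 : 0 < mu. Proof. exact: lt_le_trans mu1. Qed.

Let Lam m w : R := partial_sum U (fun s => (len s)%:R) m w.

Let LamE m w : Lam m w = (total m w)%:R.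
Proof. by rewrite /Lam /partial_sum natr_sum. Qed.

Let discrete_W m : discrete_rv (fun w => W m w) := discrete_partial_sum iidU G m.

Let discrete_Lam m : discrete_rv (Lam m) := discrete_partial_sum iidU _ m.

Let discrete_exit a n (lam : R) :
  discrete_rv (fun w => has (fun j => lam <= `|word_sum F f a j w|) (iota 0 n.+1)).
Proof.
pose h (v : seq E) := has (fun j => lam <= `|\sum_(x <- take j v) f x|) (iota 0 n.+1).
rewrite (_ : (fun w => _) = (fun w => h (word F a n w))).
  exact: (discrete_comp h (discrete_word dF a n)).
apply/funext => w; apply: eq_in_has => j; rewrite mem_iota add0n ltnS => /andP[_ jn].
by rewrite take_word.
Qed.

Let not_exit a n (lam : R) w j :
  ~~ has (fun j => lam <= `|word_sum F f a j w|) (iota 0 n.+1) -> (j <= n)%N ->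
  `|word_sum F f a j w| < lam.
Proof.
move=> /hasPn h jn; rewrite ltNge; apply: h; by rewrite mem_iota add0n ltnS.
Qed.

(** A sum of blocks is the difference of two sums of letters at random times. Outside two small
    events both times are at most [N], of order [m], and the maximal inequality bounds both sums by
    [lam]. *)
Lemma block_sums_tight : exists2 A : R, 0 < A & exists m0, forall m, (m0 <= m)%N ->
  pr P (fun w => A * Num.sqrt m%:R < `|W m w|) <= 1 / 4.
Proof.
have e16 : (0 : R) < 1 / 16 by [].
have [K1 hK1] := pr_tail_nat P dT1 e16.
have [m1 hm1] := @wlln _ _ _ P _ _ iidU (fun s => (len s)%:R) 1 _ iL ltr01 e16.
have [K hK] := ex_nat_ge (mu + 1).
have {}hK := hK K (leqnn K).
(* [8 * D] secures [4 * D <= lam], the last term makes the exit probability at most 1/8, and 1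
   ensures [A <= A ^+ 2]. *)
pose A := 8 * D + 1 + 64 * ((K.+1)%:R * sq).
have A1 : 1 <= A.
  rewrite /A; have h : 0 <= (K.+1)%:R * sq by rewrite mulr_ge0.
  by move: D0 h; lra.
exists A; first exact: lt_le_trans A1.
exists (maxn m1 K1.+1) => m; rewrite geq_max => /andP[m1m K1m].
have mp : (0 < m)%N by case: m K1m {m1m}.
have smge1 : 1 <= Num.sqrt m%:R :> R.
  by rewrite -[leLHS]sqrtr1 ler_sqrt// ler1n.
pose lam := A * Num.sqrt m%:R / 2; pose N := (K1 + m * K)%N.
pose b1 w := (K1 < T1 w)%N.
pose b2 w := m%:R * 1 < `|Lam m w - m%:R * mu|.
pose b3 w := has (fun j => lam <= `|word_sum F f 0 j w|) (iota 0 N.+1).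
have lamD : 4 * D <= lam.
  have h : 8 * D * 1 <= A * Num.sqrt m%:R.
    apply: ler_pM => //; first by rewrite mulr_ge0.
    by rewrite /A -addrA lerDl addr_ge0// !mulr_ge0.
  by rewrite /lam; move: h; lra.
have lam0 : 0 < lam.
  by rewrite /lam divr_gt0// mulr_gt0//; [exact: lt_le_trans A1|exact: lt_le_trans smge1].
have p3 : pr P b3 <= 1 / 8.
  apply: (le_trans (word_sum_maximal dF B0 fB r0 rD mix 0 N lamD lam0)).
  rewrite ler_pdivrMr ?exprn_gt0//.
  have -> : lam ^+ 2 = A ^+ 2 * m%:R / 4.
    by rewrite /lam !exprMn sqr_sqrtr// exprVn -natrX.
  have hN : N%:R <= m%:R * K.+1%:R :> R.
    by rewrite -natrM ler_nat /N mulnS leq_add2r ltnW.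
  have h1 : N%:R * sq <= m%:R * K.+1%:R * sq by rewrite ler_wpM2r.
  have h2 : 64 * (K.+1%:R * sq) <= A by rewrite /A lerDr addr_ge0// mulr_ge0.
  have h3 : A <= A ^+ 2 by rewrite expr2 ler_peMr// (le_trans _ A1).
  have h4 : m%:R * (64 * (K.+1%:R * sq)) <= m%:R * A ^+ 2.
    by rewrite ler_wpM2l// (le_trans h2).
  by move: h1 h4; rewrite mulrCA -mulrA; lra.
apply: (le_trans (@pr_le_add3 _ _ _ P _ b1 b2 b3 _ _ _ _ _)).
- exact: (discrete_comp (fun y : R => A * Num.sqrt m%:R < `|y|) (discrete_W m)).
- exact: (discrete_comp (fun k => (K1 < k)%N) dT1).
- exact: (discrete_comp (fun y : R => m%:R * 1 < `|y - m%:R * mu|) (discrete_Lam m)).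
- exact: discrete_exit.
- apply: filterS renewal => w /(_ m) ren hW.
  rewrite /b1 /b2; case: ltnP => //= T1K; case: ltP => //= hL.
  apply/negPn/negP => nb3.
  have TN : (T1 w + total m w <= N)%N.
    rewrite leq_add//; rewrite -(ler_nat R) natrM -LamE.
    move: hL; rewrite mulr1 ler_norml => /andP[_ hL].
    have : m%:R * (mu + 1) <= m%:R * K%:R by rewrite ler_wpM2l.
    by move: hL; lra.
  have s1 := not_exit nb3 TN.
  have s2 := not_exit nb3 (leq_trans (leq_addr _ _) TN).
  have : `|W m w| < A * Num.sqrt m%:R.
    have -> : W m w = S_ (T1 w + total m w)%N w - S_ (T1 w) w by rewrite ren addrAC subrr add0r.
    rewrite (le_lt_trans (ler_normB _ _))//.
    have -> : A * Num.sqrt m%:R = lam + lam by rewrite /lam; lra.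
    exact: ltrD.
  by rewrite ltNge (ltW hW).
by have := hm1 m m1m; move: hK1 p3; rewrite -/(b1) -/(b2); lra.
Qed.

Lemma integ_block_sqr : integ P (fun w => G (U 0%N w) ^+ 2).
Proof. by have [A A0 [m0 h]] := block_sums_tight; exact: (integ_sqr_of_tight iidU A0 h). Qed.

Lemma integ_block : integ P (fun w => G (U 0%N w)).
Proof.
have i1 := integD (integ_cst P 1) integ_block_sqr.
apply: (integ_le _ _ i1).
  exact: discrete_measurable (discrete_iid iidU G 0).
move=> w; set y := G _; have := sqr_ge0 (`|y| - 1).
by rewrite sqrrB expr1n mulr1 real_normK ?num_real//; have := sqr_ge0 y; lra.
Qed.

Lemma mean_block : mean P (fun w => G (U 0%N w)) = 0.
Proof.
have [A A0 [m0 h]] := block_sums_tight.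
exact: (mean0_of_tight iidU A0 integ_block h).
Qed.

(** Number of blocks expected by time [n]. *)
Let m_ n := Num.truncn (n%:R / mu).

Let m_itv n : (m_ n)%:R * mu <= n%:R /\ n%:R < (m_ n)%:R * mu + mu.
Proof.
have h0 : 0 <= n%:R / mu by rewrite divr_ge0// ltW.
have /andP[h1 h2] := truncn_itv h0.
split; first by rewrite -ler_pdivlMr.
by rewrite -[X in _ + X]mul1r -mulrDl -ltr_pdivrMr// -natr1 in h2 *.
Qed.

Let word_sum_le a k w : `|word_sum F f a k w| <= B * k%:R.
Proof.
rewrite word_sum_bigE (le_trans (ler_norm_sum _ _ _))//.
apply: (@le_trans _ _ (\sum_(i < k) B)); first by apply: ler_sum => i _; exact: fB.
by rewrite sumr_const card_ord mulr_natr.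
Qed.

Let discrete_sum_block n m : discrete_rv (fun w => S_ n w - W m w).
Proof.
pose h (u : seq E) (v : seq S) := \sum_(x <- u) f x - \sum_(y <- v) G y.
have [dU _ _] := iidU.
have := discrete_map2 h (discrete_word dF 0 n) (discrete_mkseq m dU).
by congr discrete_rv; apply/funext => w; rewrite partial_sum_mkseq.
Qed.

Let sqrt_ge (c : R) n : 0 <= c -> c ^+ 2 <= n%:R -> c <= Num.sqrt n%:R.
Proof. by move=> c0 h; rewrite -[c]ger0_norm// -sqrtr_sqr ler_wsqrtr. Qed.

(** The end of block [m_ n] is likely to fall within [N], a small fraction of [n], of time [n]. Both
    times then lie in one deterministic window, over which the maximal inequality makes the sums
    small against [sqrt n]. *)
Lemma sum_block_close (e : R) : 0 < e -> exists n0, forall n, (n0 <= n)%N ->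
  pr P (fun w => e * Num.sqrt n%:R < `|S_ n w - W (m_ n) w|) <= e.
Proof.
move=> e0; have e4 : 0 < e / 4 by rewrite divr_gt0.
(* A window of length at most [6 n del] has exit bound [12 n del sq / lam ^+ 2], to be at most
   [e / 2] with [lam ^+ 2 = e ^+ 2 n / 9]; this gives 216. Adding 1 to [sq] avoids dividing by 0. *)
pose del := e ^+ 3 / (216 * (sq + 1)).
have sq1 : 0 < sq + 1 by rewrite ltr_wpDl.
have del0 : 0 < del.
  by apply: divr_gt0; [exact: exprn_gt0|apply: mulr_gt0; [exact: ltr0Sn|exact: sq1]].
have md0 : 0 < mu * del by rewrite mulr_gt0.
have [K1 hK1] := pr_tail_nat P dT1 e4.
have [m1 hm1] := @wlln _ _ _ P _ _ iidU (fun s => (len s)%:R) _ _ iL md0 e4.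
have [n1 hn1] := ex_nat_ge (mu * m1.+1%:R).
have [n2 hn2] := ex_nat_ge ((1 + mu + K1%:R) / del).
have [n3 hn3] := ex_nat_ge ((12 * D / e) ^+ 2).
have [n4 hn4] := ex_nat_ge ((3 * (B * K1%:R) / e) ^+ 2).
exists (maxn (maxn n1 n2) (maxn n3 (maxn n4 1))) => n.
rewrite !geq_max -!andbA => /and5P[/hn1 h1 /hn2 h2 /hn3 h3 /hn4 h4 np].
set m := m_ n; have [mn nm] := m_itv n; rewrite -/m in mn nm.
have m1m : (m1 <= m)%N.
  rewrite -ltnS -(ltr_nat R) -(ltr_pM2l mu0) -natr1.
  have : mu * m1%:R < mu * m1.+1%:R by rewrite ltr_pM2l// ltr_nat.
  by move: nm; lra.
have nR : 1 <= n%:R :> R by rewrite ler1n.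
have sn0 : 0 < Num.sqrt n%:R :> R by rewrite sqrtr_gt0 (lt_le_trans ltr01).
have sn2 : Num.sqrt n%:R ^+ 2 = n%:R :> R by rewrite sqr_sqrtr.
pose lam := e * Num.sqrt n%:R / 3.
have lam0 : 0 < lam by rewrite divr_gt0// mulr_gt0.
have lamD : 4 * D <= lam.
  have := sqrt_ge (divr_ge0 (mulr_ge0 (ler0n _ 12) D0) (ltW e0)) h3.
  by rewrite ler_pdivrMr// /lam; lra.
have BK : B * K1%:R <= e * Num.sqrt n%:R / 3.
  have h0 : 0 <= 3 * (B * K1%:R) / e by rewrite divr_ge0 ?(ltW e0)// mulr_ge0// mulr_ge0.
  by have := sqrt_ge h0 h4; rewrite ler_pdivrMr//; lra.
have ndel : 1 + mu + K1%:R <= n%:R * del by rewrite -ler_pdivrMr.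
(* The delay, the rounding in [m_ n] and the truncation here cost at most [n * del] together, the
   fluctuation of the lengths another [n * del]. *)
pose N := Num.truncn (3 * (n%:R * del)).
have /andP[N1 N2] : N%:R <= 3 * (n%:R * del) < N.+1%:R.
  by apply: truncn_itv; rewrite mulr_ge0// mulr_ge0// ltW.
rewrite -natr1 in N2.
pose a := (n - N)%N.
pose b1 w := (K1 < T1 w)%N.
pose b2 w := m%:R * (mu * del) < `|Lam m w - m%:R * mu|.
pose b3 w := has (fun j => lam <= `|word_sum F f a j w|) (iota 0 (N + N).+1).
have p3 : pr P b3 <= e / 2.
  apply: (le_trans (word_sum_maximal dF B0 fB r0 rD mix a (N + N) lamD lam0)).
  rewrite ler_pdivrMr ?exprn_gt0//.
  have -> : lam ^+ 2 = e ^+ 2 * n%:R / 9.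
    by rewrite /lam !exprMn sn2 exprVn -natrX.
  have hd : del * (sq + 1) = e ^+ 3 / 216 by rewrite /del; field; exact: lt0r_neq0.
  have hd' : del * sq <= e ^+ 3 / 216 by rewrite -hd ler_wpM2l ?(ltW del0)// lerDl.
  have h5 : N%:R * sq <= 3 * (n%:R * del) * sq by rewrite ler_wpM2r.
  have h6 : n%:R * (del * sq) <= n%:R * (e ^+ 3 / 216) by rewrite ler_wpM2l.
  have -> : e / 2 * (e ^+ 2 * n%:R / 9) = 12 * (n%:R * (e ^+ 3 / 216)) by field.
  have h7 : 3 * (n%:R * del) * sq = 3 * (n%:R * (del * sq)) by ring.
  by rewrite natrD; move: h5 h6; rewrite h7; lra.
apply: (le_trans (@pr_le_add3 _ _ _ P _ b1 b2 b3 _ _ _ _ _)).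
- exact: (discrete_comp (fun y => e * Num.sqrt n%:R < `|y|) (discrete_sum_block n m)).
- exact: (discrete_comp (fun k => (K1 < k)%N) dT1).
- exact: (discrete_comp (fun y : R => m%:R * (mu * del) < `|y - m%:R * mu|) (discrete_Lam m)).
- exact: discrete_exit.
- apply: filterS renewal => w /(_ m) ren hW.
  rewrite /b1 /b2; case: ltnP => //= T1K; case: ltP => //= hL.
  apply/negPn/negP => nb3.
  pose t := (T1 w + total m w)%N.
  have tR : t%:R = (T1 w)%:R + Lam m w by rewrite /t natrD LamE.
  have hmd : m%:R * (mu * del) <= n%:R * del by rewrite mulrA ler_wpM2r// ltW.
  move: hL; rewrite ler_norml => /andP[hL1 hL2].
  have T1R : (T1 w)%:R <= K1%:R :> R by rewrite ler_nat.
  have T10 : 0 <= (T1 w)%:R :> R by [].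
  have K10 : 0 <= K1%:R :> R by [].
  have tn : (t <= n + N)%N by rewrite -(ler_nat R) natrD tR; lra.
  have nt : (n <= t + N)%N by rewrite -(ler_nat R) natrD tR; lra.
  have [ta na wt wn] := window_subn tn nt; rewrite -/a in ta na wt wn.
  have s1 : `|word_sum F f a (t - a) w| < lam := not_exit nb3 wt.
  have s2 : `|word_sum F f a (n - a) w| < lam := not_exit nb3 wn.
  have s3 : `|S_ (T1 w) w| <= B * K1%:R.
    by rewrite (le_trans (word_sum_le _ _ _))// ler_wpM2l.
  have eW : W m w = S_ t w - S_ (T1 w) w by rewrite ren addrAC subrr add0r.
  have eT : S_ t w = S_ a w + word_sum F f a (t - a) w by rewrite -{1}ta word_sumD.
  have eN : S_ n w = S_ a w + word_sum F f a (n - a) w by rewrite -{1}na word_sumD.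
  move: hW; rewrite eW eT eN; move: s1 s2 s3.
  set x1 := word_sum _ _ _ _ _; set x2 := word_sum _ _ _ _ _; set x3 := S_ (T1 w) w.
  set x4 := S_ a w => s1 s2 s3.
  have -> : x4 + x2 - (x4 + x1 - x3) = x2 - x1 + x3 by ring.
  have := ler_normD (x2 - x1) x3; have := ler_normB x2 x1.
  by move: s1 s2 s3 BK; rewrite /lam; lra.
by have := hm1 m m1m; move: hK1 p3; rewrite -/(b1) -/(b2); lra.
Qed.

Local Notation V := (mean P (fun w => G (U 0%N w) ^+ 2)).
Local Notation sigma := (Num.sqrt (V / mu)).

Let V0 : 0 <= V. Proof. by apply: mean_ge0 => w; exact: sqr_ge0. Qed.

(** The Gaussian steps are [sg / sqrt m], so that [m] of them give exactly the limit law. Blocks are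
    scaled by [1 / sqrt n]; the gap between [m] and [n / mu] becomes a variance mismatch. *)
Lemma block_clt (u u1 u2 : R -> R) C : taylor2 u u1 u2 C ->
  mean P (fun w => u ((Num.sqrt n%:R)^-1 * W (m_ n) w)) @[n --> \oo] --> mean (gauss 0 sigma) u.
Proof.
move=> tu; have C0 := taylor2_ge0 tu.
pose c (n : nat) : R := (Num.sqrt n%:R)^-1.
have c0 n : 0 <= c n by rewrite invr_ge0 sqrtr_ge0.
have cc : c n @[n --> \oo] --> 0 := @inv_sqrt_cvg R.
have dY := discrete_measurable (discrete_iid iidU G 0).
have tail := lindeberg_tail_cvg c0 cc dY integ_block_sqr.
set tl := (fun n => lindeberg_tail _ _ _) in tail.
have s20 : 0 <= V / mu by rewrite divr_ge0// ltW.
set sg := sigma.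
have sg2 : sg ^+ 2 = V / mu by rewrite sqr_sqrtr.
have sg0 : 0 <= sg by exact: sqrtr_ge0.
pose a1 := 4 * C / mu; pose a2 := C * V / 2.
pose a3 := C * (54 * expR (1 / 2)) * (sg ^+ 3 * Num.sqrt (2 * mu)).
(* Lindeberg tail, total variance mismatch of at most [V / n], and third-order Gaussian error of
   order [1 / sqrt m], where [m * mu >= n / 2] is used. *)
pose b n := a1 * tl n + a2 * (c n * c n) + a3 * c n.
have bc : b n @[n --> \oo] --> 0.
  have -> : (0 : R) = a1 * 0 + a2 * (0 * 0) + a3 * 0 by ring.
  apply: cvgD; last exact: cvgMr.
  by apply: cvgD; [exact: cvgMr|apply: cvgMr; exact: cvgM].
have [n0 hn0] := ex_nat_ge (2 * mu).
have key n : (maxn n0 1 <= n)%N ->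
    `|mean P (fun w => u (c n * W (m_ n) w)) - mean (gauss 0 sg) u| <= b n.
  rewrite geq_max => /andP[/hn0 h1 np].
  have nR : 1 <= n%:R :> R by rewrite ler1n.
  have nR0 : 0 < n%:R :> R by exact: lt_le_trans nR.
  have cn2 : c n ^+ 2 * n%:R = 1.
    by rewrite exprVn sqr_sqrtr ?ler0n// mulVf// gt_eqF.
  set m := m_ n; have [mn nm] := m_itv n; rewrite -/m in mn nm.
  have mR0 : 0 < m%:R :> R.
    by rewrite -(pmulr_lgt0 _ mu0); move: h1 nm mu0; lra.
  pose q := (Num.sqrt m%:R)^-1 : R.
  have sm0 : 0 < Num.sqrt m%:R :> R by rewrite sqrtr_gt0.
  have q0 : 0 <= q by rewrite invr_ge0 ltW.
  have qs : Num.sqrt m%:R * q = 1 by rewrite mulfV// gt_eqF.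
  have q2 : m%:R * q ^+ 2 = 1 by rewrite -[m%:R]sqr_sqrtr ?ler0n// -exprMn qs expr1n.
  have h := @lindeberg _ _ _ P _ U iidU G u u1 u2 C (c n) (sg * q) m 0 (c0 n)
    (mulr_ge0 sg0 q0) integ_block integ_block_sqr mean_block tu.
  rewrite (_ : Num.sqrt m%:R * (sg * q) = sg) in h; last by rewrite mulrCA qs mulr1.
  rewrite (eq_mean P (Z := fun w => u (c n * W m w))) in h; last by move=> w; rewrite add0r.
  apply: (le_trans h).
  have t0 : 0 <= tl n.
    apply: mean_ge0 => w.
    by have /andP[] := lindeberg_tail_bound (G (U 0%N w)) (c0 n).
  have mc : m%:R * c n ^+ 2 <= mu^-1.
    rewrite -(ler_pM2r mu0) mulVf ?gt_eqF// -[leRHS]cn2.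
    rewrite (_ : m%:R * c n ^+ 2 * mu = c n ^+ 2 * (m%:R * mu)); last by ring.
    by rewrite ler_wpM2l ?sqr_ge0.
  have mc' : mu^-1 <= m%:R * c n ^+ 2 + c n ^+ 2.
    rewrite -(ler_pM2r mu0) mulVf ?gt_eqF// -[leLHS]cn2.
    rewrite (_ : _ * mu = c n ^+ 2 * (m%:R * mu + mu)); last by ring.
    by rewrite ler_wpM2l ?sqr_ge0// ltW.
  rewrite !mulrDr /b lerD//; first rewrite lerD//.
  - rewrite (_ : m%:R * _ = 4 * C * tl n * (m%:R * c n ^+ 2)); last by rewrite /tl; ring.
    rewrite /a1 (_ : 4 * C / mu * tl n = 4 * C * tl n * mu^-1); last by ring.
    by apply: ler_wpM2l => //; apply: mulr_ge0 => //; rewrite mulr_ge0.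
  - have e1 : m%:R * `|c n ^+ 2 * V - (sg * q) ^+ 2| = V * (mu^-1 - m%:R * c n ^+ 2).
      rewrite -[X in X * `|_|](gtr0_norm mR0) -normrM.
      rewrite (_ : m%:R * _ = - (V * (mu^-1 - m%:R * c n ^+ 2))).
        by rewrite normrN ger0_norm// mulr_ge0// subr_ge0.
      by rewrite exprMn sg2 mulrBr [_ * (V / mu * _)]mulrCA q2 mulr1; ring.
    rewrite (_ : m%:R * _ = C / 2 * (m%:R * `|c n ^+ 2 * V - (sg * q) ^+ 2|)); last by ring.
    rewrite e1 /a2 (_ : C * V / 2 * (c n * c n) = C / 2 * (V * c n ^+ 2)); last by ring.
    apply: ler_wpM2l; first by rewrite divr_ge0.
    by apply: ler_wpM2l => //; move: mc'; lra.
  - rewrite (_ : m%:R * _ = C * (54 * expR (1 / 2)) * sg ^+ 3 * q * (m%:R * q ^+ 2)); last by ring.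
    rewrite q2 mulr1 /a3.
    rewrite (_ : _ * _ * c n = C * (54 * expR (1 / 2)) * sg ^+ 3 * (Num.sqrt (2 * mu) * c n)); last by ring.
    apply: ler_wpM2l.
      by apply: mulr_ge0; [rewrite mulr_ge0// mulr_ge0// expR_ge0|exact: exprn_ge0].
    rewrite -[leLHS](ger0_norm q0) -sqrtr_sqr -[leRHS]ger0_norm ?mulr_ge0 ?sqrtr_ge0//.
    rewrite -sqrtr_sqr ler_wsqrtr// exprMn sqr_sqrtr; last by rewrite mulr_ge0// ltW.
    rewrite -(ler_pM2l mR0) q2 -[leLHS]cn2.
    rewrite (_ : m%:R * _ = c n ^+ 2 * (2 * (m%:R * mu))); last by ring.
    by rewrite ler_wpM2l ?sqr_ge0//; move: nm h1; lra.
apply/cvgrPdist_le => e e0.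
have /cvgrPdist_le/(_ _ e0)[n1 _ hn1] := bc.
exists (maxn n1 (maxn n0 1)) => // n /=; rewrite geq_max => /andP[/hn1 /= h2 h3].
rewrite distrC (le_trans (key n h3))// (le_trans (ler_norm _))//.
by rewrite -normrN -[- b n]sub0r.
Qed.

(** Only an inequality, since at [n = 0] the inverse of 0 is 0. *)
Let inv_sqrt_sqr n : (Num.sqrt n%:R)^-1 ^+ 2 * n%:R <= 1 :> R.
Proof.
case: n => [|n]; first by rewrite mulr0.
by rewrite exprVn sqr_sqrtr// mulVf// pnatr_eq0.
Qed.

Let discrete_sum n : discrete_rv (fun w => S_ n w).
Proof. exact: (discrete_comp (fun v => \sum_(x <- v) f x) (discrete_word dF 0 n)). Qed.

Lemma sum_clt_taylor (u u1 u2 : R -> R) C : taylor2 u u1 u2 C ->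
  mean P (fun w => u ((Num.sqrt n%:R)^-1 * S_ n w)) @[n --> \oo] --> mean (gauss 0 sigma) u.
Proof.
move=> tu; have C0 := taylor2_ge0 tu; have mu' := taylor2_measurable tu.
have uC z : `|u z| <= C by have [] := tu.1 z.
pose c (n : nat) : R := (Num.sqrt n%:R)^-1.
have c0 n : 0 <= c n by rewrite invr_ge0 sqrtr_ge0.
have clt := block_clt tu.
apply/cvgrPdist_le => e e0.
have e2 : 0 < e / 2 by rewrite divr_gt0.
(* The 5 is 3 for the increment of [u] over a distance [del <= 1], plus 2 for the exceptional event
   of probability at most [del]. *)
pose del := Num.min 1 (e / 2 / (5 * (C + 1))).
have C1 : 0 < 5 * (C + 1) by rewrite mulr_gt0// ltr_wpDl.
have del0 : 0 < del by rewrite lt_min ltr01 divr_gt0.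
have del1 : del <= 1 by rewrite ge_min lexx.
have delC : del * (5 * (C + 1)) <= e / 2 by rewrite -ler_pdivlMr// ge_min lexx orbT.
have [n0 hn0] := sum_block_close del0.
have /cvgrPdist_le/(_ _ e2)[n1 _ hn1] := clt.
exists (maxn n0 n1) => // n /=; rewrite geq_max => /andP[/hn0 h0 /hn1 /= h1].
pose b w := del * Num.sqrt n%:R < `|S_ n w - W (m_ n) w|.
have db : discrete_rv b.
  exact: (discrete_comp (fun y => del * Num.sqrt n%:R < `|y|) (discrete_sum_block n (m_ n))).
have bS : bounded_rv (fun w => u (c n * S_ n w)).
  apply: (bounded_discrete (M := C)) => [|w]; last exact: uC.
  exact: (discrete_comp (fun y => u (c n * y)) (discrete_sum n)).
have bW : bounded_rv (fun w => u (c n * W (m_ n) w)).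
  apply: (bounded_discrete (M := C)) => [|w]; last exact: uC.
  exact: (discrete_comp (fun y => u (c n * y)) (discrete_W (m_ n))).
have near_b w : ~~ b w -> `|u (c n * S_ n w) - u (c n * W (m_ n) w)| <= 3 * C * del.
  rewrite /b -leNgt => hb.
  pose y := c n * (S_ n w - W (m_ n) w).
  have -> : c n * S_ n w = c n * W (m_ n) w + y by rewrite /y; ring.
  have y1 : `|y| <= del.
    rewrite normrM (ger0_norm (c0 n)) (le_trans (ler_wpM2l (c0 n) hb))//.
    rewrite mulrCA -[leRHS]mulr1 ler_wpM2l ?(ltW del0)// /c.
    by have [->|h] := eqVneq (Num.sqrt n%:R : R) 0; rewrite ?mulr0// mulVf.
  apply: (le_trans (taylor2_lip _ _ tu)).
  have y2 : `|y| ^+ 2 <= del.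
    by rewrite expr2 (le_trans (ler_wpM2r _ y1))// ler_piMr ?(ltW del0)// (le_trans y1).
  have y3 : `|y| ^+ 3 <= del.
    by rewrite exprS (le_trans (ler_wpM2r _ y1)) ?sqr_ge0// ler_piMr ?(ltW del0)// (le_trans y2).
  rewrite (_ : 3 * C * del = C * (del + del + del)); last by ring.
  by apply: ler_wpM2l => //; apply: lerD => //; exact: lerD.
have far w : `|u (c n * S_ n w) - u (c n * W (m_ n) w)| <= 2 * C.
  by rewrite (le_trans (ler_normB _ _))// mulr2n mulrDl mul1r lerD.
have h3 : 0 <= 3 * C * del by rewrite mulr_ge0 ?(ltW del0)// mulr_ge0.
have h2 : 0 <= 2 * C by rewrite mulr_ge0.
have := @mean_diff_le _ _ _ P _ _ _ _ b bS bW db h2 h3 near_b far.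
move: h0; rewrite -/b => h0.
have h4 : 2 * C * pr P b <= 2 * C * del by rewrite ler_wpM2l.
move: h1; rewrite -/(c n).
set x1 := mean (gauss _ _) _; set x2 := mean P _; set x3 := mean P _ => h1 h5.
have := ler_normD (x1 - x2) (x2 - x3).
rewrite (_ : x1 - x2 + (x2 - x3) = x1 - x3); last by ring.
rewrite [`|x2 - x3|]distrC.
have h6 : 3 * C * del + 2 * C * del <= e / 2.
  apply: le_trans delC; rewrite (_ : _ + _ = del * (5 * C)); last by ring.
  by rewrite ler_wpM2l ?(ltW del0)//; lra.
by move: h1 h5 h4 h6; lra.
Qed.

Let sum_sqr_le n : mean P (fun w => ((Num.sqrt n%:R)^-1 * S_ n w) ^+ 2) <= sq.
Proof.
have iS := bounded_integ P (boundedX 2 (bounded_word_sum f dF 0 n)).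
rewrite (eq_mean P (Z := fun w => (Num.sqrt n%:R)^-1 ^+ 2 * S_ n w ^+ 2)); last first.
  by move=> w; rewrite exprMn.
rewrite (meanZ _ iS).
apply: (le_trans (ler_wpM2l (sqr_ge0 _) (mean_sqr_word_sum dF B0 fB r0 rD mix 0 n))).
by rewrite mulrA -[leRHS]mul1r ler_wpM2r.
Qed.

Let sigma2_ge0 : 0 <= V / mu. Proof. by rewrite divr_ge0// ltW. Qed.

Lemma sum_clt (h : R -> R) : continuous h -> (exists M : R, forall x, `|h x| <= M) ->
  mean P (fun w => h ((Num.sqrt n%:R)^-1 * S_ n w)) @[n --> \oo] --> mean (gauss 0 sigma) h.
Proof.
have [i2 m2] := gauss_sqr (sqrtr_ge0 (V / mu)).
apply: (weak_convergence (Yn := fun n w => (Num.sqrt n%:R)^-1 * S_ n w)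
  (V := Num.max sq (sigma ^+ 2))) => //.
- by move=> n; exact: (discrete_comp (fun y => (Num.sqrt n%:R)^-1 * y) (discrete_sum n)).
- move=> n; apply: bounded_integ; apply: boundedX; apply: boundedZ.
  exact: bounded_word_sum.
- by move=> n; rewrite le_max sum_sqr_le.
- by rewrite m2 le_max lexx orbT.
- exact: sum_clt_taylor.
Qed.

(** The truncated squares [h K] are bounded and continuous, so [sum_clt] applies to them. As
    [K (x^2 - h K x) <= x^4], the fourth moment makes the truncation error at most [q / K],
    uniformly in [n]. *)
Lemma sum_sqr_cvg :
  mean P (fun w => ((Num.sqrt n%:R)^-1 * S_ n w) ^+ 2) @[n --> \oo] --> V / mu.
Proof.
have [i2 m2] := gauss_sqr (sqrtr_ge0 (V / mu)).
rewrite sqr_sqrtr// in m2.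
pose h (K : nat) (x : R) := Num.min (x ^+ 2) K%:R.
have ch K : continuous (h K).
  move=> x; apply: (@continuous_min R R (fun x => x ^+ 2) (fun=> K%:R)).
    exact: exprn_continuous.
  exact: cst_continuous.
have h0 K x : 0 <= h K x by rewrite le_min sqr_ge0/=.
have hK K x : `|h K x| <= K%:R by rewrite (ger0_norm (h0 K x)) ge_min lexx orbT.
have hx K x : h K x <= x ^+ 2 by rewrite ge_min lexx.
have mh K : measurable_fun setT (h K) by apply: continuous_measurable_fun; exact: ch.
have gh : mean (gauss 0 sigma) (h K) @[K --> \oo] --> V / mu.
  have ms : measurable_fun setT (fun z : R => z ^+ 2).
    by apply: continuous_measurable_fun; exact: exprn_continuous.
  have hs K x : `|h K x| <= x ^+ 2 by rewrite (ger0_norm (h0 K x)).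
  have hc x : h K x @[K --> \oo] --> x ^+ 2.
    apply: cvg_near_cst; have [n0 hn0] := ex_nat_ge (x ^+ 2).
    by exists n0 => // n /= /hn0 h1; rewrite /h min_l.
  rewrite -[X in _ --> X]m2.
  exact: (@cvg_mean _ _ _ (gauss 0 sigma) h (fun z => z ^+ 2) (fun z => z ^+ 2) mh ms i2 hs hc).
pose q := quart_const B D; have q0 : 0 <= q  := quart_const0 B0 rD.
apply/cvgrPdist_le => e e0; have e3 : 0 < e / 3 by rewrite divr_gt0.
have /cvgrPdist_le/(_ _ e3)[K0 _ hK0] := gh.
have [K1 hK1] := ex_nat_ge (q / (e / 3)).
pose K := maxn K0 K1.+1.
have {}hK0 := hK0 K (leq_maxl _ _); rewrite /= in hK0.
have {}hK1 : q / (e / 3) <= K%:R by apply: hK1; rewrite (leq_trans (leqnSn _))// leq_maxr.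
have Kp : 0 < K%:R :> R by rewrite ltr0n (leq_trans _ (leq_maxr _ _)).
have /cvgrPdist_le/(_ _ e3)[n0 _ hn0] := sum_clt (ch K) (ex_intro _ _ (hK K)).
exists n0 => // n /hn0 /= h1.
pose Y w := (Num.sqrt n%:R)^-1 * S_ n w.
have bY : bounded_rv Y by apply: boundedZ; exact: bounded_word_sum.
have iY2 := bounded_integ P (boundedX 2 bY).
have iY4 := bounded_integ P (boundedX 4 bY).
have bh : bounded_rv (fun w => h K (Y w)).
  apply: (bounded_discrete (M := K%:R)) => [|w]; last exact: hK.
  exact: (discrete_comp (fun y => h K ((Num.sqrt n%:R)^-1 * y)) (discrete_sum n)).
have ih := bounded_integ P bh.
have Y4 : mean P (fun w => Y w ^+ 4) <= q.
  have iS := bounded_integ P (boundedX 4 (bounded_word_sum f dF 0 n)).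
  rewrite (eq_mean P (Z := fun w => (Num.sqrt n%:R)^-1 ^+ 4 * S_ n w ^+ 4)); last first.
    by move=> w; rewrite exprMn.
  rewrite (meanZ _ iS).
  have c4 : 0 <= (Num.sqrt n%:R)^-1 ^+ 4 :> R by rewrite exprn_ge0// invr_ge0 sqrtr_ge0.
  apply: (le_trans (ler_wpM2l c4 (mean_quart_word_sum dF B0 fB r0 rD mix 0 n))).
  have regroup (i p k : R) : i ^+ 4 * (p * k ^+ 2) = p * (i ^+ 2 * k) ^+ 2 by ring.
  rewrite -/q regroup.
  rewrite -[leRHS]mulr1; apply: ler_wpM2l; first exact: q0.
  apply: exprn_ile1; last exact: inv_sqrt_sqr.
  by apply: mulr_ge0; [exact: sqr_ge0|exact: ler0n].
have dl : 0 <= mean P (fun w => Y w ^+ 2) - mean P (fun w => h K (Y w)).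
  by rewrite subr_ge0; apply: ler_mean.
have du : mean P (fun w => Y w ^+ 2) - mean P (fun w => h K (Y w)) <= e / 3.
  have : mean P (fun w => K%:R * (Y w ^+ 2 - h K (Y w))) <= mean P (fun w => Y w ^+ 4).
    apply: ler_mean => // [|w]; first exact/integZ/integB.
    rewrite /h; case: (leP (Y w ^+ 2) K%:R) => hy.
      by rewrite subrr mulr0 exprn_even_ge0.
    rewrite (_ : Y w ^+ 4 = Y w ^+ 2 * Y w ^+ 2); last by ring.
    by move: hy Kp; set x := Y w ^+ 2 => hy Kp; nra.
  rewrite (meanZ _ (integB iY2 ih)) (meanB iY2 ih) => h2.
  have h3 : K%:R * (e / 3) >= q by rewrite -ler_pdivrMr.
  by rewrite -(ler_pM2l Kp) (le_trans h2)// (le_trans Y4).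
rewrite -[X in _ - X]/(mean P (fun w => Y w ^+ 2)).
move: hK0 h1 dl du; rewrite -[X in _ - X <= _ -> _]/(mean P (fun w => h K (Y w))).
set x1 := mean P (fun w => Y w ^+ 2); set x2 := mean P (fun w => h K (Y w)).
set x3 := mean (gauss _ _) _ => h2 h3 h4 h5.
have := ler_normD (V / mu - x3) (x3 - x2).
have := ler_normD ((V / mu - x3) + (x3 - x2)) (x2 - x1).
rewrite (_ : _ + _ + (x2 - x1) = V / mu - x1); last by ring.
have -> : `|x2 - x1| = x1 - x2 by rewrite distrC; exact: (ger0_norm h4).
by move: h2 h3 h5; lra.
Qed.

End renewal_reward.

(** * Covariances *)

Section covariances.
Context {d : measure_display} {T : measurableType d} {R : realType}.
Variable P : probability T R.
Context {E : finType}.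
Variables (F : nat -> T -> E) (f : E -> R) (B D : R) (r : nat -> R).
Hypothesis dF : forall i, discrete_rv (F i).
Hypothesis B0 : 0 <= B.
Hypothesis fB : forall x, `|f x| <= B.
Hypothesis r0 : forall j, 0 <= r j.
Hypothesis rD : forall n, \sum_(j < n) r j <= D.
Hypothesis mix : forall a k j (z : seq E -> R),
  `|mean P (fun w => z (word F a k w) * f (F (a + k + j)%N w))| <=
  r j * mean P (fun w => `|z (word F a k w)|).

Definition cov j := mean P (fun w => f (F 0%N w) * f (F j w)).
Hypothesis stationary : forall i j, mean P (fun w => f (F i w) * f (F (i + j)%N w)) = cov j.

(** The new letter meets the earlier ones at distances 1 to [n], so the mean square grows by a
    partial sum of the covariance series. *)
Lemma mean_sqr_sumS n : mean P (fun w => word_sum F f 0 n.+1 w ^+ 2) =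
  mean P (fun w => word_sum F f 0 n w ^+ 2) + (cov 0 + 2 * \sum_(i < n) cov i.+1).
Proof.
pose S w := word_sum F f 0 n w; pose y i w := f (F i w).
have by' i : bounded_rv (y i) := bounded_letter dF fB i.
have bS : bounded_rv S := bounded_word_sum f dF 0 n.
have iS := bounded_integ P (boundedX 2 bS).
have iSy := bounded_integ P (boundedM bS (by' n)).
have iy := bounded_integ P (boundedX 2 (by' n)).
have iyy i := bounded_integ P (boundedM (by' i) (by' n)).
have -> : mean P (fun w => word_sum F f 0 n.+1 w ^+ 2) =
    mean P (fun w => S w ^+ 2) + (mean P (fun w => y n w ^+ 2) + 2 * mean P (fun w => S w * y n w)).
  rewrite -(meanZ 2 iSy) -(meanD iy (integZ 2 iSy)) -(meanD iS (integD iy (integZ 2 iSy))).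
  by apply: eq_mean => w; rewrite word_sumS add0n /S /y; ring.
congr (_ + (_ + 2 * _)).
  by rewrite -(stationary n 0); apply: eq_mean => w; rewrite addn0 expr2.
transitivity (\sum_(i < n) mean P (fun w => y i w * y n w)).
  rewrite -mean_sum; last by move=> i _; exact: iyy.
  apply: eq_mean => w.
  by rewrite /S word_sum_bigE mulr_suml; apply: eq_bigr => i _; rewrite add0n.
rewrite (reindex_inj rev_ord_inj)/=; apply: eq_bigr => i _.
by rewrite -(stationary (n - i.+1)); apply: eq_mean => w; rewrite /y subnK.
Qed.

Lemma cov_le j : `|cov j.+1| <= B * r j.
Proof.
have := mix 0 1 j (fun v => \sum_(x <- v) f x).
rewrite (eq_mean P (Z := fun w => f (F 0%N w) * f (F j.+1 w))); last first.
  by move=> w; rewrite -/(word_sum F f 0 1 w) word_sum1.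
move=> h; rewrite /cov (le_trans h)// mulrC ler_wpM2r//.
apply: mean_le_cst => [|w].
  exact/integ_norm/bounded_integ/(bounded_word_sum f dF 0 1).
by rewrite -/(word_sum F f 0 1 w) word_sum1.
Qed.

Lemma cov_summable : cvgn (series (fun j => cov j.+1)).
Proof.
apply: normed_cvg; apply: (@series_le_cvg _ _ (fun j => B * r j)).
- by move=> n; exact: normr_ge0.
- by move=> n; rewrite mulr_ge0.
- exact: cov_le.
apply: nondecreasing_is_cvgn.
  apply/nondecreasing_seqP => n; rewrite /series/= big_nat_recr//= lerDl mulr_ge0//.
exists (B * D) => _ [n _ <-]; rewrite /series/= -mulr_sumr ler_wpM2l//.
by rewrite big_mkord.
Qed.

(** The increments of [mean_sqr_sumS] make the normalized mean square an arithmetic mean of the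
    sequence [b]. The shift to [n.+1] avoids dividing by 0. *)
Lemma mean_sqr_sum_cvg :
  mean P (fun w => ((Num.sqrt n%:R)^-1 * word_sum F f 0 n w) ^+ 2) @[n --> \oo] -->
  cov 0 + 2 * limn (series (fun j => cov j.+1)).
Proof.
pose b n := cov 0 + 2 * series (fun j => cov j.+1) n.
have cb : b n @[n --> \oo] --> cov 0 + 2 * limn (series (fun j => cov j.+1)).
  by apply: cvgD; [exact: cvg_cst|apply: cvgMr; exact: cov_summable].
rewrite -cvg_shiftS/=; apply: cvg_trans (cesaro cb).
apply: near_eq_cvg; apply: nearW => n; rewrite /arithmetic_mean/=.
have bS := boundedX 2 (bounded_word_sum f dF 0 n.+1).
rewrite (eq_mean P (Z := fun w => (Num.sqrt n.+1%:R)^-1 ^+ 2 * word_sum F f 0 n.+1 w ^+ 2)); last first.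
  by move=> w; rewrite exprMn.
rewrite (meanZ _ (bounded_integ P bS)) exprVn sqr_sqrtr//; congr (_ * _).
elim: (n.+1) => [|k ih].
  rewrite /series/= big_geq// -(mean_cst P 0); apply: eq_mean => w.
  by rewrite word_sum0 expr0n.
rewrite mean_sqr_sumS -ih /series/= big_nat_recr//=; congr (_ + _).
by rewrite /b /series/= big_mkord.
Qed.

End covariances.

(** Needed for [tau 2 - tau 1], which is a block length only where the times are ordered. *)
Lemma expectation_ae_eq d (T : measurableType d) (R : realType) (P : probability T R)
    (Y Z : T -> R) : measurable_fun setT Y -> integ P Z -> {ae P, forall w, Y w = Z w} ->
  ('E_P[Y] = (mean P Z)%:E)%E.
Proof.
move=> mY iZ YZ; rewrite -(expectation_mean iZ) unlock.
apply: ae_eq_integral => //; first exact/measurable_EFinP.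
  exact: measurable_int iZ.
by apply: filterS YZ => w -> _.
Qed.

Theorem theorem2 (R : realType) (E : pointedFinType) (g : E -> Past E -> R)
    (d : measure_display) (T : measurableType d) (P : probability T R)
    (X : {RV P >-> Omega E}) (tau : int -> T -> int) (f : E -> R)
    (hreg : regular_g g)
    (hprod : 0 < limn (fun n => \prod_(k < n) g_coef g k))
    (hX : g_chain g X)
    (htau : regeneration_process g X tau)
    (hf : ('E_P[(fun w => f (X w 0))%R] = 0)%E) :
  let sigma2 : \bar R :=
    ('E_P[(fun w => block_sum f X tau 1 w ^+ 2)%R] /
     'E_P[(fun w => (tau 2 w - tau 1 w)%:~R)%R])%E in
  [/\ (0 <= sigma2 < +oo)%E,
      cvg_in_distribution P
        (fun n w => (Num.sqrt n%:R)^-1 * \sum_(0 <= i < n) f (X w i%:Z))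
        (centered_normal (fine sigma2))
    & ('E_P[(fun w => (tau 2 w - tau 1 w)%:~R ^+ 2)%R] < +oo)%E ->
      cvgn (fun n => \sum_(1 <= i < n)
                       'E_P[(fun w => f (X w 0) * f (X w i%:Z))%R])%E /\
      (sigma2 = 'E_P[(fun w => f (X w 0) ^+ 2)%R] +
                2%:E * \sum_(1 <= i <oo)
                         'E_P[(fun w => f (X w 0) * f (X w i%:Z))%R])%E].
Proof.
have [gg _ _] := hreg.
have dX i : discrete_rv (fun w => X w i) := @discrete_X _ _ _ _ P X i.
have dF i : discrete_rv (letter X i) := @discrete_letter _ _ _ _ P X i.
pose B := \sum_(x : E) `|f x|.
have fB x : `|f x| <= B by rewrite /B (bigD1 x)//= lerDl sumr_ge0.
have B0 : 0 <= B by exact: sumr_ge0.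
have fC x y : `|f x - f y| <= 2 * B.
  by rewrite (le_trans (ler_normB _ _))// mulr2n mulrDl mul1r lerD.
have bf i : bounded_rv (fun w => f (X w i)).
  by apply: (bounded_discrete (M := B)) => [|w]; [exact: (discrete_comp f (dX i))|exact: fB].
have bfQ : bounded_rv (fun w : Omega E => f (w 0)).
  apply: (bounded_discrete (M := B)) => [|w]; last exact: fB.
  exact: (discrete_comp f (discrete_coordinate 0)).
have f0 : mean (distribution P X) (fun w => f (w 0)) = 0.
  rewrite (mean_distribution X bfQ); apply: EFin_inj.
  by rewrite -(expectation_mean (bounded_integ P (bf 0))).
(* [2 * B] bounds the oscillation of [f]. *)
pose r j := 2 * B * rho g j.+1.
have r0 j : 0 <= r j by rewrite mulr_ge0 ?rho_ge0// mulr_ge0.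
have [D' hD'] := rho_summable gg hprod.
pose D := 2 * B * D'.
have rD n : \sum_(j < n) r j <= D.
  rewrite -mulr_sumr ler_wpM2l ?mulr_ge0//; apply: (le_trans _ (hD' n.+1)).
  by rewrite big_ord_recl/= lerDr rho_ge0.
have mix a k j (z : seq E -> R) :
    `|mean P (fun w => z (word (letter X) a k w) * f (letter X (a + k + j)%N w))| <=
    r j * mean P (fun w => `|z (word (letter X) a k w)|).
  have := g_chain_decoupling gg hX fC f0 a k j z.
  have bz : bounded_rv (fun w : Omega E => z (word (fun i (w : Omega E) => w i%:Z) a k w)).
    by apply: (bounded_word (F := fun i (w : Omega E) => w i%:Z)) => i; exact: discrete_coordinate.
  have bfj : bounded_rv (fun w : Omega E => f (w (a + k + j)%N%:Z)).
    apply: (bounded_discrete (M := B)) => [|w]; last exact: fB.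
    exact: (discrete_comp f (discrete_coordinate _)).
  by rewrite (mean_distribution X (boundedM bz bfj)) (mean_distribution X (bounded_norm bz)).
have stat i j : mean P (fun w => f (letter X i w) * f (letter X (i + j)%N w)) =
    cov P (letter X) f j.
  have bfj : bounded_rv (fun w : Omega E => f (w j%:Z)).
    apply: (bounded_discrete (M := B)) => [|w]; last exact: fB.
    exact: (discrete_comp f (discrete_coordinate _)).
  have b0j := boundedM bfQ bfj.
  rewrite /cov -(mean_distribution X b0j) -(mean_shift hX i b0j).
  rewrite (mean_distribution X (bounded_shift i%:Z b0j)); apply: eq_mean => w.
  by rewrite /letter /shift add0r PoszD [i%:Z + _]addrC.
have iidU := iid_next_block htau.
pose G (v : seq E) := \sum_(x <- v) f x.
have dT1 := discrete_first_time htau.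
have iL := integ_size gg htau hprod.
have mu1 := mean_size_ge1 gg htau hprod.
have ren : {ae P, forall w, forall m,
    word_sum (letter X) f 0 (first_time tau w + \sum_(i < m) size (next_block X tau i w))%N w =
    word_sum (letter X) f 0 (first_time tau w) w + partial_sum (next_block X tau) G m w}.
  by apply: filterS (ae_ordered_times htau) => w ordw m; exact: word_sum_next_block.
have iY2 := integ_block_sqr dF B0 fB r0 rD mix iidU dT1 (len := size) iL (G := G) ren.
have clt := sum_clt dF B0 fB r0 rD mix
  iidU dT1 (len := size) iL mu1 (G := G) ren.
have sqr := sum_sqr_cvg dF B0 fB r0 rD mix
  iidU dT1 (len := size) iL mu1 (G := G) ren.
set V := mean P (fun w => G (next_block X tau 0 w) ^+ 2) in clt sqr.
set mu := mean P (fun w => (size (next_block X tau 0 w))%:R) in mu1 clt sqr.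
have V0 : 0 <= V by apply: mean_ge0 => w; exact: sqr_ge0.
have mu0 : 0 < mu := lt_le_trans ltr01 mu1.
have eL : ('E_P[(fun w => (tau 2 w - tau 1 w)%:~R)%R] = mu%:E)%E.
  apply: expectation_ae_eq => //.
    apply: discrete_measurable.
    exact: (discrete_comp (fun p : int * int => (p.1 - p.2)%:~R)
      (discrete_pair (discrete_time htau 2) (discrete_time htau 1))).
  apply: filterS (ae_ordered_times htau) => w /(size_next_blockE X 0) e.
  by rewrite -[tau 2 w - tau 1 w]/(tau (1%:Z + 1) w - tau 1%:Z w) -e.
move=> sigma2.
have s2E : sigma2 = (V / mu)%:E.
  rewrite /sigma2 eL (_ : 'E_P[_] = V%:E)%E; last exact: (expectation_mean iY2).
  by rewrite inver gt_eqF.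
have s20 : 0 <= V / mu by rewrite divr_ge0// ltW.
split.
- by rewrite s2E lee_fin s20 ltry.
- move=> h ch bh; rewrite s2E/= (centered_normal_gauss s20).
  have [M hM] := bh.
  have mh : measurable_fun setT h by exact: continuous_measurable_fun.
  rewrite (integral_mean (bounded_integ_gauss 0 _ mh hM)).
  have e n : ('E_P[h \o (fun w => (Num.sqrt n%:R)^-1 * \sum_(0 <= i < n) f (X w i%:Z))%R] =
      (mean P (fun w => h ((Num.sqrt n%:R)^-1 * word_sum (letter X) f 0 n w)%R))%:E)%E.
    rewrite -expectation_mean.
      congr expectation; apply/funext => w /=; rewrite word_sum_bigE big_mkord.
      by congr (h (_ * _)); apply: eq_bigr => i _; rewrite add0n.
    apply: (integ_bounded P (M := M)) => [|w]; last exact: hM.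
    apply: discrete_measurable.
    exact: (discrete_comp (fun v => h ((Num.sqrt n%:R)^-1 * \sum_(x <- v) f x)) (discrete_word dF 0 n)).
  under eq_fun do rewrite e.
  by apply: cvg_EFin; [exact: nearW|exact: clt].
move=> _.
have eC i : ('E_P[(fun w => f (X w 0) * f (X w i%:Z))%R] = (cov P (letter X) f i)%:E)%E.
  exact: (expectation_mean (bounded_integ P (boundedM (bf 0) (bf i%:Z)))).
pose c j := cov P (letter X) f j.
have sums n : (\sum_(1 <= i < n.+1) 'E_P[(fun w => f (X w 0) * f (X w i%:Z))%R] =
    (series (fun j => c j.+1) n)%:E)%E.
  by rewrite /series/= -sumEFin big_add1; apply: eq_bigr => i _; rewrite eC.
have cs := cov_summable dF B0 fB r0 rD mix.
have cvs : (\sum_(1 <= i < n) 'E_P[(fun w => f (X w 0) * f (X w i%:Z))%R] @[n --> \oo] -->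
    (limn (series (fun j => c j.+1)))%:E)%E.
  rewrite -cvg_shiftS/=; under eq_fun do rewrite sums.
  by apply: cvg_EFin; [exact: nearW|exact: cs].
split; first by apply/cvg_ex; eexists; exact: cvs.
rewrite (cvg_lim _ cvs)//.
rewrite (_ : 'E_P[_] = (c 0%N)%:E)%E; last first.
  rewrite -eC; congr expectation; apply/funext => w; exact: expr2.
rewrite s2E -EFinM -EFinD; congr EFin.
(* Both expressions are limits of the mean square of the normalized sum, hence equal. *)
have sqr' := mean_sqr_sum_cvg dF B0 fB r0 rD mix stat.
exact: (etrans (esym (cvg_lim (@Rhausdorff R) sqr)) (cvg_lim (@Rhausdorff R) sqr')).
Qed.
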